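(* Let $1\le p\le2$. Let $(Y_i)_{i\in\mathbb Z}$ be a strictly stationary sequence of real-valued random variables with marginal density $f$ with respect to Lebesgue measure $\lambda$ on $\mathbb R$. Assume that $\sum_{k=0}^n\beta_{1,Y}(k)=O(n^\delta)$ for some $\delta\in[0,1)$. Let $r\ge0$ be an integer and assume that either $f\mathbf 1_{[0,1]}\in\mathrm{Lip}^*(s,\mathbb L^p([0,1],\lambda))$ with $0<s<r+1$, or $f\mathbf 1_{[0,1]}\in W^s(\mathbb L^p([0,1],\lambda))$ with $s=r+1$. Then, taking $m_n=[Cn^{(1-\delta)/(2s+1)}]$ with a constant $C>0$ (where $[\cdot]$ is the integer part), the piecewise polynomial estimator $f_n$ of order $r$ on the regular partition of $]0,1]$ into $m_n$ intervals (see context) satisfies $$\mathbb E\Big(\int_0^1|f_n(x)-f(x)|^p\,dx\Big)=O\Big(n^{\frac{-ps(1-\delta)}{2s+1}}\Big).$$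
   Context: Estimator: let $(Q_i)_{1\le i\le r+1}$ be an orthonormal basis (in $\mathbb L^2([0,1],\lambda)$) of the space of polynomials of order $r$ (degree at most $r$) on $[0,1]$; set $R_i(x)=Q_i(x)$ if $x\in]0,1]$ and $R_i(x)=0$ otherwise. For $1\le i\le r+1$, $1\le j\le m_n$, let $\varphi_{i,j}(x)=\sqrt{m_n}\,R_i(m_nx-(j-1))$, $X_{i,j,n}=\frac1n\sum_{k=1}^n\varphi_{i,j}(Y_k)$ and $f_n=\sum_{i=1}^{r+1}\sum_{j=1}^{m_n}X_{i,j,n}\varphi_{i,j}$ (defined for $n$ large enough that $m_n\ge1$). Function spaces ($f\mathbf 1_{[0,1]}$ is regarded as a function on $[0,1]$): for a positive integer $s$, $W^s(\mathbb L^p([0,1],\lambda))$ is the Sobolev space of functions such that $g^{(s-1)}$ is absolutely continuous with almost everywhere derivative $g^{(s)}\in\mathbb L^p([0,1],\lambda)$. For $s>0$, $\mathrm{Lip}^*(s,\mathbb L^p([0,1],\lambda))$ is the generalized Lipschitz space of DeVore and Lorentz (a Besov space $B_{s,p,\infty}$): functions $g\in\mathbb L^p([0,1],\lambda)$ with $\sup_{t>0}t^{-s}\omega_m(g,t)_p<\infty$, where $m=[s]+1$ and $\omega_m(g,t)_p=\sup_{0<u\le t}\|\Delta_u^mg\|_{\mathbb L^p([0,1-mu])}$ is the $m$-th modulus of smoothness, $\Delta_u^m$ being the $m$-th order forward difference with step $u$. Dependence coefficients: let $P$ be the law of $Y_0$, $\mathcal F_\ell=\sigma(Y_i,i\le\ell)$,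 and let $P_{Y_k|\mathcal F_\ell}$ be the conditional distribution of $Y_k$ given $\mathcal F_\ell$. With $f_t=\mathbf 1_{]-\infty,t]}$ for $t\in\mathbb R$ and $Q(g)=\int g\,dQ$, let $b_\ell(k)=\sup_{t\in\mathbb R}|P_{Y_k|\mathcal F_\ell}(f_t)-P(f_t)|$ and $\beta_{1,Y}(k)=\mathbb E(b_0(k))$. *)

(* Defs.v *)
From HB Require Import structures.
From mathcomp Require Import all_boot all_order all_algebra.
From mathcomp Require Import all_classical all_reals all_analysis.

Set Implicit Arguments.
Unset Strict Implicit.
Unset Printing Implicit Defensive.
Import Order.TTheory GRing.Theory Num.Theory.
Import numFieldNormedType.Exports.

Local Open Scope classical_set_scope.
Local Open Scope ring_scope.

Section FunctionSpaces.
Variable R : realType.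
Implicit Types (g h : R -> R) (p s t u x : R).

Local Notation mu := (@lebesgue_measure R).

(* A function on [0,1] is represented by any function on R; only its values on
   [0,1] matter. *)
Definition Lp01 p g : Prop := g \_ `[0, 1] \in Lfun mu p%:E.

(* Derivative relative to [0,1], hence one-sided at 0 and at 1. *)
Definition deriv01 g x (l : R) : Prop :=
  (fun y => (g y - g x) / (y - x)) @ within `[0, 1] (dnbhs x) --> l.

Definition abs_cont01 g : Prop :=
  forall e : R, 0 < e -> exists2 d : R, 0 < d &
    forall (n : nat) (a b : 'I_n -> R),
      (forall i, 0 <= a i /\ a i <= b i /\ b i <= 1) ->
      (forall i j, i != j -> b i <= a j \/ b j <= a i) ->
      \sum_(i < n) (b i - a i) < d ->
      \sum_(i < n) `|g (b i) - g (a i)| < e.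

(* W^k(L^p([0,1])), meant for k >= 1. Elements are classes modulo equality
   almost everywhere: D 0 is the regular representative of g, and D i is its
   i-th derivative (only almost everywhere for i = k). *)
Definition sobolev01 (k : nat) p g : Prop :=
  exists D : nat -> R -> R,
    [/\ {ae mu, forall x, `[0, 1]%classic x -> g x = D 0%N x},
        forall (i : nat) x, (i < k.-1)%N -> `[0, 1]%classic x ->
          deriv01 (D i) x (D i.+1 x),
        abs_cont01 (D k.-1),
        {ae mu, forall x, `[0, 1]%classic x ->
          deriv01 (D k.-1) x (D k x)} &
        Lp01 p (D k)].

Definition fwd_diff u g : R -> R := fun x => g (x + u) - g x.

(* The interval [0, 1 - m u] is empty, and the norm is 0, when m u > 1. *)
Definition modulus01 (m : nat) p g t : \bar R :=
  ereal_sup [set Lnorm mu p%:E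
                   (EFin \o (iter m (fwd_diff u) g \_ `[0, 1 - m%:R * u]))
            | u in `]0, t]].

Definition lip_star01 s p g : Prop :=
  Lp01 p g /\
  (ereal_sup [set ((t `^ (- s))%R%:E * modulus01 (Num.truncn s).+1 p g t)%E
             | t in [set t : R | (0 < t)%R]] < +oo)%E.

End FunctionSpaces.

Section Process.
Context {d : measure_display} {T : measurableType d} {R : realType}.
Variables (P : probability T R) (Y : int -> {RV P >-> R}).

Definition strictly_stationary : Prop :=
  forall (n : nat) (t : n.-tuple int) (h : int) (B : set (n.-tuple R)),
    measurable B ->
    P [set w | B [tuple Y (tnth t i + h) w | i < n]] =
    P [set w | B [tuple Y (tnth t i) w | i < n]].

(* Generating family of the sigma-algebra F_l of the Y_i, i <= l. *)
Definition past (l : int) : set (set T) :=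
  [set A | exists2 i : int, i <= l &
     exists2 B : set R, measurable B & A = Y i @^-1` B].

(* Regular version of the conditional law of X given F_l; the F_l-measurability
   of w |-> kappa w B is part of the kernel structure. *)
Definition cond_distribution (l : int) (X : {RV P >-> R})
    (kappa : R.-pker (g_sigma_algebraType (past l)) ~> R) : Prop :=
  forall (A : set T) (B : set R), <<s past l >> A -> measurable B ->
    P (A `&` X @^-1` B) = (\int[P]_(w in A) kappa w B)%E.

(* b_l(k) when kappa is the conditional law of Y_k given F_l; Q(f_t) is
   Q(]-oo, t]). *)
Definition dep_b (l : int)
    (kappa : R.-pker (g_sigma_algebraType (past l)) ~> R) (w : T) : \bar R :=
  ereal_sup [set `|kappa w `]-oo, t]%classic - distribution P (Y 0) `]-oo, t]%classic|%E
            | t in [set: R]].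

Definition beta1
    (kappa : nat -> R.-pker (g_sigma_algebraType (past 0)) ~> R)
    (k : nat) : \bar R :=
  (\int[P]_w dep_b (kappa k) w)%E.

Definition has_density (X : {RV P >-> R}) (f : R -> R) : Prop :=
  [/\ measurable_fun setT f, forall x, 0 <= f x &
      forall B : set R, measurable B ->
        distribution P X B = (\int[lebesgue_measure]_(x in B) (f x)%:E)%E].

End Process.

Section Estimator.
Variable R : realType.

Definition orthonormal_basis01 (r : nat) (Q : 'I_r.+1 -> {poly R}) : Prop :=
  [/\ forall i, (size (Q i) <= r.+1)%N,
      forall i j,
        (\int[lebesgue_measure]_(x in `[0%R, 1%R]) ((Q i).[x] * (Q j).[x])%:E
         = ((i == j)%:R)%:E)%E &
      forall q : {poly R}, (size q <= r.+1)%N ->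
        exists c : 'I_r.+1 -> R, q = \sum_(i < r.+1) c i *: Q i].

Definition poly_cell (q : {poly R}) (x : R) : R :=
  if (0 < x) && (x <= 1) then q.[x] else 0.

(* phi_{i,j} for Q i = q; cells are numbered from 0, so j stands for j - 1. *)
Definition phi (m : nat) (q : {poly R}) (j : nat) (x : R) : R :=
  Num.sqrt m%:R * poly_cell q (m%:R * x - j%:R).

Definition coefX (T : Type) (Y : int -> T -> R) (n m : nat) (q : {poly R})
    (j : nat) (w : T) : R :=
  n%:R^-1 * \sum_(1 <= k < n.+1) phi m q j (Y k%:Z w).

Definition estimator (T : Type) (Y : int -> T -> R) (r : nat)
    (Q : 'I_r.+1 -> {poly R}) (n m : nat) (w : T) (x : R) : R :=
  \sum_(i < r.+1) \sum_(j < m) coefX Y n m (Q i) j w * phi m (Q i) j x.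

End Estimator.

(* u_n = O(v_n), for a nonnegative extended real sequence u; in particular u is
   eventually finite. *)
Definition ebigO (R : realType) (u : nat -> \bar R) (v : nat -> R) : Prop :=
  exists M : R, \forall n \near \oo, (u n <= (M * v n)%:E)%E.

(* Main.v *)
Require Import Defs.
From HB Require Import structures.
From mathcomp Require Import all_boot all_order all_algebra.
From mathcomp Require Import all_classical all_reals all_analysis.
From mathcomp Require Import measurable_realfun qpoly ring lra zify.
Import Order.TTheory GRing.Theory Num.Theory.
Import numFieldNormedType.Exports.
Local Open Scope classical_set_scope.
Local Open Scope ring_scope.

(** The estimator is a random perturbation of the orthogonal projection
[projection] of the density [f] onto the piecewise polynomials of degree at most
[r] with [m] cells, and the risk is at most of the order of
[E (\int `|estimator - projection| `^ p) + \int `|projection - f| `^ p].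

Bias. The projection is local, stable in [L^p], and reproduces piecewise
polynomials, so that its error is of the order of that of any piecewise polynomial
approximation of [f] ([projection_error]). The one used is the derivative of
the polynomial that interpolates a primitive [F] of [f] at equidistant points of
each cell ([quasi_interp]). When the cells are halved it changes, on each cell, by
a multiple of the differences of order [d + 2] of [F] on the finer grid; these
changes form a geometric series when the differences decrease like
[m `^ (- s)] in [l^p] norm ([diff_rate]), and the refined approximations converge
to [f] almost everywhere by Lebesgue's differentiation theorem. Hence an error of
order [m `^ (- s)] ([quasi_interp_error]). The differences of [F] are integrals of
differences of [f]: for a generalized Lipschitz function Jensen's inequality bounds
them by the moduli of smoothness ([lip_star_diff_rate]); for a Sobolev function
they are bounded by integrals of the last derivative, through the mean value
theorem and absolute continuity ([sobolev_diff_rate]).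

Stochastic term. As [p <= 2], for every [e > 0] the function [`|x| `^ p] is at most
[e `^ p + e `^ (p - 2) * x ^+ 2] ([powR_le_square]), so that only the variances of
the empirical coefficients matter. By stationarity they are averages of
covariances between times [0] and [u]. Each basis function is replaced by a step
function on a fine grid; the covariance is then a sum over pairs of small cells,
and an Abel summation over the cells that contain [Y_u] turns it into
covariances with events [Y_u <= t], which conditioning on the past bounds by
integrals of the deviation of the conditional distribution function
([covariance_half_line]). This deviation is integrated over the events that [Y_0]
is in a given small cell; these events are disjoint, hence summing over all the
cells gives a single coefficient [beta1 kappa u], times [m] ([block_cov_bound]).
The sum of the variances is therefore of order [m / n] times the sum of the first
dependence coefficients ([variance_bound]), that is [m * n `^ (delta - 1)].

Balance. With [a = (1 - delta) / (2 * s + 1)] and [m] of order [n `^ a], the squared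
bias and the variance are both of order [n `^ (- (2 * s * a))]; taking
[e = n `^ (- (s * a))] gives the rate. *)

(** * Differences of sequences and polynomial interpolation *)

Section Interpolation.
Context {R : realType}.
Implicit Types (A B : nat -> R) (q : {poly R}) (c y : R) (d e i j n : nat).

Definition seq_diff j A : nat -> R := iter j (fun B n => B n.+1 - B n) A.

Lemma seq_diffS j A n :
  seq_diff j.+1 A n = seq_diff j (fun n => A n.+1 - A n) n.
Proof. by rewrite /seq_diff iterSr. Qed.

Lemma seq_diffSl j A n :
  seq_diff j.+1 A n = seq_diff j A n.+1 - seq_diff j A n.
Proof. by []. Qed.

Lemma eq_seq_diff j A B n : A =1 B -> seq_diff j A n = seq_diff j B n.
Proof. by move=> AB; congr (seq_diff j _ n); apply/funext. Qed.

Lemma seq_diffB j A B n :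
  seq_diff j (fun n => A n - B n) n = seq_diff j A n - seq_diff j B n.
Proof. by elim: j n => // j IH n; rewrite !seq_diffSl !IH; ring. Qed.

(** The discrete Leibniz rule for a product with the identity. *)
Lemma seq_diff_mul_id j A c n :
  seq_diff j (fun n => A n * (n%:R * c)) n =
  seq_diff j A n * (n%:R * c) +
  j%:R * c * (if j is j'.+1 then seq_diff j' A n.+1 else 0).
Proof.
elim: j n => [|j IH] n; first by rewrite /= mul0r mul0r addr0.
rewrite !seq_diffSl !IH.
by case: j {IH} => [|j]; rewrite ?seq_diffSl -?natr1 /=; ring.
Qed.

(** By induction on the degree, the Leibniz rule peeling off one factor [X] at a
time. *)
Lemma seq_diff_poly q j c n : (size q <= j)%N ->
  seq_diff j (fun n => q.[n%:R * c]) n = 0.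
Proof.
elim/poly_ind: q j n => [|q a IH] j n.
  move=> _; elim: j n => [|j IH] n; first by rewrite /= horner0.
  by rewrite seq_diffSl !IH subrr.
case: j => [|j] sq.
  move: sq; rewrite leqn0 size_poly_eq0 => /eqP ->.
  by rewrite /= horner0.
have {}sq : (size q <= j)%N.
  have [->|q0] := eqVneq q 0; first by rewrite size_poly0.
  by move: sq; rewrite size_MXaddC (negbTE q0).
have sd : seq_diff j.+1 (fun n => q.[n%:R * c] * (n%:R * c)) n = 0.
  by rewrite seq_diff_mul_id !IH ?mul0r ?mulr0 ?addr0 // ltnW.
rewrite -[RHS]sd [LHS]seq_diffS [RHS]seq_diffS.
by apply: eq_seq_diff => k; rewrite !hornerE; ring.
Qed.

(** The last term of a difference has coefficient [1], so it is recovered from the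
difference and the earlier terms. *)
Lemma seq_diff_lead j : exists2 c : R, 0 <= c & forall A n,
  `|A (n + j)%N| <= `|seq_diff j A n| + c * \sum_(i < j) `|A (n + i)%N|.
Proof.
elim: j => [|j [c c0 IH]].
  by exists 0 => // A n; rewrite big_ord0 mulr0 addr0 addn0.
exists (1 + c *+ 2) => [|A n]; first by rewrite addr_ge0 // mulrn_wge0.
set S := \sum_(i < j.+1) _.
have S0 : 0 <= S by exact: sumr_ge0.
have h1 : `|A (n + j)%N| <= S.
  by rewrite /S big_ord_recr /= lerDr sumr_ge0.
have h2 : \sum_(i < j) `|A (n + i).+1 - A (n + i)%N| <= S *+ 2.
  apply: (@le_trans _ _ (\sum_(i < j) (`|A (n + i).+1| + `|A (n + i)%N|))).
    by apply: ler_sum => i _; exact: ler_normB.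
  rewrite big_split mulr2n lerD //= /S.
    rewrite big_ord_recl; under [X in _ <= _ + X]eq_bigr do rewrite lift0 addnS.
    by rewrite lerDr.
  by rewrite big_ord_recr /= lerDl.
have := IH (fun n => A n.+1 - A n) n.
rewrite -seq_diffS /= => h3.
have h4 : c * (\sum_(i < j) `|A (n + i).+1 - A (n + i)%N|) <= c * (S *+ 2).
  exact: ler_wpM2l.
have : `|A (n + j).+1| <= `|A (n + j)%N| + `|A (n + j).+1 - A (n + j)%N|.
  by rewrite -{1}(subrKC (A (n + j)%N) (A (n + j).+1)) ler_normD.
rewrite addnS.
rewrite mulrnAr in h4; rewrite mulrDl mul1r mulrnAl => h5.
lra.
Qed.

(** A sequence that starts with [d.+2] zeros is controlled by its differences
of order [d.+2], since these determine it. *)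
Lemma seq_diff_control d n : exists2 c : R, 0 <= c & forall A,
  (forall i, (i < d.+2)%N -> A i = 0) ->
  forall i, (i <= n)%N -> (i <= d.+1.*2)%N ->
    `|A i| <= c * \sum_(l < d.+1) `|seq_diff d.+2 A l|.
Proof.
elim: n => [|n [c c0 IH]].
  exists 0 => // A A0 [|//] _ _.
  by rewrite A0 // normr0 mul0r.
have [b b0 bP] := seq_diff_lead d.+2.
exists (1 + c + b * (d.+2%:R * c)) => [|A A0 i].
  by rewrite addr_ge0 ?addr_ge0 ?mulr_ge0.
set S := \sum_(l < _) _.
have S0 : 0 <= S by exact: sumr_ge0.
rewrite leq_eqVlt => /predU1P[->|lin] ind; last first.
  apply: (le_trans (IH A A0 i lin ind)).
  rewrite -/S ler_wpM2r //.
  have : 0 <= b * (d.+2%:R * c) by rewrite ?mulr_ge0.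
  lra.
have [n2|n2] := ltnP n.+1 d.+2.
  by rewrite A0 // normr0 mulr_ge0 // addr_ge0 ?addr_ge0 ?mulr_ge0.
have ltd : (n.+1 - d.+2 < d.+1)%N by lia.
have := bP A (n.+1 - d.+2)%N.
rewrite subnK // => /le_trans; apply.
have h1 : `|seq_diff d.+2 A (n.+1 - d.+2)| <= S.
  rewrite /S (bigD1 (Ordinal ltd)) //= lerDl sumr_ge0 //.
have h2 : \sum_(i < d.+2) `|A (n.+1 - d.+2 + i)%N| <= d.+2%:R * c * S.
  apply: (@le_trans _ _ (\sum_(i < d.+2) c * S)).
    by apply: ler_sum => k _; apply: IH => //; have := ltn_ord k; lia.
  by rewrite sumr_const card_ord -mulrA -[leLHS]mulr_natl.
have h3 := ler_wpM2l b0 h2.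
have : 0 <= c * S by rewrite mulr_ge0.
have -> : (1 + c + b * (d.+2%:R * c)) * S = S + c * S + b * (d.+2%:R * c * S).
  by ring.
lra.
Qed.

Definition knot d i : R := i%:R / d.+1%:R.

Lemma knot_inj d : injective (knot d).
Proof.
move=> i j /(congr1 (fun x => x * d.+1%:R)).
by rewrite !divfK ?pnatr_eq0 // => /eqP; rewrite eqr_nat => /eqP.
Qed.

(** The polynomial of degree at most [d.+1] with value [A i] at the [i]-th of the
[d.+2] equidistant knots of the unit interval. *)
Definition interp d A : {poly R} :=
  \sum_(i < d.+2) A i *: val (tnth (lagrange d.+2 (knot d)) i).

Lemma size_interp d A : (size (interp d A) <= d.+2)%N.
Proof.
apply: (leq_trans (size_sum _ _ _)).
apply/bigmax_leqP => i _.
apply: (leq_trans (size_scale_leq _ _)).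
rewrite size_lagrange_ //; exact: knot_inj.
Qed.

Lemma interp_knot d A i : (i < d.+2)%N -> (interp d A).[knot d i] = A i.
Proof.
move=> id; rewrite /interp horner_sum (bigD1 (Ordinal id)) //= big1.
  have -> : knot d i = knot d (Ordinal id) by [].
  by rewrite hornerZ lagrange_sample ?eqxx ?mulr1 ?addr0 //; exact: knot_inj.
move=> j ji; have -> : knot d i = knot d (Ordinal id) by [].
rewrite hornerZ lagrange_sample ?(negbTE ji) ?mulr0 //; exact: knot_inj.
Qed.

Lemma interp_poly d A q : (size q <= d.+2)%N ->
  (forall i, (i < d.+2)%N -> A i = q.[knot d i]) -> interp d A = q.
Proof.
move=> sq Aq; rewrite [RHS](lagrange_gen _ (knot_inj d) sq) //.
by apply: eq_bigr => i _; rewrite mul_polyC Aq.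
Qed.

Lemma interpB d A B : interp d (fun i => A i - B i) = interp d A - interp d B.
Proof. by rewrite /interp -sumrB; apply: eq_bigr => i _; rewrite scalerBl. Qed.

Lemma poly_bounded01 q : exists2 c : R, 0 <= c &
  forall y, 0 <= y <= 1 -> `|q.[y]| <= c.
Proof.
exists (\sum_(i < size q) `|q`_i|) => [|y /andP[y0 y1]]; first exact: sumr_ge0.
rewrite horner_coef; apply: (le_trans (ler_norm_sum _ _ _)).
apply: ler_sum => i _; rewrite normrM normrX (ger0_norm y0).
by rewrite ler_piMr // exprn_ile1.
Qed.

(** The interpolant depends linearly on the values, through [d.+2] fixed
polynomials. *)
Lemma interp_deriv_bound d : exists2 c : R, 0 <= c & forall A (a : R) y,
  (forall i, (i < d.+2)%N -> `|A i| <= a) -> 0 <= y <= 1 ->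
  `|(interp d A)^`().[y]| <= c * a.
Proof.
pose l (i : 'I_d.+2) := (val (tnth (lagrange d.+2 (knot d)) i))^`().
pose c (i : 'I_d.+2) := sval (cid2 (poly_bounded01 (l i))).
have c0 (i : 'I_d.+2) : 0 <= c i by rewrite /c; case: cid2.
have cP (i : 'I_d.+2) y : 0 <= y <= 1 -> `|(l i).[y]| <= c i.
  by rewrite /c; case: cid2 => /= x _; exact.
exists (\sum_i c i) => [|A a y Aa y01]; first exact: sumr_ge0.
rewrite /interp (big_morph _ (@derivD R) (deriv0 R)) horner_sum mulr_suml.
apply: (le_trans (ler_norm_sum _ _ _)).
apply: ler_sum => i _; rewrite derivZ hornerZ normrM mulrC.
by apply: ler_pM => //; [exact: cP|exact: Aa].
Qed.

(** Interpolation at the knots of a cell and at those of one of its halves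
both reproduce polynomials of degree [d.+1]; up to such a polynomial, the
sequence is controlled by its differences of order [d.+2], hence so is the
change in the interpolant when the cell is halved. *)
Lemma interp_two_scale d : exists2 c : R, 0 <= c & forall A e y,
  (e <= 1)%N -> 0 <= y <= 1 ->
  `|2 * (interp d (fun i => A (e * d.+1 + i)%N))^`().[y] -
    (interp d (fun i => A i.*2))^`().[(y + e%:R) / 2]| <=
  c * \sum_(l < d.+1) `|seq_diff d.+2 A l|.
Proof.
have [c c0 cP] := interp_deriv_bound d.
have [b b0 bP] := seq_diff_control d d.+1.*2.
exists (3 * c * b) => [|A e y e1 /andP[y0 y1]]; first by rewrite !mulr_ge0.
(* Subtracting the interpolant of the first d.+2 terms makes these vanish and
   leaves the differences of order d.+2 unchanged. *)
set q := interp d A.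
set r := fun n => A n - q.[knot d n].
have rE : forall i, (i < d.+2)%N -> r i = 0.
  by move=> i id; rewrite /r interp_knot // subrr.
have drE l : seq_diff d.+2 r l = seq_diff d.+2 A l.
  by rewrite seq_diffB seq_diff_poly ?subr0 // size_interp.
set S := \sum_(l < _) _.
have S0 : 0 <= S by exact: sumr_ge0.
have rS i : (i <= d.+1.*2)%N -> `|r i| <= b * S.
  move=> id; apply: (le_trans (bP r rE i id id)).
  by under eq_bigr do rewrite drE.
have E1 : interp d (fun i => A (e * d.+1 + i)%N) =
    (q \Po ('X + e%:R%:P)) + interp d (fun i => r (e * d.+1 + i)%N).
  rewrite interpB addrC -[RHS]addrA [X in _ = _ + X](_ : _ = 0) ?addr0 //.
  apply/eqP; rewrite addrC subr_eq0; apply/eqP/esym/interp_poly.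
    rewrite size_comp_poly2 ?size_interp // size_XaddC //.
  move=> i id; rewrite horner_comp !hornerE; congr _.[_].
  by rewrite /knot natrD natrM mulrDl mulfK ?pnatr_eq0 // addrC.
have E2 : interp d (fun i => A i.*2) =
    (q \Po (2 *: 'X)) + interp d (fun i => r i.*2).
  rewrite interpB addrC -[RHS]addrA [X in _ = _ + X](_ : _ = 0) ?addr0 //.
  apply/eqP; rewrite addrC subr_eq0; apply/eqP/esym/interp_poly.
    rewrite size_comp_poly2 ?size_interp // size_scale ?size_polyX //.
  move=> i id; rewrite horner_comp hornerZ hornerX; congr _.[_].
  by rewrite /knot -mul2n natrM mulrA.
have e01 : 0 <= (e%:R : R) <= 1 by rewrite ler0n lern1.
have y2 : 0 <= (y + e%:R) / 2 <= 1.
  by move/andP: e01 => [? ?]; apply/andP; split; lra.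
have h1 : `|(interp d (fun i => r (e * d.+1 + i)%N))^`().[y]| <= c * (b * S).
  apply: cP; last by rewrite y0.
  move=> i id; apply: rS; case: e e1 {E1 e01 y2} => [|[|//]] _; lia.
have h2 : `|(interp d (fun i => r i.*2))^`().[(y + e%:R) / 2]| <= c * (b * S).
  by apply: cP => // i id; apply: rS; rewrite leq_double.
rewrite E1 E2 !(derivD, deriv_comp, derivX, derivC, derivZ).
rewrite !(hornerD, hornerM, hornerC, hornerX, hornerZ, horner_comp).
have -> : (2 * ((y + e%:R) / 2)) = y + e%:R by field.
rewrite [X in `|X|](_ : _ =
  2 * (interp d (fun i => r (e * d.+1 + i)%N))^`().[y] -
  (interp d (fun i => r i.*2))^`().[(y + e%:R) / 2]); last by ring.
apply: (le_trans (ler_normB _ _)); rewrite normrM ger0_norm //.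
rewrite -!mulrA; lra.
Qed.

End Interpolation.

(** * Power inequalities and integrals over cells *)

Section PowerInequalities.
Context {R : realType}.
Implicit Types (a b p x y : R).

(** Each term is at most the largest one. *)
Lemma powR_sum_le p n (a : 'I_n -> R) : 1 <= p -> (forall i, 0 <= a i) ->
  (\sum_i a i) `^ p <= n%:R `^ p * \sum_i a i `^ p.
Proof.
move=> p1 a0; have p0 : 0 <= p by rewrite (le_trans _ p1).
case: n a a0 => [|n] a a0.
  by rewrite !big_ord0 mulr0 powR0 // gt_eqF // (lt_le_trans _ p1).
pose k := [arg max_(i > ord0) a i]%O.
have ak i : a i <= a k by rewrite /k; case: arg_maxP => // j _ /(_ i); exact.
apply: (@le_trans _ _ ((n.+1%:R * a k) `^ p)).
  rewrite ge0_ler_powR ?nnegrE ?sumr_ge0 ?mulr_ge0 //.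
  apply: (@le_trans _ _ (\sum_(i < n.+1) a k)); first exact: ler_sum.
  by rewrite sumr_const card_ord -[leLHS]mulr_natl.
rewrite powRM // ler_wpM2l ?powR_ge0 // (bigD1 k) //= lerDl sumr_ge0 // => i _.
exact: powR_ge0.
Qed.

Lemma powRD_le p a b : 1 <= p -> p <= 2 -> 0 <= a -> 0 <= b ->
  (a + b) `^ p <= 4 * (a `^ p + b `^ p).
Proof.
move=> p1 p2 a0 b0.
have := @powR_sum_le p 2 (fun i => if i == ord0 then a else b) p1.
rewrite !big_ord_recl !big_ord0 /= !addr0 => h.
apply: (le_trans (h _)) => [i|]; first by case: ifP.
rewrite ler_wpM2r ?addr_ge0 ?powR_ge0 //.
have -> : 4 = 2 `^ 2%:R :> R by rewrite powR_mulrn // expr2 -natrM.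
by rewrite ler_powR // ler1n.
Qed.

(** Young's inequality for the exponents [p] and [p / (p - 1)], in the form of the
tangent to the graph of [x `^ p] at [y]. *)
Lemma powR_tangent p x y : 1 <= p -> 0 <= x -> 0 <= y ->
  p * y `^ (p - 1) * x <= x `^ p + (p - 1) * y `^ p.
Proof.
rewrite le_eqVlt => /predU1P[<-|p1] x0 y0.
  by rewrite subrr powRr0 !mul1r powRr1 // mul0r addr0.
have p0 : 0 < p by rewrite (lt_trans _ p1).
have q0 : 0 < p / (p - 1) by rewrite divr_gt0 // subr_gt0.
have := @conjugate_powR _ x (y `^ (p - 1)) p (p / (p - 1)) x0 (powR_ge0 _ _) p0 q0.
have p10 : p - 1 != 0 by rewrite gt_eqF // subr_gt0.
have pn0 : p != 0 by rewrite gt_eqF.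
rewrite -powRrM (_ : (p - 1) * (p / (p - 1)) = p); last by field.
move=> h; have {}h : x * y `^ (p - 1) <= x `^ p / p + y `^ p / (p / (p - 1)).
  apply: h; rewrite invf_div -[X in X + _]mul1r -mulrDl addrCA subrr addr0.
  by rewrite divff.
have := ler_wpM2l (ltW p0) h.
rewrite (_ : p * (x * y `^ (p - 1)) = p * y `^ (p - 1) * x); last by ring.
rewrite (_ : p * (_ + _) = x `^ p + (p - 1) * y `^ p) //.
by field; rewrite p10 pn0.
Qed.

Lemma continuous_powR_norm p : 1 <= p -> continuous (fun x => `|x| `^ p).
Proof.
move=> p1 x; have p0 : 0 < p by rewrite (lt_le_trans _ p1).
have [->|x0] := eqVneq x 0.
  rewrite /continuous_at normr0 powR0 ?gt_eqF //.
  apply/cvgrPdist_le => e e0; near=> y.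
  rewrite sub0r normrN ger0_norm ?powR_ge0 //.
  have [->|y0] := eqVneq y 0; first by rewrite normr0 powR0 ?gt_eqF // ltW.
  apply: (@le_trans _ _ `|y|).
    apply: ge1r_powR => //; rewrite normr_gt0 y0 /=; near: y.
    exact: (@nbhs0_le R R 1 ltr01).
  by near: y; exact: (@nbhs0_le R R e e0).
have nx : 0 < `|x| by rewrite normr_gt0.
have dp : derivable (@powR R ^~ p) `|x| 1.
  by apply: derivable_powR; rewrite in_itv /= nx.
apply: (@continuous_comp _ _ _ (fun z : R => `|z|) (@powR R ^~ p)).
  exact: norm_continuous.
by apply: differentiable_continuous; exact/derivable1_diffP.
Unshelve. all: by end_near. Qed.

End PowerInequalities.

Section IntegralTools.
Context {d : measure_display} {T : measurableType d} {R : realType}.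
Variable mu : {measure set T -> \bar R}.
Local Open Scope ereal_scope.
Import HBNNSimple.

(** The integral of a nonnegative function is a supremum over simple functions
below it, so it is monotone even for functions that are not measurable. *)
Lemma ge0_le_integral_nonmeasurable (D : set T) (f g : T -> \bar R) :
  (forall x, D x -> 0 <= f x) -> (forall x, D x -> f x <= g x) ->
  \int[mu]_(x in D) f x <= \int[mu]_(x in D) g x.
Proof.
move=> f0 fg; rewrite !(integral_mkcond D).
rewrite !ge0_integralTE.
- apply: ereal_sup_le => _ [h hf <-]; exists h => // x.
  rewrite (le_trans (hf x)) // !patchE; case: ifPn => // xD.
  by apply: fg; rewrite inE in xD.
- move=> x; rewrite patchE; case: ifPn => // /set_mem xD.
  by rewrite (le_trans (f0 _ xD)) // fg.
- by move=> x; rewrite patchE; case: ifPn => // /set_mem xD; exact: f0.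
Qed.

Lemma measurable_powR_norm (D : set T) (g : T -> R) (p : R) :
  measurable_fun D g -> measurable_fun D (fun x => (`|g x| `^ p)%:E).
Proof.
move=> mg; apply/measurable_EFinP.
apply: (measurableT_comp (measurable_powR p)).
exact: (measurableT_comp (@normr_measurable R setT)).
Qed.

(** Jensen's inequality, by integration of the tangent inequality at the mean value
[I / l] of [g]. *)
Lemma integral_powR_jensen (D : set T) (g : T -> R) (I l p : R) :
  measurable D -> measurable_fun D g -> (forall x, D x -> (0 <= g x)%R) ->
  mu D = l%:E -> (0 < l)%R -> (1 <= p)%R ->
  \int[mu]_(x in D) (g x)%:E = I%:E ->
  (I `^ p)%:E <= (l `^ (p - 1))%:E * \int[mu]_(x in D) (g x `^ p)%:E.
Proof.
move=> mD mg g0 mul l0 p1 gI.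
have p0 : (0 < p)%R by rewrite (lt_le_trans _ p1).
have I0 : (0 <= I)%R.
  by rewrite -lee_fin -gI integral_ge0 // => x Dx; rewrite lee_fin g0.
pose t := (I / l)%R.
have t0 : (0 <= t)%R by rewrite /t divr_ge0 // ltW.
have mgp : measurable_fun D (EFin \o (fun x => (g x `^ p)%R)).
  apply/measurable_EFinP; exact: (measurableT_comp (measurable_powR p) mg).
have h : (p * t `^ (p - 1))%:E * I%:E <=
    \int[mu]_(x in D) (g x `^ p)%:E + ((p - 1) * t `^ p)%:E * l%:E.
  have mgE : measurable_fun D (fun x => (g x)%:E) by exact/measurable_EFinP.
  have c0 : (0 <= p * t `^ (p - 1))%R by rewrite mulr_ge0 ?powR_ge0 // ltW.
  rewrite -gI -mul -integral_cst // -ge0_integralZl // -ge0_integralD //;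
    last 2 first.
  - by move=> x _; rewrite lee_fin powR_ge0.
  - by move=> x _; rewrite lee_fin mulr_ge0 ?powR_ge0 ?subr_ge0.
  apply: ge0_le_integral_nonmeasurable => x Dx.
    by rewrite -EFinM lee_fin ?mulr_ge0 ?powR_ge0 ?g0 // ltW.
  by rewrite -EFinM -EFinD lee_fin powR_tangent // g0.
have tl : (t * l = I)%R by rewrite /t divfK // gt_eqF.
have h2 : (t `^ p * l)%:E <= \int[mu]_(x in D) (g x `^ p)%:E.
  move: h; rewrite -!EFinM -leeBlDr // -EFinB; apply: le_trans.
  rewrite lee_fin -tl -(mulr_powRB1 t0 p0) le_eqVlt; apply/orP; left.
  by apply/eqP; ring.
apply: (@le_trans _ _ ((l `^ (p - 1))%:E * (t `^ p * l)%:E)); last first.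
  by rewrite lee_pmul2l // lte_fin powR_gt0.
rewrite -EFinM lee_fin -tl powRM // ?(ltW l0) //.
by rewrite -(mulr_powRB1 (ltW l0) p0) le_eqVlt; apply/orP; left; apply/eqP; ring.
Qed.

Lemma Rintegral_sum (I : Type) (s : seq I) (F : I -> T -> R) :
  (forall i, mu.-integrable setT (EFin \o F i)) ->
  mu.-integrable setT (EFin \o (fun w => (\sum_(i <- s) F i w)%R)) /\
  (\int[mu]_w (\sum_(i <- s) F i w) = \sum_(i <- s) \int[mu]_w F i w)%R.
Proof.
move=> Fi; elim: s => [|i s [si sE]].
  have E : (fun w => (\sum_(i <- [::]) F i w)%R) = (fun=> 0%R).
    by apply/funext => w; rewrite big_nil.
  rewrite E big_nil; split; last by rewrite Rintegral_cst // mul0r.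
  exact: integrable0.
have E : (fun w => (\sum_(j <- i :: s) F j w)%R) =
    (fun w => (F i w + \sum_(j <- s) F j w)%R).
  by apply/funext => w; rewrite big_cons.
rewrite E big_cons -sE -RintegralD //; split => //.
by have := integrableD measurableT (Fi i) si; apply: eq_integrable.
Qed.

End IntegralTools.

Section Cells.
Context {R : realType}.
Local Notation mu := (@lebesgue_measure R).
Implicit Types (h a x : R) (j m n : nat).

Definition cell h j : set R := [set` `]j%:R * h, j.+1%:R * h]].

Lemma measurable_cell h j : measurable (cell h j).
Proof. exact: measurable_itv. Qed.

Lemma lebesgue_cell h j : 0 < h -> mu (cell h j) = h%:E.
Proof.
move=> h0; rewrite /cell lebesgue_measure_itv /= lte_fin ltr_pM2r // ltr_nat.
by rewrite ltnSn -EFinD -mulrBl -natrB // subSnn mul1r.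
Qed.

Lemma cell_exists h n x : 0 < h -> 0 < x <= n%:R * h ->
  exists2 j, (j < n)%N & cell h j x.
Proof.
move=> h0; elim: n => [|n IH] /andP[x0 xn].
  by rewrite mul0r leNgt x0 in xn.
have [xh|hx] := leP x (n%:R * h).
  have [|j jn jx] := IH; first by rewrite x0.
  by exists j => //; rewrite ltnS ltnW.
by exists n => //=; rewrite /cell /= in_itv /= hx.
Qed.

Local Open Scope ereal_scope.

Lemma integral_cells (g : R -> \bar R) h n : (0 < h)%R ->
  (forall x, (0 < x <= n%:R * h)%R -> 0 <= g x) ->
  measurable_fun `]0%R, (n%:R * h)%R] g ->
  \int[mu]_(x in `]0%R, (n%:R * h)%R]) g x =
  \sum_(j < n) \int[mu]_(x in cell h j) g x.
Proof.
move=> h0; elim: n => [|n IH] g0 mg.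
  by rewrite big_ord0 mul0r set_itv_ge ?integral_set0 // bnd_simp ltxx.
have nh : (0 <= n%:R * h)%R by rewrite mulr_ge0 // ltW.
have nn : (n%:R * h <= n.+1%:R * h)%R by rewrite ler_pM2r // ler_nat.
have E : `]0%R, (n.+1%:R * h)%R]%classic =
    `]0%R, (n%:R * h)%R]%classic `|` cell h n :> set R.
  by rewrite /cell; apply: itv_bndbnd_setU; rewrite bnd_simp.
rewrite E in mg *; rewrite ge0_integral_setU //.
- rewrite big_ord_recr /= IH //.
    by move=> x /andP[x0 xn]; apply: g0; rewrite x0 (le_trans xn).
  apply: measurable_funS mg; last exact: subsetUl.
  by apply: measurableU => //; exact: measurable_cell.
- exact: measurable_cell.
- move=> x; have := congr1 (fun A : set R => A x) E; rewrite /= => <-.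
  by rewrite in_itv /= => /g0.
- rewrite disj_set2E; apply/eqP; rewrite -subset0 => x [] /=.
  rewrite /cell /= !in_itv /= => /andP[_ xn] /andP[nx _].
  by rewrite leNgt nx in xn.
Qed.

Lemma integral_cells_le (g : R -> \bar R) (c : nat -> R) h n : (0 < h)%R ->
  (forall x, (0 < x <= n%:R * h)%R -> 0 <= g x) ->
  measurable_fun `]0%R, (n%:R * h)%R] g ->
  (forall j x, (j < n)%N -> cell h j x -> g x <= (c j)%:E) ->
  \int[mu]_(x in `]0%R, (n%:R * h)%R]) g x <= (h * \sum_(j < n) c j)%:E.
Proof.
move=> h0 g0 mg gc; rewrite integral_cells // mulr_sumr -sumEFin.
apply: lee_sum => j _.
apply: (@le_trans _ _ (\int[mu]_(x in cell h j) (c j)%:E)); last first.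
  rewrite integral_cst //=; last exact: measurable_cell.
  by rewrite (lebesgue_cell h j h0) -EFinM mulrC.
apply: ge0_le_integral_nonmeasurable => x jx; last exact: gc.
move: jx; rewrite /cell /= in_itv /= => /andP[x1 x2]; apply: g0.
rewrite (le_lt_trans _ x1) ?mulr_ge0 ?(ltW h0) //= (le_trans x2) //.
by rewrite ler_pM2r // ler_nat.
Qed.

End Cells.

(** * Translation of integrals *)

Section Translation.
Context {R : realType}.
Local Notation mu := (@lebesgue_measure R).
Implicit Types (f : R -> R) (u a b : R).

Lemma measurable_shift u :
  @measurable_fun _ _ (measurableTypeR R) (measurableTypeR R) setT
    (fun x : R => x + u).
Proof. exact: (@measurable_funD _ R R setT id (cst u)). Qed.

(** The image of the Lebesgue measure by a translation agrees with it on
intervals. *)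
Lemma lebesgue_measure_shift u (A : set R) : measurable A ->
  mu ((fun x => x + u) @^-1` A) = mu A.
Proof.
move=> mA; pose mphi := isMeasurableFun.Build _ _ _ _ _ (measurable_shift u).
pose phi : {mfun measurableTypeR R >-> measurableTypeR R} :=
  HB.pack (fun x : R => x + u) mphi.
apply/esym; apply: (@lebesgue_measure_unique R (pushforward mu phi)) => // X.
move=> [[a b] _ <-] /=; rewrite /pushforward /=.
rewrite (_ : _ @^-1` _ = `](a - u), (b - u)]%classic); last first.
  by apply/seteqP; split => x; rewrite /= !in_itv /= ltrBlDr lerBrDr.
rewrite !lebesgue_measure_itv /= !lte_fin ltrD2r.
by case: ifP => // _; rewrite -!EFinD; congr EFin; ring.
Qed.

Lemma ge0_integral_shift (D : set R) (g : R -> \bar R) u : measurable D ->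
  measurable_fun [set: R] g -> (forall x, 0 <= g x)%E ->
  (\int[mu]_(x in (fun x => (x + u)%R) @^-1` D) g (x + u)%R =
   \int[mu]_(x in D) g x)%E.
Proof.
move=> mD mg g0.
have := @ge0_integral_pushforward _ _ _ _ _ _ (measurable_shift u) mu D g mD.
move=> /(_ (measurable_funS measurableT (@subsetT _ _) mg)) <- //.
apply: eq_measure_integral; first exact: measurable_shift.
by move=> ? A mA _; exact: lebesgue_measure_shift.
Qed.

Lemma integrable_shift f u : mu.-integrable setT (EFin \o f) ->
  mu.-integrable setT (EFin \o (fun x => f (x + u))).
Proof.
move=> /integrableP[mf fi]; apply/integrableP.
have mf' : measurable_fun setT f by exact/measurable_EFinP.
split.
  by apply/measurable_EFinP; exact: (measurableT_comp mf' (measurable_shift u)).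
apply: le_lt_trans fi.
have := @ge0_integral_shift setT (fun x => (`|f x|)%:E) u measurableT.
rewrite preimage_setT => -> //.
by apply/measurable_EFinP; exact: measurableT_comp.
Qed.

Lemma Rintegral_shift f u a b : mu.-integrable setT (EFin \o f) ->
  \int[mu]_(x in `]a, b]) f (x + u) = \int[mu]_(x in `](a + u), (b + u)]) f x.
Proof.
move=> fi; rewrite /Rintegral; congr fine.
have mf := measurable_int mu fi.
have E : (fun x : R => x + u) @^-1` `](a + u), (b + u)]%classic = `]a, b]%classic.
  by apply/seteqP; split => x; rewrite /= !in_itv /= ltrD2r lerD2r.
have fiu := integrable_shift f u fi.
have := @integral_pushforward _ _ _ _ _ _ (measurable_shift u) mu
  `](a + u), (b + u)]%classic (EFin \o f) mf.
rewrite E => <- //; last by apply: integrableS fiu.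
apply: eq_measure_integral; first exact: measurable_shift.
by move=> ? A mA _; exact: lebesgue_measure_shift.
Qed.

End Translation.

Section Primitive.
Context {R : realType}.
Local Notation mu := (@lebesgue_measure R).
Variable f : R -> R.
Hypothesis fi : mu.-integrable setT (EFin \o f).

Definition primitive (x : R) : R := \int[mu]_(t in `]0, x]) f t.

Lemma primitiveB (a b : R) : 0 <= a -> a <= b ->
  primitive b - primitive a = \int[mu]_(t in `]a, b]) f t.
Proof.
move=> a0 ab; apply: Rintegral_itvB; rewrite ?bnd_simp //.
exact: integrableS fi.
Qed.

Lemma integrable_iter_diff j (h : R) :
  mu.-integrable setT (EFin \o iter j (fwd_diff h) f).
Proof.
elim: j => //= j IH.
have := integrableB measurableT (integrable_shift _ h IH) IH.
by apply: eq_integrable => // x _ /=.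
Qed.

(** A difference of order [j.+1] of the primitive is the integral over one step
of the difference of order [j] of the function. *)
Lemma seq_diff_primitive j (h : R) i : 0 < h ->
  seq_diff j.+1 (fun n => primitive (n%:R * h)) i =
  \int[mu]_(x in cell h i) iter j (fwd_diff h) f x.
Proof.
move=> h0; elim: j i => [|j IH] i.
  by rewrite seq_diffSl /= primitiveB // ?mulr_ge0 ?(ltW h0) // ler_pM2r // ler_nat.
rewrite seq_diffSl !IH.
have -> : cell h i.+1 = `](i%:R * h + h), (i.+1%:R * h + h)]%classic.
  by rewrite /cell -!natr1 !mulrDl !mul1r.
rewrite -Rintegral_shift; last exact: integrable_iter_diff.
rewrite /cell -RintegralB //=.
- apply: integrableS (integrable_shift _ h (integrable_iter_diff j h)) => //.
- exact: integrableS (integrable_iter_diff j h).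
Qed.

End Primitive.

(** * Approximation by piecewise polynomials *)

Section PiecewisePolynomials.
Context {R : realType}.
Local Notation mu := (@lebesgue_measure R).
Implicit Types (F f g : R -> R) (q : nat -> {poly R}) (m n i j l d e N : nat).

Definition piecewise m q (x : R) : R :=
  \sum_(j < m) poly_cell (q j) (m%:R * x - j%:R).

Lemma cellP m j (x : R) : (0 < m)%N ->
  cell m%:R^-1 j x <-> 0 < m%:R * x - j%:R <= 1.
Proof.
move=> m0; have m0' : 0 < (m%:R : R) by rewrite ltr0n.
rewrite /cell /= in_itv /= subr_gt0 lerBlDl ltr_pdivrMr // ler_pdivlMr //.
by rewrite (mulrC x) natr1.
Qed.

Lemma poly_cell_eq0 (p : {poly R}) m j l (x : R) : (0 < m)%N ->
  cell m%:R^-1 j x -> l != j -> poly_cell p (m%:R * x - l%:R) = 0.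
Proof.
move=> m0 /(cellP _ _ _ m0)/andP[x1 x2] /eqP lj; rewrite /poly_cell.
case: ifP => // /andP[y1 y2]; exfalso; apply: lj.
have h1 : (l%:R : R) < j.+1%:R by rewrite -natr1; lra.
have h2 : (j%:R : R) < l.+1%:R by rewrite -natr1; lra.
by move: h1 h2; rewrite !ltr_nat; lia.
Qed.

Lemma poly_cell_in (p : {poly R}) m j (x : R) : (0 < m)%N ->
  cell m%:R^-1 j x ->
  poly_cell p (m%:R * x - j%:R) = p.[m%:R * x - j%:R].
Proof. by move=> m0 /(cellP _ _ _ m0) h; rewrite /poly_cell h. Qed.

Lemma piecewiseE m q j (x : R) : (0 < m)%N -> (j < m)%N ->
  cell m%:R^-1 j x -> piecewise m q x = (q j).[m%:R * x - j%:R].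
Proof.
move=> m0 jm jx; rewrite /piecewise (bigD1 (Ordinal jm)) //= big1 ?addr0.
  exact: poly_cell_in.
move=> l; rewrite -val_eqE /= => lj; exact: poly_cell_eq0 jx lj.
Qed.

Lemma measurable_horner (p : {poly R}) : measurable_fun setT (fun x => p.[x]).
Proof.
under eq_fun do rewrite horner_coef.
by apply: measurable_sum => i; exact: measurable_funM.
Qed.

Lemma measurable_poly_cell (p : {poly R}) : measurable_fun setT (poly_cell p).
Proof.
rewrite /poly_cell; apply: measurable_fun_ifT => //.
- apply: measurable_and; first exact: measurable_fun_ltr.
  exact: measurable_fun_ler.
- exact: measurable_horner.
Qed.

Lemma measurable_cell_poly (p : {poly R}) m j :
  measurable_fun setT (fun x : R => poly_cell p (m%:R * x - j%:R)).
Proof.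
apply: (measurableT_comp (measurable_poly_cell p)).
by apply: measurable_funB => //; exact: measurable_funM.
Qed.

Lemma measurable_piecewise m q : measurable_fun setT (piecewise m q).
Proof. by apply: measurable_sum => j; exact: measurable_cell_poly. Qed.

(** On each cell, the derivative of the polynomial of degree at most [d.+1] that
interpolates [F] at [d.+2] equidistant points of the cell; when [F] is a primitive
of [f], this polynomial of degree at most [d] has the same integral as [f] between
any two of these points. *)
Definition quasi_interp d F m j : {poly R} :=
  m%:R *: (interp d (fun i => F ((j * d.+1 + i)%:R * (m * d.+1)%:R^-1)))^`().

Lemma size_quasi_interp d F m j : (size (quasi_interp d F m j) <= d.+1)%N.
Proof.
rewrite /quasi_interp (leq_trans (size_scale_leq _ _)) //.
have [->|p0] := eqVneq (interp d (fun i => F ((j * d.+1 + i)%:R *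
  (m * d.+1)%:R^-1))) 0; first by rewrite deriv0 size_poly0.
by rewrite -ltnS (leq_trans (lt_size_deriv p0)) ?size_interp.
Qed.

Lemma seq_diff_shift k (A : nat -> R) a l :
  seq_diff k (fun n => A (a + n)%N) l = seq_diff k A (a + l)%N.
Proof. by elim: k l => //= k IH l; rewrite !IH addnS. Qed.

(** The estimate of [interp_two_scale], rescaled to the cell [j] and to its half,
the cell [2 * j + e] of the finer grid. *)
Lemma quasi_interp_two_scale d : exists2 c : R, 0 <= c & forall F m j e (y : R),
  (0 < m)%N -> (e <= 1)%N -> 0 <= y <= 1 ->
  `|(quasi_interp d F (2 * m) (2 * j + e)).[y] -
    (quasi_interp d F m j).[(y + e%:R) / 2]| <=
  m%:R * c * \sum_(l < d.+1)
    `|seq_diff d.+2 (fun n => F (n%:R * (2 * m * d.+1)%:R^-1))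
        (2 * j * d.+1 + l)%N|.
Proof.
have [c c0 cP] := @interp_two_scale R d.
exists c => // F m j e y m0 e1 y01.
pose A n := F ((2 * j * d.+1 + n)%:R * (2 * m * d.+1)%:R^-1).
have := cP A e y e1 y01.
rewrite /quasi_interp !hornerZ.
have -> : (fun i => F (((2 * j + e) * d.+1 + i)%:R * (2 * m * d.+1)%:R^-1)) =
    (fun i => A (e * d.+1 + i)%N).
  by apply/funext => i; rewrite /A mulnDl addnA.
have -> : (fun i => F ((j * d.+1 + i)%:R * (m * d.+1)%:R^-1)) =
    (fun i => A i.*2).
  apply/funext => i; rewrite /A; congr F.
  rewrite (_ : 2 * j * d.+1 + i.*2 = 2 * (j * d.+1 + i))%N; last by lia.
  rewrite -(mulnA 2) !(natrM _ 2) invfM mulrACA divff ?mul1r //.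
set u := (interp d _)^`().[y]; set v := (interp d _)^`().[_] => h.
rewrite natrM -mulrA (mulrCA 2) -mulrBr normrM ger0_norm // -mulrA.
rewrite ler_wpM2l //; apply: (le_trans h).
rewrite ler_wpM2l //; apply: ler_sum => l _.
by rewrite /A (seq_diff_shift _ (fun n => F (n%:R * _))).
Qed.

(** The rate at which the differences of order [d.+2] of [F] on the regular grid
with [N] steps decrease in [l^p] norm; for a primitive [F] of [f], this expresses
that the modulus of smoothness of order [d.+1] of [f] in [L^p] is of order
[t `^ s]. *)
Definition diff_rate d (s p : R) F : Prop :=
  exists2 M : R, 0 <= M & forall N, (0 < N)%N ->
    \sum_(i < N - d.+1)
       `|seq_diff d.+2 (fun n => F (n%:R * N%:R^-1)) i| `^ p <=
    (M * N%:R `^ (- s)) `^ p * N%:R `^ (1 - p).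

Lemma sum_even_blocks (a : nat -> R) m k : (forall i, 0 <= a i) ->
  \sum_(j < m) \sum_(l < k) a (2 * j * k + l)%N <=
  \sum_(i < 2 * m * k - k) a i.
Proof.
move=> a0; case: m => [|m]; first by rewrite big_ord0 sumr_ge0.
rewrite (_ : 2 * m.+1 * k - k = 2 * m * k + k)%N; last by lia.
elim: m => [|m IH].
  by rewrite big_ord_recr big_ord0 /= add0r muln0 mul0n.
rewrite big_ord_recr /=.
rewrite big_split_ord /= lerD //; apply: (le_trans IH).
rewrite (_ : 2 * m.+1 * k = 2 * m * k + k + k)%N; last by lia.
rewrite [leRHS]big_split_ord /= lerDl sumr_ge0 //.
Qed.

Local Open Scope ereal_scope.

(** The cells involve disjoint blocks of differences of [F] on a common grid, so
their contributions add up to the sum that the rate controls. *)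
Lemma quasi_interp_halving d (s p : R) F : (1 <= p)%R -> (0 <= s)%R ->
  diff_rate d s p F ->
  exists2 c : R, (0 <= c)%R & forall m, (0 < m)%N ->
    \int[mu]_(x in `]0%R, 1%R])
      (`|piecewise (2 * m) (quasi_interp d F (2 * m)) x -
         piecewise m (quasi_interp d F m) x| `^ p)%:E <=
    ((c * m%:R `^ (- s)) `^ p)%:E.
Proof.
move=> p1 s0 [M M0 MP]; have p0 : (0 <= p)%R by rewrite (le_trans _ p1).
have [c c0 cP] := quasi_interp_two_scale d.
exists (c * d.+1%:R * M)%R => [|m m0]; first by rewrite !mulr_ge0.
have mr0 : (0 < m%:R :> R)%R by rewrite ltr0n.
pose N := (2 * m * d.+1)%N; have N0 : (0 < N)%N by rewrite /N !muln_gt0 m0.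
pose D l := `|seq_diff d.+2 (fun n => F (n%:R * N%:R^-1)%R) l|%R.
pose S j := (\sum_(l < d.+1) D (2 * j * d.+1 + l)%N)%R.
have D0 l : (0 <= D l)%R by rewrite /D.
have S0 j : (0 <= S j)%R by exact: sumr_ge0.
have m1 : (m%:R * m%:R^-1 = 1 :> R)%R by rewrite mulfV // gt_eqF.
rewrite -[X in Interval _ (BRight X)]m1.
apply: (le_trans (@integral_cells_le R _ (fun j => (m%:R * c * S j) `^ p)%R
  _ _ _ _ _ _)) => //.
- by rewrite invr_gt0.
- apply: measurable_powR_norm; apply: measurable_funTS.
  by apply: measurable_funB; exact: measurable_piecewise.
- move=> j x jm jx; rewrite lee_fin ge0_ler_powR ?nnegrE ?mulr_ge0 //.
  rewrite (piecewiseE _ _ _ _ m0 jm jx).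
  have [y1 y2] := andP (proj1 (cellP _ _ _ m0) jx).
  have m20 : (0 < 2 * m)%N by rewrite muln_gt0.
  have E2 : ((2 * m)%:R = 2 * m%:R :> R)%R by rewrite natrM.
  suff [e e1 jx2] : exists2 e, (e <= 1)%N & cell (2 * m)%:R^-1 (2 * j + e) x.
    have jm2 : (2 * j + e < 2 * m)%N by lia.
    rewrite (piecewiseE _ _ _ _ m20 jm2 jx2).
    have [z1 z2] := andP (proj1 (cellP _ _ _ m20) jx2).
    have := cP F m j e _ m0 e1 (introT andP (conj (ltW z1) z2)).
    rewrite (_ : (_ + e%:R) / 2 = m%:R * x - j%:R)%R //.
    by rewrite natrD !natrM; field.
  have [h|h] := leP ((2 * m)%:R * x - (2 * j)%:R)%R 1%R.
    exists 0%N => //; apply/cellP; rewrite // addn0 h andbT E2 natrM; lra.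
  exists 1%N => //; apply/cellP => //.
  move: h; rewrite E2 natrD natrM => h; apply/andP; split; lra.
rewrite lee_fin.
have h1 : (\sum_(j < m) (m%:R * c * S j) `^ p <=
    (m%:R * c * d.+1%:R) `^ p * \sum_(i < N - d.+1) D i `^ p)%R.
  apply: (@le_trans _ _ ((m%:R * c * d.+1%:R) `^ p *
    \sum_(j < m) \sum_(l < d.+1) D (2 * j * d.+1 + l)%N `^ p)%R).
    rewrite mulr_sumr; apply: ler_sum => j _.
    rewrite powRM ?mulr_ge0 // [in leRHS]powRM ?mulr_ge0 // -mulrA.
    by rewrite ler_wpM2l ?powR_ge0 //; exact: powR_sum_le.
  rewrite ler_wpM2l ?powR_ge0 //.
  apply: (@sum_even_blocks (fun i => D i `^ p)%R) => i; exact: powR_ge0.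
have h2 := MP N N0.
have mN : (m%:R <= N%:R :> R)%R by rewrite ler_nat /N; nia.
have Nr0 : (0 < N%:R :> R)%R by rewrite ltr0n.
have le_neg (b : R) : (0 <= b)%R -> (N%:R `^ (- b) <= m%:R `^ (- b))%R.
  move=> b0; rewrite !powRN lef_pV2 ?posrE ?powR_gt0 //.
  by rewrite ge0_ler_powR ?nnegrE.
have h3 : ((M * N%:R `^ (- s)) `^ p * N%:R `^ (1 - p) <=
    (M * m%:R `^ (- s)) `^ p * m%:R `^ (1 - p))%R.
  apply: ler_pM; rewrite ?powR_ge0 //.
    rewrite ge0_ler_powR ?nnegrE ?mulr_ge0 ?powR_ge0 //.
    by rewrite ler_wpM2l // le_neg.
  by rewrite -(opprB p 1) le_neg // subr_ge0.
apply: (@le_trans _ _ (m%:R^-1 * ((m%:R * c * d.+1%:R) `^ p *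
    ((M * m%:R `^ (- s)) `^ p * m%:R `^ (1 - p))))%R).
  rewrite ler_wpM2l ?invr_ge0 // (le_trans h1) // ler_wpM2l ?powR_ge0 //.
  exact: le_trans h3.
rewrite -(mulrA m%:R%R) [X in (_ * (X * _) <= _)%R]powRM ?mulr_ge0 //.
rewrite -(mulrA (c * _)%R) [leRHS]powRM ?mulr_ge0 ?powR_ge0 //.
have -> : (m%:R `^ (1 - p) = m%:R * (m%:R `^ p)^-1 :> R)%R.
  rewrite powRD; last by apply/implyP => _; rewrite gt_eqF.
  by rewrite powRr1 ?(ltW mr0) // powRN.
rewrite le_eqVlt; apply/orP; left; apply/eqP.
by field; rewrite !gt_eqF ?powR_gt0.
Qed.

End PiecewisePolynomials.

Section QuasiInterpolationError.
Context {R : realType}.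
Local Notation mu := (@lebesgue_measure R).
Implicit Types (F f g : R -> R) (m n i j l d L : nat) (p s : R).

Lemma derivable_remainder F (x a : R) : derivable F x 1 -> derive1 F x = a ->
  forall e : R, 0 < e -> exists2 b : R, 0 < b & forall z, `|z - x| < b ->
    `|F z - F x - a * (z - x)| <= e * `|z - x|.
Proof.
move=> dF; rewrite derive1E => Fa e e0.
have : h^-1 *: ((F \o shift x) (h *: 1) - F x) @[h --> 0^'] --> a.
  by rewrite -Fa; exact: dF.
move=> /cvgrPdist_le /(_ e e0); rewrite near_withinE => -[b /= b0 bP].
exists b => // z zx.
have [->|nzx] := eqVneq z x; first by rewrite !subrr mulr0 subr0 normr0 mulr0.
have zx0 : z - x != 0 by rewrite subr_eq0.
have := bP (z - x); rewrite /ball_ /= sub0r normrN => /(_ zx zx0).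
rewrite /= scaler1 subrK => h.
rewrite -[X in `|X|](mulfVK zx0) normrM ler_wpM2r //.
rewrite distrC in h; congr (`|_| <= e) : h; rewrite /GRing.scale /=.
by field.
Qed.

(** At a point of differentiability of the primitive, the quasi-interpolants
converge to its derivative, because they reproduce its first order Taylor
polynomial and are stable. *)
Lemma quasi_interp_pointwise d F (x a : R) : 0 < x <= 1 ->
  derivable F x 1 -> derive1 F x = a ->
  forall e : R, 0 < e -> exists M, forall m, (M <= m)%N ->
    `|piecewise m (quasi_interp d F m) x - a| <= e.
Proof.
move=> /andP[x0 x1] dF Fa e e0.
have [c c0 cP] := @interp_deriv_bound R d.
have e'0 : 0 < e / (c + 1) by rewrite divr_gt0 // ltr_wpDl.
have [b b0 bP] := derivable_remainder _ _ _ dF Fa _ e'0.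
exists (Num.truncn b^-1).+1 => m bm.
have m0 : (0 < m)%N by exact: leq_ltn_trans bm.
have mr0 : 0 < (m%:R : R) by rewrite ltr0n.
have mb : m%:R^-1 < b.
  rewrite invf_plt ?posrE // (lt_le_trans (truncnS_gt _)) // ler_nat //.
have [j jm jx] : exists2 j, (j < m)%N & cell m%:R^-1 j x.
  by apply: cell_exists; rewrite ?invr_gt0 // mulfV ?gt_eqF // x0.
rewrite (piecewiseE _ _ _ _ m0 jm jx).
have /andP[y0 y1] := proj1 (cellP _ _ _ m0) jx.
set y := m%:R * x - j%:R in y0 y1 *.
pose z i := (j * d.+1 + i)%:R * (m * d.+1)%:R^-1 : R.
have zE i : z i - x = m%:R^-1 * (knot d i - y).
  rewrite /z /knot /y !natrD !natrM.
  by field; rewrite nat1r !pnatr_eq0 -!lt0n.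
have zx i : (i < d.+2)%N -> `|z i - x| <= m%:R^-1.
  move=> id; rewrite zE normrM gtr0_norm ?invr_gt0 //.
  rewrite ler_piMr ?invr_ge0 ?(ltW mr0) // ler_norml.
  have k0 : 0 <= knot d i :> R by rewrite /knot divr_ge0.
  have k1 : knot d i <= 1 :> R by rewrite /knot ler_pdivrMr ?mul1r ?ler_nat.
  apply/andP; split; lra.
pose r i := F (z i) - F x - a * (z i - x).
have rP i : (i < d.+2)%N -> `|r i| <= e / (c + 1) * m%:R^-1.
  move=> id; rewrite (le_trans (bP _ _)) //.
    by rewrite (le_lt_trans (zx i id)).
  by rewrite ler_wpM2l ?zx // ltW.
pose q : {poly R} := (F x - a * (m%:R^-1 * y))%:P + (a / m%:R) *: 'X.
have E : interp d (fun i => F (z i)) = q + interp d r.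
  have -> : interp d r = interp d (fun i => F (z i) - q.[knot d i]).
    congr interp; apply/funext => i; rewrite /r /q zE.
    by rewrite hornerD hornerC hornerZ hornerX; ring.
  rewrite interpB [X in _ = X + _](_ : q = interp d (fun i => q.[knot d i])).
    by rewrite addrC subrK.
  apply/esym/interp_poly => //; rewrite /q.
  apply: (leq_trans (size_polyD _ _)); rewrite geq_max.
  rewrite (leq_trans (size_polyC_leq1 _)) //=.
  by rewrite (leq_trans (size_scale_leq _ _)) // size_polyX.
rewrite /quasi_interp -/(z) hornerZ E derivD hornerD.
have -> : q^`() = (a / m%:R)%:P.
  by rewrite /q derivD derivC add0r derivZ derivX alg_polyC.
rewrite hornerC mulrDr (mulrC _ (a / _)) divfK ?gt_eqF // addrAC subrr add0r.
rewrite normrM gtr0_norm //.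
have := cP r _ y rP; rewrite (ltW y0) y1 => /(_ isT) h.
apply: (@le_trans _ _ (m%:R * (c * (e / (c + 1) * m%:R^-1)))).
  by rewrite ler_wpM2l // ltW.
rewrite (_ : _ * _ = c / (c + 1) * e); last first.
  by field; rewrite !gt_eqF // ltr_wpDl.
rewrite ler_piMl ?(ltW e0) // ler_pdivrMr ?ltr_wpDl // mul1r lerDl //.
Qed.

Lemma powR_exprn (x y : R) n : 0 <= x -> (x ^+ n) `^ y = (x `^ y) ^+ n.
Proof.
by move=> x0; rewrite -powR_mulrn // -powRrM mulrC powRrM powR_mulrn ?powR_ge0.
Qed.

Local Open Scope ereal_scope.
Local Notation D01 := (`]0%R, 1%R]%classic : set R).

Lemma Lnorm_restrict_le (D : set R) g p (a : R) :
  measurable D -> (1 <= p)%R -> (0 <= a)%R ->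
  (Lnorm mu p%:E (EFin \o (g \_ D)) <= a%:E) =
  (\int[mu]_(x in D) (`|g x| `^ p)%:E <= (a `^ p)%:E).
Proof.
move=> mD p1 a0; have p0 : (0 < p)%R by rewrite (lt_le_trans _ p1).
have -> : \int[mu]_(x in D) (`|g x| `^ p)%:E =
    Lnorm mu p%:E (EFin \o (g \_ D)) `^ p.
  rewrite powR_Lnorm ?gt_eqF // [LHS]integral_mkcond; apply: eq_integral => x _.
  rewrite /= !patchE; case: ifPn => _ //.
  by rewrite normr0 powR0 // gt_eqF.
rewrite -poweR_EFin.
have := Lnorm_ge0 mu p%:E (EFin \o (g \_ D)).
case: (Lnorm _ _ _) => [b| |]; rewrite ?leeNy_eq //.
- rewrite !poweR_EFin !lee_fin => b0.
  apply/idP/idP => [ba|]; first by rewrite ge0_ler_powR ?nnegrE // ltW.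
  by apply: contraLR; rewrite -!ltNge => ab; rewrite gt0_ltr_powR ?nnegrE.
- by move=> _; rewrite /poweR gt_eqF // !leye_eq.
Qed.

Variables (d : nat) (p s : R) (f : R -> R).
Hypothesis p1 : (1 <= p)%R.
Hypothesis s0 : (0 < s)%R.
Hypothesis fi : mu.-integrable setT (EFin \o f).
Local Notation F := (primitive f).
Hypothesis Frate : diff_rate d s p F.

Let T m := piecewise m (quasi_interp d F m).

(** Minkowski's inequality over the successive halvings, whose contributions form a
geometric series of ratio [2 `^ (- s)]. *)
Lemma quasi_interp_dyadic : exists2 c : R, (0 <= c)%R &
  forall m L, (0 < m)%N ->
    \int[mu]_(x in D01) (`|T (2 ^ L * m) x - T m x| `^ p)%:E <=
    ((c * m%:R `^ (- s)) `^ p)%:E.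
Proof.
have [c c0 cP] := quasi_interp_halving d s p F p1 (ltW s0) Frate.
have z0 : (0 < 2 `^ (- s) :> R)%R by rewrite powR_gt0.
have z1 : (2 `^ (- s) < 1 :> R)%R.
  rewrite powRN invf_lt1 ?powR_gt0 //.
  have : (1 `^ s < 2 `^ s :> R)%R.
    by apply: gt0_ltr_powR; rewrite ?nnegrE // ltr1n.
  by rewrite powR1.
set z := (2 `^ (- s))%R in z0 z1.
exists (c / (1 - z))%R => [|m L m0]; first by rewrite divr_ge0 // subr_ge0 ltW.
have mr0 : (0 < m%:R :> R)%R by rewrite ltr0n.
have q0 : (0 <= m%:R `^ (- s) :> R)%R by exact: powR_ge0.
rewrite -(@Lnorm_restrict_le _ (fun x => T (2 ^ L * m) x - T m x)%R) //; last first.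
  by rewrite mulr_ge0 // divr_ge0 // subr_ge0 ltW.
suff : Lnorm mu p%:E (EFin \o ((fun x => T (2 ^ L * m) x - T m x)%R \_ D01)) <=
    (c / (1 - z) * m%:R `^ (- s) * (1 - z ^+ L))%:E.
  move=> /le_trans; apply; rewrite lee_fin ler_piMr //.
    by rewrite mulr_ge0 // divr_ge0 // subr_ge0 ltW.
  by rewrite gerBl exprn_ge0 // ltW.
have mT n : measurable_fun setT (T n) by exact: measurable_piecewise.
have mTB n n' : measurable_fun setT (fun x : R => (T n x - T n' x)%R).
  exact: measurable_funB.
elim: L => [|L IH].
  have p00 : p != 0%R by rewrite gt_eqF // (lt_le_trans _ p1).
  rewrite expr0 subrr mulr0 Lnorm_restrict_le //.
  rewrite powR0 //.
  rewrite integral0_eq // => x _.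
  by rewrite expn0 mul1n subrr normr0 powR0.
have -> : (fun x => T (2 ^ L.+1 * m) x - T m x)%R \_ D01 =
    (((fun x => T (2 ^ L.+1 * m) x - T (2 ^ L * m) x)%R \_ D01) \+
     ((fun x => T (2 ^ L * m) x - T m x)%R \_ D01))%R.
  apply/funext => x; rewrite /= !patchE; case: ifP => _; last by rewrite addr0.
  by ring.
apply: (le_trans (minkowski_EFin _ _ _ p1)).
- apply/(measurable_restrictT _ _).1 => //; apply: measurable_funTS.
  exact: mTB.
- apply/(measurable_restrictT _ _).1 => //; apply: measurable_funTS.
  exact: mTB.
have m20 : (0 < 2 ^ L * m)%N by rewrite muln_gt0 expn_gt0.
have h := cP _ m20.
have h2 : Lnorm mu p%:E (EFin \o
    ((fun x => T (2 ^ L.+1 * m) x - T (2 ^ L * m) x)%R \_ D01)) <=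
    (c * (z ^+ L * m%:R `^ (- s)))%:E.
  have E : ((2 ^ L * m)%:R `^ (- s) = z ^+ L * m%:R `^ (- s) :> R)%R.
    rewrite natrM natrX powRM ?exprn_ge0 //; congr (_ * _)%R.
    exact: powR_exprn.
  have a0 : (0 <= c * (z ^+ L * m%:R `^ (- s)))%R.
    by rewrite !mulr_ge0 ?exprn_ge0 // ltW.
  by rewrite Lnorm_restrict_le //; move: h; rewrite E mulnA -expnS.
apply: (le_trans (leeD h2 IH)).
rewrite -EFinD lee_fin le_eqVlt; apply/orP; left; apply/eqP.
by rewrite exprSr; field; rewrite subr_eq0 gt_eqF.
Qed.

(** By Lebesgue's differentiation theorem the primitive is differentiable, with
derivative [f], almost everywhere. *)
Lemma quasi_interp_ae_cvg m : (0 < m)%N ->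
  {ae mu, forall x, D01 x -> T (2 ^ L * m) x @[L --> \oo] --> f x}.
Proof.
move=> m0.
have fi' y : mu.-integrable [set` Interval (BRight 0%R) (BRight y)] (EFin \o f).
  exact: integrableS fi.
have floc : locally_integrable setT f.
  exact: open_integrable_locally openT fi.
have := FTC1 fi' floc.
apply: filterS; first exact: (ae_filter_ringOfSetsType mu).
move=> x /= H; rewrite in_itv /= => x01.
have [|dF Fx] := H; first by rewrite lte_fin; case/andP: x01.
apply/cvgrPdist_le => e e0.
have [M MP] := quasi_interp_pointwise d F x (f x) x01 dF Fx e e0.
near=> L; rewrite distrC; apply: MP.
apply: (@leq_trans L); first by near: L; exact: nbhs_infty_ge.
by rewrite (leq_trans (ltnW (ltn_expl L (isT : 1 < 2)%N))) // leq_pmulr.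
Unshelve. all: by end_near. Qed.

(** Fatou's lemma, applied to the successive halvings: the distance to [f] is at most
the uniform bound on the distance to the refined quasi-interpolants. *)
Lemma quasi_interp_error : exists2 c : R, (0 <= c)%R & forall m, (0 < m)%N ->
  \int[mu]_(x in D01) (`|f x - T m x| `^ p)%:E <=
  ((c * m%:R `^ (- s)) `^ p)%:E.
Proof.
have [c c0 cP] := quasi_interp_dyadic.
exists c => // m m0.
have mT n : measurable_fun D01 (T n).
  by apply: measurable_funTS; exact: measurable_piecewise.
have mf : measurable_fun D01 f.
  by apply: measurable_funTS; apply/measurable_EFinP; exact: measurable_int fi.
have mfT : measurable_fun D01 (fun x : R => (f x - T m x)%R).
  exact: measurable_funB.
have mTT n : measurable_fun D01 (fun x : R => (T n x - T m x)%R).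
  exact: measurable_funB.
pose g L x := (`|T (2 ^ L * m) x - T m x| `^ p)%:E.
have mg L : measurable_fun D01 (g L).
  by apply: measurable_powR_norm; exact: mTT.
have g0 L x : D01 x -> 0 <= g L x by move=> _; rewrite lee_fin powR_ge0.
have -> : \int[mu]_(x in D01) (`|f x - T m x| `^ p)%:E =
    \int[mu]_(x in D01) limn_einf (g^~ x).
  apply: ge0_ae_eq_integral => //.
  - by apply: measurable_powR_norm; exact: mfT.
  - rewrite /limn_einf; apply: (measurableT_comp (@oppe_measurable R _)).
    apply: (@measurable_fun_limn_esup _ _ _ _ (fun L x => - g L x)) => L.
    exact: (measurableT_comp (@oppe_measurable R _) (mg L)).
  - move=> x Dx; rewrite limn_einf_lim; apply: lime_ge; first exact: is_cvg_einfs.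
    apply: nearW => L; apply: le_ereal_inf_tmp => _ [n _ <-]; exact: g0.
  - have := quasi_interp_ae_cvg m m0.
    apply: filterS; first exact: (ae_filter_ringOfSetsType mu).
    move=> x H /H Tx.
    have h1 : (T (2 ^ L * m) x - T m x)%R @[L --> \oo] --> (f x - T m x)%R.
      by apply: cvgB => //; exact: cvg_cst.
    have h2 := continuous_cvg _ (continuous_powR_norm p p1 (f x - T m x)%R) h1.
    have gx : g^~ x @ \oo --> (`|f x - T m x| `^ p)%:E.
      by apply: cvg_EFin; [exact: nearW|exact: h2].
    by rewrite is_cvg_limn_einfE; [apply/esym/cvg_lim|apply/cvg_ex; eexists; exact: gx].
apply: (le_trans (fatou mu _ mg g0)) => //.
rewrite limn_einf_lim; apply: lime_le; first exact: is_cvg_einfs.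
apply: nearW => L; apply: le_trans (cP m L m0).
by apply: ereal_inf_lbound; exists L => /=.
Qed.

End QuasiInterpolationError.

(** * Moduli of smoothness and differences of the primitive *)

Section LipschitzRate.
Context {R : realType}.
Local Notation mu := (@lebesgue_measure R).
Implicit Types (f g : R -> R) (p s h : R).

Lemma Rintegral_powR_le (D : set R) g (l p : R) : measurable D ->
  mu D = l%:E -> 0 < l -> 1 <= p -> mu.-integrable D (EFin \o g) ->
  ((`|\int[mu]_(x in D) g x| `^ p)%:E <=
   (l `^ (p - 1))%:E * \int[mu]_(x in D) (`|g x| `^ p)%:E)%E.
Proof.
move=> mD mul l0 p1 gi.
have mg : measurable_fun D g by apply/measurable_EFinP; exact: measurable_int gi.
have mng : measurable_fun D (fun x => `|g x|).
  exact: (measurableT_comp (@normr_measurable R setT) mg).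
have ni : mu.-integrable D (EFin \o (fun x => `|g x|)).
  exact: integrable_norm gi.
have := @integral_powR_jensen _ _ _ mu D (fun x => `|g x|)
  (\int[mu]_(x in D) `|g x|) l p mD mng (fun x _ => normr_ge0 _) mul l0 p1.
rewrite /Rintegral fineK; last exact: integrable_fin_num.
move=> /(_ erefl); apply: le_trans; rewrite lee_fin ge0_ler_powR ?nnegrE //.
- by rewrite (le_trans _ p1).
- by apply: fine_ge0; apply: integral_ge0 => x _; rewrite lee_fin.
- exact: le_normr_Rintegral.
Qed.

Lemma iter_fwd_diff_restrict k h f (x : R) : 0 <= h -> 0 <= x ->
  x + k%:R * h <= 1 ->
  iter k (fwd_diff h) (f \_ `[0, 1]) x = iter k (fwd_diff h) f x.
Proof.
move=> h0; elim: k x => [|k IH] x x0 xk.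
  rewrite /= patchE mem_set //= in_itv /= x0.
  by rewrite mul0r addr0 in xk.
rewrite -natr1 mulrDl mul1r in xk.
have kh : 0 <= k%:R * h by rewrite mulr_ge0.
by rewrite !iterS /fwd_diff !IH //; lra.
Qed.

(** The moduli of smoothness control the differences of the primitive, by
Jensen's inequality on each cell of a grid whose mesh is the step. *)
Lemma lip_star_diff_rate f p s : 1 <= p -> 0 < s ->
  mu.-integrable setT (EFin \o f) -> lip_star01 s p (f \_ `[0, 1]) ->
  diff_rate (Num.truncn s) s p (primitive f).
Proof.
move=> p1 s0 fi [_ lipf]; set k := (Num.truncn s).+1.
have p0 : 0 < p by rewrite (lt_le_trans _ p1).
have [M M0 MP] : exists2 M : R, 0 <= M & forall h : R, 0 < h ->
    (\int[mu]_(x in `[0%R, (1 - k%:R * h)%R])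
      (`|iter k (fwd_diff h) (f \_ `[0%R, 1%R]) x| `^ p)%:E <=
    ((M * h `^ s) `^ p)%:E)%E.
  move: lipf; set S := ereal_sup _ => Sfin.
  have SP (h : R) : 0 < h ->
      ((h `^ (- s))%:E * Lnorm mu p%:E (EFin \o
        (iter k (fwd_diff h) (f \_ `[0%R, 1%R]) \_ `[0%R, (1 - k%:R * h)%R])) <= S)%E.
    move=> h0; apply: (@le_trans _ _ ((h `^ (- s))%:E *
      modulus01 k p (f \_ `[0%R, 1%R]) h)%E).
      rewrite lee_wpmul2l ?lee_fin ?powR_ge0 //; apply: ereal_sup_ubound.
      by exists h => //=; rewrite in_itv /= h0 lexx.
    by apply: ereal_sup_ubound; exists h.
  have S0 : (0 <= S)%E.
    apply: le_trans (SP 1 ltr01); apply: mule_ge0; last exact: Lnorm_ge0.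
    by rewrite lee_fin powR_ge0.
  exists (fine S) => [|h h0]; first exact: fine_ge0.
  rewrite -Lnorm_restrict_le //; last by rewrite mulr_ge0 ?powR_ge0 ?fine_ge0.
  have hs : 0 < h `^ s by rewrite powR_gt0.
  have := SP h h0; rewrite powRN -[X in (_ <= X)%E]fineK; last first.
    by rewrite ge0_fin_numE.
  move=> H; have := lee_wpmul2l (ltW hs : (0 <= (h `^ s)%:E)%E) H.
  rewrite muleA -!EFinM divff ?gt_eqF // mul1e.
  by rewrite (mulrC (fine S)).
exists M => // N N0.
have Nr0 : 0 < (N%:R : R) by rewrite ltr0n.
set h : R := N%:R^-1; have h0 : 0 < h by rewrite invr_gt0.
have Nh : N%:R * h = 1 by rewrite /h mulfV // gt_eqF.
have NE b : N%:R `^ (- b) = h `^ b :> R.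
  by rewrite /h -(powR_inv1 (ltW Nr0)) -powRrM mulN1r.
have -> : N%:R `^ (1 - p) = h `^ (p - 1) :> R by rewrite -NE opprB.
rewrite NE -lee_fin -sumEFin.
have [Nk|kN] := leqP N k.
  rewrite (_ : N - k = 0)%N; last by lia.
  by rewrite big_ord0 lee_fin mulr_ge0 ?powR_ge0.
have kh : (N - k)%:R * h = 1 - k%:R * h.
  by rewrite natrB ?(ltnW kN) // mulrBl Nh.
pose g := iter k (fwd_diff h) f.
have gi : mu.-integrable setT (EFin \o g) by exact: integrable_iter_diff.
have mg : measurable_fun setT g by apply/measurable_EFinP; exact: measurable_int gi.
have mgp (D : set R) : measurable_fun D (fun x => (`|g x| `^ p)%:E).
  by apply: measurable_powR_norm; exact: measurable_funTS.
apply: (@le_trans _ _ (\sum_(i < N - k)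
    (h `^ (p - 1))%:E * \int[mu]_(x in cell h i) (`|g x| `^ p)%:E)%E).
  apply: lee_sum => i _.
  rewrite (_ : seq_diff _ _ _ = \int[mu]_(x in cell h i) g x); last first.
    exact: seq_diff_primitive.
  apply: Rintegral_powR_le => //; first exact: measurable_cell.
    exact: lebesgue_cell.
  by apply: integrableS gi => //; exact: measurable_cell.
rewrite -ge0_sume_distrr; last first.
  by move=> i _; apply: integral_ge0 => x _; rewrite lee_fin powR_ge0.
rewrite -integral_cells //.
rewrite [X in (_ <= X%:E)%E]mulrC EFinM lee_wpmul2l ?lee_fin ?powR_ge0 //.
apply: le_trans (MP h h0).
rewrite kh integral_itv_obnd_cbnd; last exact: mgp.
apply: ge0_le_integral_nonmeasurable => x; first by rewrite lee_fin powR_ge0.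
move=> xD; have /andP[x0 xk] : 0 <= x <= 1 - k%:R * h.
  by move: xD; rewrite /= in_itv.
by rewrite iter_fwd_diff_restrict // ?(ltW h0) //; lra.
Qed.

End LipschitzRate.

(** * Sobolev functions *)

Section AbsoluteContinuity.
Context {R : realType}.
Local Notation mu := (@lebesgue_measure R).
Implicit Types (g h G H : R -> R) (a b x y u v : R).

Lemma deriv01_remainder g x (l : R) : deriv01 g x l ->
  forall e : R, 0 < e -> exists2 b : R, 0 < b & forall y, 0 <= y <= 1 ->
    `|y - x| < b -> `|g y - g x - l * (y - x)| <= e * `|y - x|.
Proof.
move=> gl e e0; have /cvgrPdist_le /(_ e e0) := gl.
rewrite near_withinE near_withinE => -[b /= b0 bP].
exists b => // y y01 yx.
have [->|nyx] := eqVneq y x; first by rewrite !subrr mulr0 subr0 normr0 mulr0.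
have yx0 : y - x != 0 by rewrite subr_eq0.
have := bP y; rewrite /ball_ /= distrC => /(_ yx nyx).
rewrite in_itv /= => /(_ y01) h.
rewrite -[X in `|X|](mulfVK yx0) normrM ler_wpM2r //.
rewrite distrC in h; congr (`|_| <= e) : h.
by field.
Qed.

Lemma is_derive_remainder G x (l : R) :
  (forall e : R, 0 < e -> exists2 b : R, 0 < b & forall y,
    `|y - x| < b -> `|G y - G x - l * (y - x)| <= e * `|y - x|) ->
  is_derive x 1 G l.
Proof.
move=> GP.
have h : h^-1 *: ((G \o shift x) (h *: 1) - G x) @[h --> 0^'] --> l.
  apply/cvgrPdist_le => e e0; rewrite near_withinE.
  have [b b0 bP] := GP e e0; exists b => //= t; rewrite /ball_ /= sub0r normrN.
  move=> tb t0; have := bP (t + x); rewrite addrK => /(_ tb) h.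
  have t0' : 0 < `|t| by rewrite normr_gt0.
  rewrite scaler1 -(ler_pM2r t0') -normrM.
  rewrite distrC in h; congr (`|_| <= _) : h.
  by rewrite /GRing.scale /=; field.
split; first by apply/cvg_ex; exists l; exact: h.
exact/cvg_lim.
Qed.

(** Induction along a segment: the step at the supremum of the points of [S] would
reach further, unless this supremum is [b]. *)
Lemma real_induction a b (S : R -> Prop) : a <= b -> S a ->
  (forall c, a <= c <= b -> exists2 e : R, 0 < e & forall x v, S x -> a <= x ->
    c - e < x <= c -> c <= v <= b -> v < c + e -> S v) ->
  S b.
Proof.
move=> ab Sa step; pose A := [set x | a <= x <= b /\ S x].
have Aa : A a by split=> //; rewrite lexx.
have supA : has_sup A.
  by split; [exists a|exists b => x [/andP[]]].
set c := sup A.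
have ac : a <= c by apply: ub_le_sup Aa; case: supA.
have cb : c <= b by apply: ge_sup; [exists a|move=> x [/andP[]]].
have [|e e0 eP] := step c; first by rewrite ac.
have [x [/andP[ax xb] Sx] cx] := sup_adherent e0 supA.
have xc : x <= c by apply: ub_le_sup; [case: supA|split=> //; rewrite ax].
have Sv v : c <= v <= b -> v < c + e -> S v.
  by move=> cv ve; apply: (eP x v) => //; rewrite cx.
have [cb'|] := ltP c b; last first.
  by move=> bc; apply: Sv; rewrite ?lexx ?cb //; lra.
pose v := Order.min b (c + e / 2).
have cv : c < v by rewrite lt_min cb' /= ltrDl divr_gt0.
have vb : v <= b by rewrite ge_min lexx.
have ve : v < c + e by rewrite gt_min; apply/orP; right; lra.
have Av : A v by split; [rewrite vb (le_trans ac) // ltW|apply: Sv; rewrite ?(ltW cv)].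
suff : v <= c by rewrite leNgt cv.
by apply: ub_le_sup Av; case: supA.
Qed.

(** An absolutely continuous function varies by at most the integral of a bound
on its derivative. Around a point where both it and the primitive [H] of the
bound are differentiable, its variation is at most that of [H], up to a small
error; the other points lie in an open set of small measure, where absolute
continuity makes the variation small. These estimates are put together by real
induction, which records the intervals of the second kind in a list. *)
Lemma abs_cont_le_integral g h : abs_cont01 g ->
  mu.-integrable setT (EFin \o h) -> (forall x, 0 <= h x) ->
  {ae mu, forall x, `[0, 1]%classic x ->
    exists2 l, deriv01 g x l & `|l| <= h x} ->
  forall a b, 0 <= a -> a <= b -> b <= 1 ->
  `|g b - g a| <= \int[mu]_(x in `]a, b]) h x.
Proof.
move=> gac hi h0 gh a b a0 ab b1.
pose H x := \int[mu]_(t in `](-1), x]) h t.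
have HB u v : 0 <= u -> u <= v -> H v - H u = \int[mu]_(x in `]u, v]) h x.
  move=> u0 uv; apply: Rintegral_itvB; rewrite ?bnd_simp //.
    exact: integrableS hi.
  by rewrite (le_trans _ u0) // lerN10.
have Hmono u v : 0 <= u -> u <= v -> 0 <= H v - H u.
  by move=> u0 uv; rewrite HB // Rintegral_ge0.
pose good x := forall e : R, 0 < e -> exists2 k : R, 0 < k & forall u v,
  0 <= u -> u <= x -> x <= v -> v <= 1 -> x - u < k -> v - x < k ->
  `|g v - g u| <= H v - H u + e * (v - u).
have : {ae mu, forall x, `[0, 1]%classic x -> good x}.
  have hloc : locally_integrable setT h by exact: open_integrable_locally openT hi.
  have hi' y : mu.-integrable [set` Interval (BRight (-1)) (BRight y)] (EFin \o h).
    exact: integrableS hi.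
  have := FTC1 hi' hloc.
  apply: filterS2 gh; first exact: (ae_filter_ringOfSetsType mu).
  move=> x + + x01 => /(_ x01) [l gl lh].
  have /andP[x0 x1] : 0 <= x <= 1 by move: x01; rewrite /= in_itv.
  move=> [|dH Hx]; first by rewrite lte_fin (lt_le_trans _ x0) // ltrN10.
  move=> e e0; have e4 : 0 < e / 4 by rewrite divr_gt0.
  have [k1 k10 k1P] := deriv01_remainder _ _ _ gl _ e4.
  have [k2 k20 k2P] := derivable_remainder _ _ _ dH Hx _ e4.
  exists (Order.min k1 k2) => [|u v u0 ux xv v1]; first by rewrite lt_min k10.
  rewrite !lt_min => /andP[uk1 uk2] /andP[vk1 vk2].
  have nv : `|v - x| = v - x by rewrite ger0_norm // subr_ge0.
  have nu : `|u - x| = x - u by rewrite distrC ger0_norm // subr_ge0.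
  have g1 : `|g v - g x - l * (v - x)| <= e / 4 * (v - x).
    by rewrite -[in leRHS]nv k1P ?nv // v1 andbT (le_trans x0).
  have g2 : `|g u - g x - l * (u - x)| <= e / 4 * (x - u).
    by rewrite -[in leRHS]nu k1P ?nu // u0 (le_trans ux).
  have H1 : - (e / 4 * (v - x)) <= H v - H x - h x * (v - x).
    by have := k2P v; rewrite nv => /(_ vk2); rewrite ler_norml => /andP[].
  have H2 : H u - H x - h x * (u - x) <= e / 4 * (x - u).
    by have := k2P u; rewrite nu => /(_ uk2); rewrite ler_norml => /andP[].
  have l1 : `|l| * (v - u) <= h x * (v - u).
    by rewrite ler_wpM2r // subr_ge0 (le_trans ux).
  have : `|g v - g u| <= `|l * (v - u)| + (e / 4 * (v - x) + e / 4 * (x - u)).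
    rewrite (_ : g v - g u = l * (v - u) + ((g v - g x - l * (v - x)) -
      (g u - g x - l * (u - x)))); last by ring.
    rewrite (le_trans (ler_normD _ _)) // lerD // (le_trans (ler_normB _ _)) //.
    exact: lerD.
  rewrite normrM (@ger0_norm _ (v - u)); last by rewrite subr_ge0 (le_trans ux).
  move=> hgv.
  have ev : 0 <= e * (v - x) by rewrite mulr_ge0 ?subr_ge0 // ltW.
  have eu : 0 <= e * (x - u) by rewrite mulr_ge0 ?subr_ge0 // ltW.
  apply: (le_trans hgv); apply: (le_trans (lerD l1 (lexx _))).
  lra.
(* N contains the points that are not good; U is an open neighbourhood of N of
   measure less than the modulus k of absolute continuity. *)
move=> [N [mN N0 sN]].
apply/ler_addgt0Pr => e e0; rewrite -HB //.
have e2 : 0 < e / 2 by rewrite divr_gt0.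
have [k k0 kP] := gac _ e2.
have [U [Uo NU Uk]] : exists U : set R, [/\ open U, N `<=` U & (mu U < k%:E)%E].
  have N0' : mu N = 0%E := N0.
  have [|U [Uo NU Uk]] := @lebesgue_regularity_outer R N k mN _ k0.
    by apply: (@le_lt_trans _ _ 0%E) => //; rewrite -N0'.
  exists U; split=> //; apply: le_lt_trans Uk.
  have mU : measurable U by exact: open_measurable.
  have UE : U = (U `\` N) `|` N.
    apply/seteqP; split => x; last by case=> [[]|/NU].
    by have [Nx|Nx] := pselect (N x); [right|left].
  rewrite [X in (mu X <= _)%E]UE.
  apply: le_trans (measureU2 _ _ _) _ => //; first exact: measurableD.
  rewrite -[leRHS]adde0; apply: leeD => //.
  by apply: (@le_trans _ _ 0%E) => //; rewrite -N0'.
have mU : measurable U by exact: open_measurable.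
have mUi x : measurable (U `&` `]a, x]%classic) by exact: measurableI.
have Lfin x : mu (U `&` `]a, x]%classic) \is a fin_num.
  rewrite ge0_fin_numE //; apply: le_lt_trans (ltry k).
  apply: le_trans (ltW Uk); apply: le_measure; rewrite ?inE //; exact: mUi.
(* L x is the length available in U to the left of x; it bounds the total length
   of the intervals recorded so far. *)
pose L x := fine (mu (U `&` `]a, x]%classic)).
have Lmono x v : x <= v -> L x <= L v.
  move=> xv; apply: fine_le => //.
  apply: le_measure; rewrite ?inE; [exact: mUi|exact: mUi|].
  by apply: setIS => y /=; rewrite !in_itv /= => /andP[-> /le_trans]; exact.
have Ladd x v : a <= x -> x <= v -> `]x, v]%classic `<=` U ->
    L v = L x + (v - x).
  move=> ax xv xvU.
  have E : U `&` `]a, v]%classic = (U `&` `]a, x]%classic) `|` `]x, v]%classic.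
    rewrite -(setIidr xvU) -setIUr; congr (_ `&` _).
    by apply: itv_bndbnd_setU; rewrite bnd_simp.
  have muE : (mu (U `&` `]a, v]%classic) =
      mu (U `&` `]a, x]%classic) + mu `]x, v]%classic)%E.
    rewrite E; apply: measureU => //; first exact: mUi.
    apply/seteqP; split => // y [[_]] /=; rewrite !in_itv /=.
    by move=> /andP[_ yx] /andP[xy _]; move: yx; rewrite leNgt xy.
  rewrite /L muE fineD //; last by rewrite lebesgue_measure_itv /=; case: ifP.
  congr (_ + _); rewrite lebesgue_measure_itv /= lte_fin.
  by move: xv; rewrite le_eqVlt => /predU1P[->|xv]; rewrite ?xv // ltxx subrr.
pose P x (l : seq (R * R)) :=
  [/\ all (fun q => [&& a <= q.1, q.1 <= q.2 & q.2 <= x]) l,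
      pairwise (fun q r => r.2 <= q.1) l,
      \sum_(q <- l) (q.2 - q.1) <= L x &
      `|g x - g a| <= H x - H a + e / 2 * (x - a) +
        \sum_(q <- l) `|g q.2 - g q.1|].
have [l [la lp lL lg]] : exists l, P b l.
  apply: (@real_induction a b (fun x => exists l, P x l)) => //.
    exists [::]; split=> //; first by rewrite big_nil /L fine_ge0.
    by rewrite big_nil !subrr mulr0 !addr0 normr0.
  move=> c /andP[ac cb].
  have widen x v l : x <= v -> P x l ->
      all (fun q => [&& a <= q.1, q.1 <= q.2 & q.2 <= v]) l.
    move=> xv [la _ _ _]; apply: sub_all la => q /and3P[-> -> /le_trans]; exact.
  have c01 : `[0, 1]%classic c.
    by rewrite /= in_itv /= (le_trans a0) //= (le_trans cb).
  have [cg|cb'] := pselect (good c).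
    have [i i0 iP] := cg _ e2; exists i => // x v [l Px] ax /andP[cx xc].
    move=> /andP[cv vb] vc; exists l.
    have xv : x <= v by rewrite (le_trans xc).
    split; first exact: widen Px.
    - by case: Px.
    - by case: Px => _ _ lL _; rewrite (le_trans lL) // Lmono.
    have xgv : `|g v - g x| <= H v - H x + e / 2 * (v - x).
      by apply: iP; rewrite ?(le_trans a0) ?(le_trans vb) //; lra.
    case: Px => _ _ _ lg; rewrite (_ : g v - g a = (g v - g x) + (g x - g a));
      last by ring.
    rewrite (le_trans (ler_normD _ _)) // (le_trans (lerD xgv lg)) //.
    by rewrite le_eqVlt; apply/orP; left; apply/eqP; ring.
  have Nc : N c by apply: sN => /= /(_ c01).
  have [i /= i0 iP] := (open_nbhs_nbhs (conj Uo (NU _ Nc)) : nbhs c U).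
  exists i => // x v [l Px] ax /andP[cx xc] /andP[cv vb] vc.
  have xv : x <= v by rewrite (le_trans xc).
  have xvU : `]x, v]%classic `<=` U.
    move=> y /=; rewrite in_itv /= => /andP[xy yv]; apply: iP.
    by rewrite /ball_ /= ltr_norml; apply/andP; split; lra.
  exists ((x, v) :: l); split.
  - by rewrite /= ax xv lexx /=; exact: widen Px.
  - rewrite /=; case: Px => la -> _ _; rewrite andbT.
    by apply: sub_all la => q /and3P[].
  - rewrite big_cons /= (Ladd x v) // addrC lerD //.
    by case: Px.
  case: Px => _ _ _ lg; rewrite big_cons /=.
  rewrite (_ : g v - g a = (g v - g x) + (g x - g a)); last by ring.
  rewrite (le_trans (ler_normD _ _)) // (le_trans (lerD (lexx _) lg)) //.
  have Hv := Hmono x v (le_trans a0 ax) xv.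
  have ev : 0 <= e / 2 * (v - x) by rewrite mulr_ge0 ?subr_ge0 // ltW.
  lra.
have lLk : \sum_(q <- l) (q.2 - q.1) < k.
  apply: (le_lt_trans lL); rewrite -lte_fin fineK //.
  by apply: le_lt_trans Uk; apply: le_measure; rewrite ?inE //; exact: mUi.
pose q0 : R * R := (0, 0).
have /(pairwiseP q0) lP := lp.
have := kP (size l) (fun i => (nth q0 l i).1) (fun i => (nth q0 l i).2).
have -> : \sum_(i < size l) ((nth q0 l i).2 - (nth q0 l i).1) =
    \sum_(q <- l) (q.2 - q.1) by rewrite (big_nth q0) big_mkord.
have -> : \sum_(i < size l) `|g (nth q0 l i).2 - g (nth q0 l i).1| =
    \sum_(q <- l) `|g q.2 - g q.1| by rewrite (big_nth q0) big_mkord.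
move=> K; have : \sum_(q <- l) `|g q.2 - g q.1| < e / 2.
  apply: K => // [i|i j ij].
    have := all_nthP q0 la _ (ltn_ord i) => /and3P[q1 q2 q3].
    by rewrite (le_trans a0) // q2 (le_trans q3).
  have /orP[ij'|ij'] : (i < j)%N || (j < i)%N by rewrite -neq_ltn.
  - by right; apply: (lP i j) => //; rewrite inE.
  - by left; apply: (lP j i) => //; rewrite inE.
have : e / 2 * (b - a) <= e / 2 by rewrite ler_piMr ?(ltW e2) //; lra.
lra.
Qed.

End AbsoluteContinuity.

Section SobolevRate.
Context {R : realType}.
Local Notation mu := (@lebesgue_measure R).
Implicit Types (f g G : R -> R) (a b h p x y : R) (i j k n r N : nat).

(** Composition with this retraction extends a function on the unit interval to the
line, where two-sided continuity and differentiability apply. *)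
Definition clamp01 x : R := Num.max 0 (Num.min x 1).

Lemma clamp01_itv x : 0 <= clamp01 x <= 1.
Proof. by rewrite /clamp01 le_max lexx ge_max ler01 ge_min lexx orbT. Qed.

Lemma clamp01_id x : 0 <= x <= 1 -> clamp01 x = x.
Proof.
by move=> /andP[x0 x1]; rewrite /clamp01 (min_idPl x1) (max_idPr x0).
Qed.

Lemma clamp01_lipschitz x y : `|clamp01 x - clamp01 y| <= `|x - y|.
Proof.
rewrite ler_norml /clamp01 /Num.max /Num.min.
have h1 := ler_norm (x - y); have h2 := ler_norm (y - x).
rewrite distrC in h2.
by case: (ltP x 1) => hx; case: (ltP y 1) => hy; case: ltP => h3; case: ltP => h4;
  apply/andP; split; lra.
Qed.

Definition continuous01 G : Prop :=
  forall x, 0 <= x <= 1 -> forall e : R, 0 < e -> exists2 b : R, 0 < b &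
    forall y, 0 <= y <= 1 -> `|y - x| < b -> `|G y - G x| <= e.

Lemma deriv01_continuous01 G (l : R -> R) :
  (forall x, `[0, 1]%classic x -> deriv01 G x (l x)) -> continuous01 G.
Proof.
move=> Gl x x01 e e0.
have /Gl Gx : `[0, 1]%classic x by rewrite /= in_itv.
have [b b0 bP] := deriv01_remainder _ _ _ Gx _ ltr01.
have l1 : 0 < `|l x| + 1 by rewrite ltr_wpDl.
exists (Num.min b (e / (`|l x| + 1))) => [|y y01].
  by rewrite lt_min b0 divr_gt0.
rewrite lt_min => /andP[yb]; rewrite ltr_pdivlMr // => ye.
have := bP y y01 yb; rewrite mul1r => h.
rewrite (_ : G y - G x = (G y - G x - l x * (y - x)) + l x * (y - x)); last by ring.
rewrite (le_trans (ler_normD _ _)) // normrM.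
apply: le_trans (ltW ye).
by rewrite (mulrDr `|y - x|) mulr1 addrC (mulrC `|y - x|) lerD.
Qed.

Lemma abs_cont_continuous01 G : abs_cont01 G -> continuous01 G.
Proof.
move=> Gac x /andP[x0 x1] e e0; have [b b0 bP] := Gac e e0.
have H u v : 0 <= u -> u <= v -> v <= 1 -> v - u < b -> `|G v - G u| < e.
  move=> u0 uv v1 uvb; have := bP 1%N (fun=> u) (fun=> v); rewrite !big_ord1.
  by apply=> // i j; rewrite (ord1 i) (ord1 j).
exists b => // y /andP[y0 y1]; have [xy|yx] := leP x y.
  by rewrite ger0_norm ?subr_ge0 // => yb; exact/ltW/H.
by rewrite distrC (distrC (G y)) gtr0_norm ?subr_gt0 // => yb; apply/ltW/H; rewrite ?(ltW yx).
Qed.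

Lemma continuous_clamp01 G : continuous01 G -> continuous (G \o clamp01).
Proof.
move=> Gc x; apply/cvgrPdist_le => e e0.
have [b b0 bP] := Gc _ (clamp01_itv x) e e0.
exists b => //= y /= xy; rewrite distrC bP ?clamp01_itv //.
by rewrite (le_lt_trans (clamp01_lipschitz _ _)) // distrC.
Qed.

Lemma is_derive_clamp01 G x (l : R) : 0 < x < 1 -> deriv01 G x l ->
  is_derive x 1 (G \o clamp01) l.
Proof.
move=> /andP[x0 x1] Gl; apply: is_derive_remainder => e e0.
have [b b0 bP] := deriv01_remainder _ _ _ Gl e e0.
exists (Num.min b (Num.min x (1 - x))) => [|y].
  by rewrite !lt_min b0 x0 subr_gt0.
rewrite !lt_min => /and3P[yb]; rewrite !ltr_norml => /andP[y1 _] /andP[_ y2].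
have y01 : 0 <= y <= 1 by apply/andP; split; lra.
rewrite /= !clamp01_id ?bP //.
by rewrite !ltW.
Qed.

Lemma continuous_fwd_diff G h : continuous G -> continuous (fwd_diff h G).
Proof.
move=> Gc z; apply: cvgB; last exact: Gc.
apply: (@continuous_comp _ _ _ (fun t => t + h) G); last exact: Gc.
by apply: cvgD; [exact: cvg_id|exact: cvg_cst].
Qed.

Lemma is_derive_fwd_diff G (l : R -> R) h x : is_derive x 1 G (l x) ->
  is_derive (x + h) 1 G (l (x + h)) ->
  is_derive x 1 (fwd_diff h G) (fwd_diff h l x).
Proof.
move=> Gx Gxh; apply: is_deriveB; apply: is_derive_remainder => e e0.
have [c c0 cP] := derivable_remainder _ _ _ (@ex_derive _ _ _ _ _ _ _ Gxh)
  (etrans (derive1E _ _) derive_val) e e0.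
exists c => // t tx; have := cP (t + h).
by rewrite opprD addrACA subrr addr0; exact.
Qed.

Lemma sum_shift_le (a : nat -> R) k n N : (forall i, 0 <= a i) ->
  (n + k <= N)%N -> \sum_(i < n) a (i + k)%N <= \sum_(i < N) a i.
Proof.
move=> a0 nN; rewrite (_ : N = k + n + (N - (n + k)))%N; last by lia.
rewrite big_split_ord big_split_ord /= -[leLHS]addr0 lerD ?sumr_ge0 //.
rewrite -[leLHS]add0r lerD ?sumr_ge0 //.
by apply: ler_sum => i _; rewrite addnC.
Qed.

(** The mean value theorem for differences of order [r], by iterating the usual
one on the differences of the successive derivatives. *)
Lemma fwd_diff_mvt r (G : nat -> R -> R) h b : 0 < h ->
  (forall j, (j < r)%N -> continuous (G j) /\
    forall x, 0 < x < b -> is_derive x 1 (G j) (G j.+1 x)) ->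
  forall x, 0 <= x -> x + r%:R * h <= b ->
  exists2 y, x <= y <= x + r%:R * h &
    iter r (fwd_diff h) (G 0%N) x = h ^+ r * G r y.
Proof.
move=> h0; elim: r G b => [|r IH] G b GP x x0 xb.
  by exists x; rewrite ?mul0r ?addr0 ?lexx // expr0 mul1r.
rewrite -natr1 mulrDl mul1r in xb.
have [||y /andP[xy yx] yE] := IH (fun j => fwd_diff h (G j)) (b - h) _ x x0.
- move=> j jr; have [Gc Gd] := GP j (ltnW jr).
  split=> [|z /andP[z0 zb]]; first exact: continuous_fwd_diff.
  by apply: is_derive_fwd_diff; apply: Gd; apply/andP; split; lra.
- lra.
rewrite iterSr yE.
have [Gc Gd] := GP r (ltnSn r).
have y0 : 0 <= y by exact: le_trans xy.
have rh : 0 <= r%:R * h by rewrite mulr_ge0 // ltW.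
have [|||z] := @MVT_segment R (G r) (G r.+1) y (y + h) _ _ _.
- by rewrite lerDl ltW.
- by move=> z; rewrite in_itv /= => /andP[yz zy]; apply: Gd; apply/andP; split; lra.
- exact: continuous_subspaceT.
rewrite in_itv /= => /andP[yz zy] zE; exists z.
  by rewrite -natr1 mulrDl mul1r; apply/andP; split; lra.
rewrite /fwd_diff zE exprSr -mulrA; congr (_ * _).
by rewrite addrAC subrr add0r mulrC.
Qed.

Lemma eq_in_seq_diff k N (A B : nat -> R) i :
  (forall n, (n <= N)%N -> A n = B n) -> (i + k <= N)%N ->
  seq_diff k A i = seq_diff k B i.
Proof.
move=> AB; elim: k i => [|k IH] i iN; first by apply: AB; lia.
by rewrite !seq_diffSl !IH //; lia.
Qed.

(** [`|g| <= 1 + `|g| `^ p] on an interval of finite length. *)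
Lemma Lp01_integrable p g : 1 <= p -> Lp01 p g ->
  mu.-integrable setT (EFin \o (g \_ `[0, 1])) /\
  (\int[mu]_x (`|(g \_ `[0%R, 1%R]) x| `^ p)%:E < +oo)%E.
Proof.
move=> p1 gp; have p0 : 0 < p by rewrite (lt_le_trans _ p1).
have mg : measurable_fun setT (g \_ `[0, 1]).
  by have := sub_Lfun_mfun gp; rewrite inE.
have gpi := Lfun_integrable p1 gp.
have gpfin : (\int[mu]_x (`|(g \_ `[0%R, 1%R]) x| `^ p)%:E < +oo)%E.
  have /integrableP[_] := gpi; apply: le_lt_trans; apply: ge0_le_integral_nonmeasurable.
    by move=> x _; rewrite lee_fin powR_ge0.
  by move=> x _; rewrite lee_abs.
split=> //.
apply: (le_integrable measurableT _ _
  (integrableD measurableT (integrable_indic_itv 0 1 true false) gpi)).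
  exact/measurable_EFinP.
move=> x _ /=; rewrite lee_fin.
rewrite [leRHS]ger0_norm; last by rewrite addr_ge0 ?powR_ge0 // indicE.
rewrite patchE indicE /=; case: ifPn => x01; last first.
  by rewrite normr0 add0r powR_ge0.
have [g1|g1] := leP `|g x| 1; first by rewrite (le_trans g1) // lerDl powR_ge0.
by rewrite (le_trans (le1r_powR (ltW g1) p1)) // lerDr.
Qed.

(** By the mean value theorem the differences of order [r.+1] of the regular
representative are variations of its derivative of order [r] over one step,
which absolute continuity bounds by integrals of the last derivative. *)
Lemma sobolev_diff_rate f p r : 1 <= p -> mu.-integrable setT (EFin \o f) ->
  sobolev01 r.+1 p (f \_ `[0, 1]) -> diff_rate r r.+1%:R p (primitive f).
Proof.
move=> p1 fi [D [fD /= Dd Dac Dae Dp]].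
have p0 : 0 < p by rewrite (lt_le_trans _ p1).
have [gi gfin] := Lp01_integrable _ _ p1 Dp.
have Dc j : (j <= r)%N -> continuous01 (D j).
  rewrite leq_eqVlt => /predU1P[->|jr]; first exact: abs_cont_continuous01.
  by apply: (@deriv01_continuous01 _ (D j.+1)) => x x01; exact: Dd.
pose E j := D j \o clamp01.
have Ec j : (j <= r)%N -> continuous (E j).
  by move=> jr; apply: continuous_clamp01; exact: Dc.
have Ed j x : (j < r)%N -> 0 < x < 1 -> is_derive x 1 (E j) (E j.+1 x).
  move=> jr /andP[x0 x1]; rewrite /E /= clamp01_id ?(ltW x0) ?(ltW x1) //.
  apply: is_derive_clamp01; first by rewrite x0.
  by apply: Dd => //; rewrite /= in_itv /= !ltW.
(* The last derivative dominates the variations of the previous one. *)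
pose w x := `|(D r.+1 \_ `[0, 1]%classic) x|.
have wi : mu.-integrable setT (EFin \o w) by exact: (integrable_norm gi).
have w0 x : 0 <= w x by rewrite /w /=.
have Evar a b : 0 <= a -> a <= b -> b <= 1 ->
    `|E r b - E r a| <= primitive w b - primitive w a.
  move=> a0 ab b1; rewrite primitiveB // /E /= !clamp01_id; last 2 first.
  - by rewrite a0 (le_trans ab).
  - by rewrite b1 (le_trans a0).
  apply: abs_cont_le_integral => //.
  move: Dae; apply: filterS; first exact: (ae_filter_ringOfSetsType mu).
  move=> x Dx x01; exists (D r.+1 x); first exact: Dx.
  by rewrite /w /= patchE mem_set.
pose F0 := E 0%N \_ `[0, 1]%classic.
have F0i : mu.-integrable setT (EFin \o F0).
  have := @integrable_mkcond _ _ R mu `[0%R, 1%R]%classic (EFin \o E 0%N).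
  rewrite restrict_EFin => <- //.
  apply: continuous_compact_integrable; first exact: segment_compact.
  by apply: continuous_subspaceT; exact: Ec.
have FE x : 0 <= x <= 1 -> primitive f x = primitive F0 x.
  move=> /andP[x0 x1]; rewrite /primitive /Rintegral; congr fine.
  apply: ae_eq_integral => //.
  - by apply: measurable_funTS; exact: measurable_int fi.
  - by apply: measurable_funTS; exact: measurable_int F0i.
  move: fD; apply: filterS; first exact: (ae_filter_ringOfSetsType mu).
  move=> y fy; rewrite /= in_itv /= => /andP[y0 yx].
  have y01 : `[0, 1]%classic y by rewrite /= in_itv /= (ltW y0) (le_trans yx).
  have := fy y01; rewrite /F0 !patchE mem_set // => ->.
  by rewrite /E /= clamp01_id //; move: y01; rewrite /= in_itv.
pose A := fine (\int[mu]_x (`|(D r.+1 \_ `[0%R, 1%R]) x| `^ p)%:E).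
have A0 : 0 <= A.
  by apply: fine_ge0; apply: integral_ge0 => x _; rewrite lee_fin powR_ge0.
exists (r.+2%:R * r.+2%:R * (1 + A)) => [|N N0]; first by rewrite !mulr_ge0 // addr_ge0.
have Nr0 : 0 < (N%:R : R) by rewrite ltr0n.
set h : R := N%:R^-1; have h0 : 0 < h by rewrite invr_gt0.
have Nh : N%:R * h = 1 by rewrite /h mulfV // gt_eqF.
have nh n : (n <= N)%N -> 0 <= n%:R * h <= 1.
  by move=> nN; rewrite mulr_ge0 ?(ltW h0) //= -[leRHS]Nh ler_pM2r // ler_nat.
have NE b : N%:R `^ (- b) = h `^ b :> R.
  by rewrite /h -(powR_inv1 (ltW Nr0)) -powRrM mulN1r.
have -> : N%:R `^ (1 - p) = h `^ (p - 1) :> R by rewrite -NE opprB.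
rewrite NE powR_mulrn ?(ltW h0) //.
pose W j := primitive w (j.+1%:R * h) - primitive w (j%:R * h).
have W0 j : 0 <= W j.
  rewrite /W primitiveB // ?mulr_ge0 ?(ltW h0) // ?ler_pM2r // ?ler_nat //.
  by apply: Rintegral_ge0.
have Wp : \sum_(j < N) W j `^ p <= h `^ (p - 1) * A.
  rewrite -lee_fin -sumEFin EFinM.
  apply: (@le_trans _ _ (\sum_(j < N) (h `^ (p - 1))%:E *
      \int[mu]_(x in cell h j) (`|w x| `^ p)%:E)%E).
    apply: lee_sum => j _.
    rewrite -{1}(ger0_norm (W0 j)) /W primitiveB ?mulr_ge0 ?(ltW h0) //; last first.
      by rewrite ler_pM2r // ler_nat.
    apply: (Rintegral_powR_le (cell h j)) => //; first exact: measurable_cell.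
      exact: lebesgue_cell.
    by apply: integrableS wi => //; exact: measurable_cell.
  have mw (B : set R) : measurable_fun B (fun x => (`|w x| `^ p)%:E).
    apply: measurable_powR_norm; apply: measurable_funTS.
    by apply/measurable_EFinP; exact: measurable_int wi.
  rewrite -ge0_sume_distrr; last first.
    by move=> j _; apply: integral_ge0 => x _; rewrite lee_fin powR_ge0.
  rewrite -integral_cells //.
  rewrite lee_wpmul2l ?lee_fin ?powR_ge0 //.
  rewrite /A fineK; last first.
    by rewrite ge0_fin_numE // integral_ge0 // => x _; rewrite lee_fin powR_ge0.
  apply: le_trans (ge0_subset_integral mu _ measurableT _ _ (@subsetT _ _)) _ => //.
    exact: mw.
  apply: ge0_le_integral_nonmeasurable => x _; first by rewrite lee_fin powR_ge0.
  by rewrite /w /= normr_id.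
have key i : (i < N - r.+1)%N ->
    `|seq_diff r.+2 (fun n => primitive f (n%:R * h)) i| <=
    h ^+ r.+1 * \sum_(l < r.+2) W (i + l)%N.
  move=> iN; rewrite (@eq_in_seq_diff _ N _ (fun n => primitive F0 (n%:R * h)));
    [|by move=> n nN; exact: FE (nh n nN)|by rewrite addnS addnC -ltn_subRL].
  have -> : \sum_(l < r.+2) W (i + l)%N =
      primitive w ((i + r.+2)%:R * h) - primitive w (i%:R * h).
    elim: (r.+2) => [|n IHn]; first by rewrite big_ord0 addn0 subrr.
    by rewrite big_ord_recr /= IHn /W addnS; ring.
  rewrite (seq_diff_primitive _ F0i) //.
  have ci : mu.-integrable (cell h i) (EFin \o iter r.+1 (fwd_diff h) F0).
    apply: integrableS (integrable_iter_diff _ F0i _ _) => //.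
    exact: measurable_cell.
  apply: le_trans (le_normr_Rintegral _ ci) _; first exact: measurable_cell.
  set V := _ - _.
  have iN1 : i.+1%:R * h + r.+1%:R * h <= 1.
    have /nh /andP[_] : (i.+1 + r.+1 <= N)%N by rewrite addSn addnC -ltn_subRL.
    by rewrite natrD mulrDl.
  have iE : i.+1%:R * h = i%:R * h + h by rewrite -natr1 mulrDl mul1r.
  have rE : r.+1%:R * h = r%:R * h + h by rewrite -natr1 mulrDl mul1r.
  have rh0 : 0 <= r%:R * h by rewrite mulr_ge0 // ltW.
  have ih0 : 0 <= i%:R * h by rewrite mulr_ge0 // ltW.
  have bound x : cell h i x -> `|iter r.+1 (fwd_diff h) F0 x| <= h ^+ r * V.
    move=> cx; have /andP[x0 x1] : i%:R * h < x <= i.+1%:R * h.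
      by move: cx; rewrite /cell /= in_itv.
    have xx : 0 <= x by lra.
    have xr : x + r.+1%:R * h <= 1 by lra.
    rewrite iter_fwd_diff_restrict ?(ltW h0) //.
    rewrite iterSr.
    have [|||y /andP[y1 y2] ->] := @fwd_diff_mvt r (fun j => fwd_diff h (E j)) h
      (1 - h) h0 _ x.
    - move=> j jr; split=> [|z /andP[z0 zb]].
        exact: continuous_fwd_diff (Ec _ (ltnW jr)).
      by apply: is_derive_fwd_diff; apply: Ed => //; apply/andP; split; lra.
    - lra.
    - lra.
    rewrite normrM ger0_norm ?exprn_ge0 ?(ltW h0) // ler_wpM2l ?exprn_ge0 ?(ltW h0) //.
    rewrite /fwd_diff (le_trans (Evar _ _ _ _ _)) //; [lra|lra|lra|].
    have wmono a b : 0 <= a -> a <= b -> primitive w a <= primitive w b.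
      by move=> a0 ab; rewrite -subr_ge0 primitiveB // Rintegral_ge0.
    have E2 : (i + r.+2)%:R * h = i%:R * h + (r%:R * h + h + h).
      by rewrite natrD -2!natr1; ring.
    rewrite /V lerB // wmono // ?E2; lra.
  apply: (@le_trans _ _ (\int[mu]_(x in cell h i) (h ^+ r * V))).
    apply: le_Rintegral => //; first exact: measurable_cell.
      exact: integrable_norm ci.
    apply/integrableP; split; first exact: measurable_cst.
    rewrite (_ : (\int[mu]_(x in cell h i) _)%E =
      ((`|h ^+ r * V|)%:E * mu (cell h i))%E); last first.
      exact: (integral_cst mu (measurable_cell h i) (`|h ^+ r * V|)%:E).
    by rewrite lebesgue_cell // -EFinM ltry.
  rewrite Rintegral_cst; last exact: measurable_cell.
  rewrite [X in fine X](_ : _ = h%:E); last exact: lebesgue_cell.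
  by rewrite /= mulrC mulrA -exprS.
apply: (@le_trans _ _ (\sum_(i < N - r.+1) (h ^+ r.+1 *
    \sum_(l < r.+2) W (i + l)%N) `^ p)).
  apply: ler_sum => i _; rewrite ge0_ler_powR ?nnegrE ?(ltW p0) //.
    by rewrite mulr_ge0 ?exprn_ge0 ?(ltW h0) ?sumr_ge0.
  exact: key.
apply: (@le_trans _ _ ((h ^+ r.+1) `^ p * (r.+2%:R `^ p *
    \sum_(i < N - r.+1) \sum_(l < r.+2) W (i + l)%N `^ p))).
  rewrite mulrA mulr_sumr; apply: ler_sum => i _.
  rewrite powRM ?exprn_ge0 ?(ltW h0) ?sumr_ge0 // -mulrA ler_wpM2l ?powR_ge0 //.
  exact: powR_sum_le.
have sumW : \sum_(i < N - r.+1) \sum_(l < r.+2) W (i + l)%N `^ p <=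
    r.+2%:R * (h `^ (p - 1) * A).
  have [Nr|rN] := leqP N r.+1.
    have -> : (N - r.+1 = 0)%N by apply/eqP; rewrite subn_eq0.
    by rewrite big_ord0 !mulr_ge0 ?powR_ge0.
  rewrite exchange_big /=.
  apply: (@le_trans _ _ (\sum_(l < r.+2) (h `^ (p - 1) * A))); last first.
    by rewrite sumr_const card_ord -[leLHS]mulr_natl.
  apply: ler_sum => l _; apply: le_trans Wp.
  apply: (@sum_shift_le (fun j => W j `^ p)) => [j|]; first exact: powR_ge0.
  by rewrite -[leqRHS](subnK (ltnW rN)) leq_add2l -ltnS.
have hr0 : 0 <= h ^+ r.+1 by rewrite exprn_ge0 // ltW.
apply: (@le_trans _ _ ((h ^+ r.+1) `^ p * (r.+2%:R `^ p *
    (r.+2%:R * (h `^ (p - 1) * A))))).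
  by rewrite !ler_wpM2l ?powR_ge0.
have A10 : 0 <= 1 + A by rewrite addr_ge0.
have rr0 : 0 <= r.+2%:R * r.+2%:R :> R by rewrite mulr_ge0.
have rA0 : 0 <= r.+2%:R * r.+2%:R * (1 + A) by rewrite mulr_ge0.
rewrite (powRM _ rA0 hr0) (powRM _ rr0 A10) powRM //.
have r1 : r.+2%:R <= r.+2%:R `^ p :> R by rewrite le1r_powR // ler1n.
have A1 : A <= (1 + A) `^ p.
  by apply: (@le_trans _ _ (1 + A)); rewrite ?lerDr // le1r_powR // lerDl.
have : r.+2%:R * A <= r.+2%:R `^ p * (1 + A) `^ p by exact: ler_pM.
move=> /(ler_wpM2l (mulr_ge0 (powR_ge0 (h ^+ r.+1) p) (mulr_ge0
  (powR_ge0 r.+2%:R p) (powR_ge0 h (p - 1))))) H.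
apply: (le_trans _ (le_trans H _)); rewrite le_eqVlt; apply/orP; left;
  by apply/eqP; ring.
Qed.

End SobolevRate.

(** * The projection onto piecewise polynomials *)

Section PolynomialIntegrals.
Context {R : realType}.
Local Notation mu := (@lebesgue_measure R).
Implicit Types (p q : {poly R}) (a b : R).

Lemma poly_antiderivative p : exists q, q^`() = p.
Proof.
exists (\poly_(i < (size p).+1) (p`_i.-1 / i%:R)).
apply/polyP => i; rewrite coef_deriv coef_poly ltnS.
case: ltnP => [ip|pi]; last by rewrite mul0rn nth_default.
by rewrite /= -[LHS]mulr_natr divfK // pnatr_eq0.
Qed.

Lemma integrable_poly_cell p m j :
  mu.-integrable (cell m%:R^-1 j) (EFin \o (fun x => p.[m%:R * x - j%:R])).
Proof.
have -> : (fun x => p.[m%:R * x - j%:R]) = horner (p \Po (m%:R *: 'X - j%:R%:P)).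
  by apply/funext => x; rewrite horner_comp hornerD hornerN hornerZ hornerX hornerC.
set q := p \Po _.
have qi : mu.-integrable `[j%:R * m%:R^-1, j.+1%:R * m%:R^-1] (EFin \o horner q).
  apply: continuous_compact_integrable; first exact: segment_compact.
  by apply: continuous_subspaceT; exact: continuous_horner.
apply: integrableS qi => //; first exact: measurable_cell.
by move=> x; rewrite /cell /= !in_itv /= => /andP[/ltW -> ->].
Qed.

Lemma Rintegral_deriv_poly q a b : a < b ->
  \int[mu]_(x in `]a, b]) (q^`()).[x] = q.[b] - q.[a].
Proof.
move=> ab; rewrite /Rintegral.
have mq : measurable_fun setT (EFin \o (fun x => (q^`()).[x])).
  by apply/measurable_EFinP; exact: measurable_horner.
rewrite integral_itv_obnd_cbnd; last exact: measurable_funTS.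
rewrite (@continuous_FTC2 _ (fun x => (q^`()).[x]) (horner q)) //.
- by apply: continuous_subspaceT; exact: continuous_horner.
- split=> [x _||]; first exact: derivable_horner.
    by apply: cvg_at_right_filter; exact: continuous_horner.
  by apply: cvg_at_left_filter; exact: continuous_horner.
- by move=> x _; rewrite -derivE.
Qed.

(** The affine change of variables is performed on antiderivatives. *)
Lemma Rintegral_cell_poly p m j : (0 < m)%N ->
  \int[mu]_(x in cell m%:R^-1 j) p.[m%:R * x - j%:R] =
  m%:R^-1 * \int[mu]_(x in `]0, 1]) p.[x].
Proof.
move=> m0; have mr0 : 0 < m%:R :> R by rewrite ltr0n.
have [q qp] := poly_antiderivative p.
rewrite -qp Rintegral_deriv_poly //.
pose s := q \Po (m%:R *: 'X - j%:R%:P).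
have -> : \int[mu]_(x in cell m%:R^-1 j) (q^`()).[m%:R * x - j%:R] =
    m%:R^-1 * \int[mu]_(x in cell m%:R^-1 j) (s^`()).[x].
  have sE x : (s^`()).[x] = m%:R * (q^`()).[m%:R * x - j%:R].
    rewrite /s deriv_comp hornerM horner_comp derivB derivZ derivX derivC subr0.
    rewrite !(hornerD, hornerN, hornerZ, hornerX, hornerC).
    by rewrite mulr1 mulrC.
  under [in RHS]eq_Rintegral do rewrite sE.
  rewrite RintegralZl; [|exact: measurable_cell|exact: integrable_poly_cell].
  by rewrite mulKf // gt_eqF.
rewrite Rintegral_deriv_poly; last by rewrite ltr_pM2r ?invr_gt0 // ltr_nat.
rewrite /s !horner_comp !(hornerD, hornerN, hornerZ, hornerX, hornerC).
rewrite !(mulrCA m%:R) mulfV ?gt_eqF // !mulr1 subrr -natr1 addrAC subrr add0r.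
by [].
Qed.

Lemma integrable_bounded_mul (D : set R) (g f : R -> R) (c : R) :
  measurable D -> measurable_fun D g -> (forall x, D x -> `|g x| <= c) ->
  mu.-integrable D (EFin \o f) ->
  mu.-integrable D (EFin \o (fun x => g x * f x)).
Proof.
move=> mD mg gc fi.
have mf : measurable_fun D f by apply/measurable_EFinP; exact: measurable_int fi.
have cfi : mu.-integrable D (fun x => c%:E * (EFin \o f) x)%E.
  exact: integrableZl.
apply: (le_integrable _ _ _ cfi); first exact: mD.
  by apply/measurable_EFinP; exact: measurable_funM.
move=> x Dx /=; rewrite lee_fin !normrM ler_wpM2r //.
exact: le_trans (gc x Dx) (ler_norm c).
Qed.

End PolynomialIntegrals.

Section Projection.
Context {R : realType}.
Local Notation mu := (@lebesgue_measure R).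
Variables (r : nat) (Q : 'I_r.+1 -> {poly R}).
Hypothesis hQ : orthonormal_basis01 Q.
Implicit Types (f : R -> R) (p x y : R) (m j : nat) (i : 'I_r.+1).

(** When [f] is the density of the observations, this is the expectation of the
empirical coefficient [Defs.coefX]. *)
Definition basis_coef f m (q : {poly R}) j : R :=
  \int[mu]_x (phi m q j x * f x).

Definition projection f m (x : R) : R :=
  \sum_(i < r.+1) \sum_(j < m) basis_coef f m (Q i) j * phi m (Q i) j x.

Lemma orthonormal_bounded : exists2 B : R, 0 <= B &
  forall i y, 0 <= y <= 1 -> `|(Q i).[y]| <= B.
Proof.
pose c i := sval (cid2 (poly_bounded01 (Q i))).
have c0 i : 0 <= c i by rewrite /c; case: cid2.
have cP i y : 0 <= y <= 1 -> `|(Q i).[y]| <= c i.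
  by rewrite /c; case: cid2 => /= ? _; exact.
exists (\sum_i c i) => [|i y y01]; first exact: sumr_ge0.
by rewrite (le_trans (cP i y y01)) // (bigD1 i) //= lerDl sumr_ge0.
Qed.

Lemma phi_cell m q j x : (0 < m)%N -> cell m%:R^-1 j x ->
  phi m q j x = Num.sqrt m%:R * q.[m%:R * x - j%:R].
Proof. by move=> m0 jx; rewrite /phi poly_cell_in. Qed.

Lemma phi_eq0 m q j x : (0 < m)%N -> ~ cell m%:R^-1 j x -> phi m q j x = 0 :> R.
Proof.
move=> m0 jx; rewrite /phi /poly_cell; case: ifPn => [h|_]; last by rewrite mulr0.
by exfalso; apply: jx; apply/cellP.
Qed.

Lemma measurable_phi m q j : measurable_fun setT (@phi R m q j).
Proof. by apply: measurable_funM => //; exact: measurable_cell_poly. Qed.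

Lemma basis_coefE f m q j : (0 < m)%N ->
  basis_coef f m q j =
  \int[mu]_(x in cell m%:R^-1 j) (Num.sqrt m%:R * q.[m%:R * x - j%:R] * f x).
Proof.
move=> m0; rewrite /basis_coef [RHS]Rintegral_mkcond; apply: eq_Rintegral => x _.
rewrite patchE; case: ifPn => jx.
  by rewrite phi_cell //; move: jx; rewrite inE.
by rewrite phi_eq0 ?mul0r //; move/negP: jx; rewrite inE.
Qed.

Lemma projection_cell f m j x : (0 < m)%N -> (j < m)%N -> cell m%:R^-1 j x ->
  projection f m x = \sum_(i < r.+1)
    basis_coef f m (Q i) j * (Num.sqrt m%:R * (Q i).[m%:R * x - j%:R]).
Proof.
move=> m0 jm jx; apply: eq_bigr => i _.
rewrite (bigD1 (Ordinal jm)) //= phi_cell // big1 ?addr0 // => l.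
rewrite -val_eqE /= => lj.
by rewrite /phi (poly_cell_eq0 _ _ _ _ _ m0 jx lj) !mulr0.
Qed.

Lemma measurable_projection f m : measurable_fun setT (projection f m).
Proof.
apply: measurable_sum => i; apply: measurable_sum => j.
by apply: measurable_funM => //; exact: measurable_phi.
Qed.

(** Orthonormality makes the projection reproduce piecewise polynomials. *)
Lemma basis_reproduces (g : {poly R}) m j (y : R) : (size g <= r.+1)%N ->
  (0 < m)%N ->
  \sum_(i < r.+1)
    (\int[mu]_(x in cell m%:R^-1 j)
       (Num.sqrt m%:R * (Q i).[m%:R * x - j%:R] * g.[m%:R * x - j%:R])) *
    (Num.sqrt m%:R * (Q i).[y]) = g.[y].
Proof.
move=> sg m0; have [_ Qorth Qspan] := hQ.
have mr0 : 0 < m%:R :> R by rewrite ltr0n.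
have [c gE] := Qspan g sg.
have intQ i l : \int[mu]_(x in `]0, 1]) (Q i * Q l).[x] = (i == l)%:R.
  rewrite /Rintegral integral_itv_obnd_cbnd; last first.
    by apply/measurable_EFinP; apply: measurable_funTS; exact: measurable_horner.
  under eq_integral do rewrite hornerM.
  by rewrite Qorth.
have intg i : \int[mu]_(x in `]0, 1]) (Q i * g).[x] = c i.
  have [q qE] := poly_antiderivative (Q i * g).
  have /choice [q_ q_E] : forall l, exists q, q^`() = Q i * Q l.
    by move=> l; exact: poly_antiderivative.
  have E : (\sum_l c l *: q_ l)^`() = Q i * g.
    rewrite (big_morph _ (@derivD R) (deriv0 R)) gE mulr_sumr.
    by apply: eq_bigr => l _; rewrite derivZ q_E scalerAr.
  rewrite -E Rintegral_deriv_poly // !horner_sum -sumrB.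
  rewrite (bigD1 i) //= big1 ?addr0 => [|l li].
    rewrite !hornerZ -mulrBr -Rintegral_deriv_poly // q_E intQ eqxx mulr1 //.
  rewrite !hornerZ -mulrBr -Rintegral_deriv_poly // q_E intQ.
  by rewrite eq_sym (negbTE li) mulr0.
rewrite [in RHS]gE horner_sum; apply: eq_bigr => i _; rewrite hornerZ.
have -> : \int[mu]_(x in cell m%:R^-1 j)
    (Num.sqrt m%:R * (Q i).[m%:R * x - j%:R] * g.[m%:R * x - j%:R]) =
    Num.sqrt m%:R * (m%:R^-1 * c i).
  rewrite -intg -(Rintegral_cell_poly _ _ j m0) -RintegralZl //.
  - by apply: eq_Rintegral => x _; rewrite hornerM mulrA.
  - exact: measurable_cell.
  - exact: integrable_poly_cell.
have sm : Num.sqrt m%:R * Num.sqrt m%:R = m%:R :> R.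
  by rewrite -expr2 sqr_sqrtr // ltW.
rewrite [LHS](_ : _ = (Num.sqrt m%:R * Num.sqrt m%:R) * m%:R^-1 *
  (c i * (Q i).[y])); last by ring.
by rewrite sm mulfV ?mul1r // gt_eqF.
Qed.

Local Open Scope ereal_scope.

(** The projection is local and stable in [L^p], and it reproduces piecewise
polynomials, so its error is of the order of that of any such approximation. *)
Lemma projection_error p : (1 <= p)%R -> (p <= 2)%R ->
  exists2 c : R, (0 <= c)%R & forall f (g : nat -> {poly R}) m, (0 < m)%N ->
    mu.-integrable setT (EFin \o f) ->
    (forall j, (size (g j) <= r.+1)%N) ->
    \int[mu]_(x in `]0%R, 1%R]) (`|projection f m x - f x| `^ p)%:E <=
    c%:E * \int[mu]_(x in `]0%R, 1%R]) (`|f x - piecewise m g x| `^ p)%:E.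
Proof.
move=> p1 p2; have p0 : (0 <= p)%R by rewrite (le_trans _ p1).
have [B B0 QB] := orthonormal_bounded.
pose b := (r.+1%:R * B ^+ 2 : R)%R.
have b0 : (0 <= b)%R by rewrite /b mulr_ge0 ?exprn_ge0.
exists (4 * (b `^ p + 1))%R => [|f g m m0 fi sg].
  by rewrite mulr_ge0 // addr_ge0 ?powR_ge0.
have mr0 : (0 < m%:R :> R)%R by rewrite ltr0n.
have h0 : (0 < m%:R^-1 :> R)%R by rewrite invr_gt0.
set G := piecewise m g.
have mf : measurable_fun setT f by apply/measurable_EFinP; exact: measurable_int fi.
have mG : measurable_fun setT G by exact: measurable_piecewise.
have mpr : measurable_fun setT (projection f m) by exact: measurable_projection.
have m1 : (m%:R * m%:R^-1 = 1 :> R)%R by rewrite mulfV // gt_eqF.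
have mE1 : measurable_fun setT (fun x => (`|projection f m x - f x| `^ p)%:E).
  by apply: measurable_powR_norm; exact: measurable_funB.
have mE2 : measurable_fun setT (fun x => (`|f x - G x| `^ p)%:E).
  by apply: measurable_powR_norm; exact: measurable_funB.
rewrite -[X in Interval _ (BRight X)]m1.
rewrite !integral_cells //; last 2 first.
- exact: measurable_funTS.
- exact: measurable_funTS.
rewrite ge0_sume_distrr; last first.
  by move=> j _; apply: integral_ge0 => x _; rewrite lee_fin powR_ge0.
apply: lee_sum => j _; have jm := ltn_ord j.
have mC : measurable (cell m%:R^-1 j : set (measurableTypeR R)).
  exact: measurable_cell.
have fci : mu.-integrable (cell m%:R^-1 j) (EFin \o f) by exact: integrableS fi.
have gci : mu.-integrable (cell m%:R^-1 j)
    (EFin \o (fun x => (g j).[m%:R * x - j%:R])%R) by exact: integrable_poly_cell.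
pose e x := (f x - (g j).[m%:R * x - j%:R])%R.
have eci : mu.-integrable (cell m%:R^-1 j) (EFin \o e).
  by have := integrableB mC fci gci; apply: eq_integrable.
have eE x : cell m%:R^-1 j x -> (f x - G x = e x)%R.
  by move=> jx; rewrite /G (piecewiseE _ _ _ _ m0 jm jx).
pose I := (\int[mu]_(x in cell m%:R^-1 j) `|e x|)%R.
have I0 : (0 <= I)%R by apply: Rintegral_ge0 => x _.
have sm : (Num.sqrt m%:R * Num.sqrt m%:R = m%:R :> R)%R.
  by rewrite -expr2 sqr_sqrtr // ltW.
have s0 : (0 <= Num.sqrt m%:R :> R)%R by exact: sqrtr_ge0.
have psi_le i x : cell m%:R^-1 j x ->
    (`|Num.sqrt m%:R * (Q i).[m%:R * x - j%:R]| <= Num.sqrt m%:R * B)%R.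
  move=> /(cellP _ _ _ m0)/andP[y0 y1]; rewrite normrM ger0_norm //.
  by rewrite ler_wpM2l // QB // (ltW y0).
have mpsi i : measurable_fun (cell m%:R^-1 j)
    (fun x : R => Num.sqrt m%:R * (Q i).[m%:R * x - j%:R])%R.
  apply: measurable_funM => //; apply: measurable_funTS.
  apply: (measurableT_comp (measurable_horner _)).
  by apply: measurable_funB => //; exact: measurable_funM.
have local x : cell m%:R^-1 j x ->
    (`|projection f m x - G x| <= b * m%:R * I)%R.
  move=> jx; rewrite (projection_cell _ _ _ _ m0 jm jx).
  rewrite /G (piecewiseE _ _ _ _ m0 jm jx) -(basis_reproduces _ m j _ (sg j) m0).
  rewrite -sumrB; apply: (le_trans (ler_norm_sum _ _ _)).
  have -> : (b * m%:R * I = \sum_(i < r.+1) (m%:R * B ^+ 2 * I))%R.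
    rewrite sumr_const card_ord -[RHS]mulr_natl /b.
    have E (k u v t : R) : (k * u ^+ 2 * v * t = k * (v * u ^+ 2 * t))%R by ring.
    exact: E.
  apply: ler_sum => i _; rewrite -mulrBl normrM basis_coefE // -RintegralB //.
  - have -> : (m%:R * B ^+ 2 * I = (Num.sqrt m%:R * B * I) * (Num.sqrt m%:R * B))%R.
      have E (k u t : R) : (k * k * u ^+ 2 * t = (k * u * t) * (k * u))%R by ring.
      by rewrite -[X in (X * _ * _)%R]sm E.
    apply: ler_pM => //; last exact: psi_le.
    have ei := integrable_bounded_mul _ _ _ _ mC (mpsi i) (psi_le i) eci.
    have -> : (\int[mu]_(x in cell m%:R^-1 j)
        (Num.sqrt m%:R * (Q i).[m%:R * x - j%:R] * f x -
         Num.sqrt m%:R * (Q i).[m%:R * x - j%:R] * (g j).[m%:R * x - j%:R]) =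
        \int[mu]_(x in cell m%:R^-1 j)
          (Num.sqrt m%:R * (Q i).[m%:R * x - j%:R] * e x))%R.
      by apply: eq_Rintegral => y _; rewrite /e mulrBr.
    have nei : mu.-integrable (cell m%:R^-1 j) (EFin \o (fun x => `|e x|)%R).
      exact: (integrable_norm eci).
    apply: le_trans (le_normr_Rintegral _ ei) _; first exact: measurable_cell.
    rewrite -RintegralZl //.
    apply: le_Rintegral => //.
    - exact: (integrable_norm ei).
    - by have := integrableZl mC (Num.sqrt m%:R * B)%R nei; apply: eq_integrable.
    - by move=> y jy; rewrite normrM ler_wpM2r // psi_le.
  - exact: integrable_bounded_mul (psi_le i) fci.
  - exact: integrable_bounded_mul (psi_le i) gci.
have IE : \int[mu]_(x in cell m%:R^-1 j) (`|e x|)%:E = I%:E.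
  by rewrite /I /Rintegral fineK //; apply: integrable_fin_num => //;
    exact: (integrable_norm eci).
have me : measurable_fun (cell m%:R^-1 j) (fun x => `|e x|%R).
  apply: (measurableT_comp (@normr_measurable R setT)).
  by apply/measurable_EFinP; exact: measurable_int eci.
have J := integral_powR_jensen mu _ (fun x => `|e x|%R) I m%:R^-1 p mC me
  (fun x _ => normr_ge0 _) (lebesgue_cell _ j h0) h0 p1 IE.
have bmI0 : (0 <= b * m%:R * I)%R by rewrite !mulr_ge0 // ltW.
pose Ep := \int[mu]_(x in cell m%:R^-1 j) (`|e x| `^ p)%:E.
have Ep0 : 0 <= Ep by apply: integral_ge0 => x _; rewrite lee_fin powR_ge0.
have mep : measurable_fun (cell m%:R^-1 j) (fun x => (`|e x| `^ p)%:E).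
  apply: measurable_powR_norm.
  by apply/measurable_EFinP; exact: measurable_int eci.
rewrite [X in _ * X](_ : _ = Ep); last first.
  by apply: eq_integral => x /set_mem jx; rewrite (eE x jx).
apply: (@le_trans _ _ (\int[mu]_(x in cell m%:R^-1 j)
    (4%:E * (((b * m%:R * I) `^ p)%:E + (`|e x| `^ p)%:E)))).
  apply: ge0_le_integral_nonmeasurable => x jx; first by rewrite lee_fin powR_ge0.
  rewrite -EFinD -EFinM lee_fin.
  apply: (@le_trans _ _ ((b * m%:R * I + `|e x|) `^ p)%R); last exact: powRD_le.
  rewrite ge0_ler_powR ?nnegrE ?addr_ge0 //.
  rewrite (_ : projection f m x - f x =
    (projection f m x - G x) - (f x - G x))%R; last by ring.
  by rewrite (le_trans (ler_normB _ _)) // lerD ?(eE x jx) // local.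
rewrite ge0_integralZl //; last 2 first.
- by apply: emeasurable_funD => //; exact: measurable_cst.
- by move=> x _; rewrite adde_ge0 // lee_fin powR_ge0.
rewrite ge0_integralD //; last by move=> x _; rewrite lee_fin powR_ge0.
rewrite EFinM -muleA lee_pmul2l // EFinD ge0_muleDl ?lee_fin ?powR_ge0 // mul1e.
apply: leeD => //.
rewrite [X in X <= _](_ : _ = ((b * m%:R * I) `^ p)%:E * m%:R^-1%:E); last first.
  have := integral_cst mu mC ((b * m%:R * I) `^ p)%:E.
  by move=> ->; congr (_ * _); exact: lebesgue_cell.
have -> : ((b * m%:R * I) `^ p)%:E * m%:R^-1%:E =
    (b `^ p * (m%:R `^ p * m%:R^-1))%:E * (I `^ p)%:E.
  rewrite -!EFinM powRM ?mulr_ge0 ?(ltW mr0) // powRM ?(ltW mr0) //.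
  by congr EFin; ring.
have C0 : (0 <= b `^ p * (m%:R `^ p * m%:R^-1))%R.
  by rewrite !mulr_ge0 ?powR_ge0 // ltW.
apply: (le_trans (lee_wpmul2l (C0 : 0 <= (_)%:E) J)).
rewrite muleA -EFinM le_eqVlt; apply/orP; left; apply/eqP; congr (_%:E * _).
have E1 : (m%:R `^ (p - 1) * m%:R^-1 `^ (p - 1) = 1 :> R)%R.
  by rewrite -powRM ?invr_ge0 ?(ltW mr0) // mulfV ?gt_eqF // powR1.
have E (u v t x y : R) : (u * ((v * t) * x) * y = u * ((v * x) * (t * y)))%R by ring.
rewrite -(@mulr_powRB1 _ m%:R p) ?(ltW mr0) ?(lt_le_trans _ p1) //.
by rewrite E E1 mulfV ?gt_eqF // !mulr1.
Qed.

End Projection.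

(** * Variance of the empirical coefficients *)

Section StepApproximation.
Context {R : realType}.
Implicit Types (q : {poly R}) (x y : R) (m N j a b n k l : nat).

Lemma poly_lipschitz01 q : exists2 L : R, 0 <= L & forall x y,
  0 <= x <= 1 -> 0 <= y <= 1 -> `|q.[x] - q.[y]| <= L * `|x - y|.
Proof.
have [L L0 LP] := poly_bounded01 q^`(); exists L => // x y.
wlog xy : x y / x <= y.
  move=> H x01 y01; have [/H|/ltW/H] := leP x y; first exact.
  by rewrite distrC (distrC x); exact.
move=> /andP[x0 _] /andP[_ y1].
have dq z : z \in `]x, y[ -> is_derive z 1 (horner q) (q^`()).[z].
  move=> _; rewrite derivE derive1E; apply: DeriveDef; last by [].
  by have := @derivable_horner R q z.
have [|z] := @MVT_segment R (horner q) (horner q^`()) x y xy dq.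
  by apply: continuous_subspaceT; exact: continuous_horner.
rewrite in_itv /= => /andP[xz zy] E.
rewrite distrC E normrM (distrC x) ler_wpM2r // LP //.
by rewrite (le_trans x0) // (le_trans zy).
Qed.

Definition step_value m N q a : R := Num.sqrt m%:R * q.[a.+1%:R / N%:R].

(** A step approximation of [phi], built on the cells of a grid that is [N] times
finer, so that covariances reduce to probabilities of cells. *)
Definition step_phi m N q j x : R :=
  \sum_(a < N) step_value m N q a * \1_(cell (m * N)%:R^-1 (j * N + a)) x.

Lemma cell_unique h a b x : 0 < h -> cell h a x -> cell h b x -> a = b.
Proof.
move=> h0; rewrite /cell /= !in_itv /= => /andP[a1 a2] /andP[b1 b2].
have := lt_le_trans a1 b2; have := lt_le_trans b1 a2.
by rewrite !ltr_pM2r // !ltr_nat; lia.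
Qed.

Lemma subcell m N j a x : (0 < m)%N -> (0 < N)%N -> (a < N)%N ->
  cell (m * N)%:R^-1 (j * N + a) x -> cell m%:R^-1 j x.
Proof.
move=> m0 N0 aN; have mN0 : (0 < m * N)%N by rewrite muln_gt0 m0.
have Nr : 0 < N%:R :> R by rewrite ltr0n.
move=> /(cellP _ _ _ mN0)/andP[h1 h2]; apply/cellP => //.
rewrite !natrD !natrM in h1 h2.
have aN1 : a%:R + 1 <= N%:R :> R by rewrite natr1 ler_nat.
have a0 : 0 <= a%:R :> R by [].
have E : m%:R * N%:R * x - (j%:R * N%:R + a%:R) = N%:R * (m%:R * x - j%:R) - a%:R.
  by ring.
rewrite E in h1 h2; apply/andP; split.
  by rewrite -(pmulr_rgt0 _ Nr); lra.
by rewrite -(ler_pM2l Nr) mulr1; lra.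
Qed.

Lemma step_phi_approx m N q j (L : R) x : (0 < m)%N -> (0 < N)%N -> 0 <= L ->
  (forall x y, 0 <= x <= 1 -> 0 <= y <= 1 -> `|q.[x] - q.[y]| <= L * `|x - y|) ->
  `|phi m q j x - step_phi m N q j x| <= Num.sqrt m%:R * (L / N%:R).
Proof.
move=> m0 N0 L0 LP.
have mN0 : (0 < m * N)%N by rewrite muln_gt0 m0.
have h0 : 0 < (m * N)%:R^-1 :> R by rewrite invr_gt0 ltr0n.
have Nr : 0 < N%:R :> R by rewrite ltr0n.
have s0 : 0 <= Num.sqrt m%:R :> R by exact: sqrtr_ge0.
have [jx|jx] := pselect (cell m%:R^-1 j x); last first.
  rewrite phi_eq0 // /step_phi big1 ?subrr ?normr0.
    by rewrite mulr_ge0 // divr_ge0.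
  move=> a _; rewrite indicE memNset ?mulr0 // => ax.
  exact: jx (subcell _ _ _ _ _ m0 N0 (ltn_ord a) ax).
have /andP[y0 y1] := proj1 (cellP _ _ _ m0) jx.
set y := m%:R * x - j%:R in y0 y1 *.
have [a aN ay] : exists2 a, (a < N)%N & cell N%:R^-1 a y.
  by apply: cell_exists; rewrite ?invr_gt0 // mulfV ?gt_eqF // y0.
have /andP[a1 a2] := proj1 (cellP _ _ _ N0) ay.
have ax : cell (m * N)%:R^-1 (j * N + a) x.
  apply/cellP => //; rewrite natrD !natrM.
  rewrite (_ : _ - _ = N%:R * y - a%:R); last by rewrite /y; ring.
  by rewrite a1.
rewrite phi_cell // /step_phi (bigD1 (Ordinal aN)) //= big1 ?addr0 => [|b ba].
  rewrite indicE mem_set // mulr1 /step_value -mulrBr normrM ger0_norm //.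
  rewrite ler_wpM2l // (le_trans (LP _ _ _ _)) //.
  - by rewrite (ltW y0).
  - by rewrite divr_ge0 //= ler_pdivrMr // mul1r ler_nat.
  rewrite ler_wpM2l // distrC -(ler_pM2l Nr) mulfV ?gt_eqF //.
  rewrite -[X in X * _]gtr0_norm // -normrM mulrBr mulrCA mulfV ?gt_eqF // mulr1.
  rewrite -natr1 ler_norml -/y.
  by apply/andP; split; lra.
rewrite indicE memNset ?mulr0 // => bx.
have := cell_unique _ _ _ _ h0 ax bx => /eqP; rewrite eqn_add2l => /eqP ab.
by move: ba; rewrite -val_eqE /= -ab eqxx.
Qed.

(** Abel summation: a sum of increments of [d] weighted by [v] is controlled by
the variation of [v]. *)
Lemma abel_bound N (v d : nat -> R) (s : R) : 0 <= s ->
  (forall b, (b <= N.+1)%N -> `|d b| <= s) ->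
  `|\sum_(b < N.+1) v b * (d b.+1 - d b)| <=
  (`|v 0%N| + `|v N| + \sum_(b < N) `|v b.+1 - v b|) * s.
Proof.
move=> s0 ds.
have -> : \sum_(b < N.+1) v b * (d b.+1 - d b) =
    v N * d N.+1 - v 0%N * d 0%N - \sum_(b < N) (v b.+1 - v b) * d b.+1.
  elim: (N) => [|n IH]; first by rewrite big_ord_recr !big_ord0 /=; ring.
  by rewrite big_ord_recr /= IH [X in _ = _ - X]big_ord_recr /=; ring.
rewrite !mulrDl mulr_suml (le_trans (ler_normB _ _)) // lerD //.
  rewrite (le_trans (ler_normB _ _)) // addrC !normrM lerD //.
    by rewrite ler_wpM2l // ds.
  by rewrite ler_wpM2l // ds.
apply: (le_trans (ler_norm_sum _ _ _)); apply: ler_sum => b _.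
by rewrite normrM ler_wpM2l // ds // ltnS ltnW // ltn_ord.
Qed.

(** A given distance to [k] is attained by at most two indices. *)
Lemma sum_dist_le (g : nat -> R) n k : (forall u, 0 <= g u) -> (k < n)%N ->
  \sum_(l < n) g (maxn k l - minn k l)%N <= 2 * \sum_(u < n) g u.
Proof.
move=> g0 kn.
have E (l : 'I_n) : g (maxn k l - minn k l)%N =
    \sum_(u < n) (if (u : nat) == (maxn k l - minn k l)%N then g u else 0).
  have un : (maxn k l - minn k l < n)%N by have := ltn_ord l; lia.
  rewrite -big_mkcond /= (big_pred1 (Ordinal un)) //.
rewrite (eq_bigr _ (fun (l : 'I_n) _ => E l)) exchange_big mulr_sumr /=.
apply: ler_sum => u _.
have le1 (c : nat) : \sum_(l < n) (if (l : nat) == c then g u else 0) <= g u.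
  have [cn|nc] := ltnP c n.
    by rewrite -big_mkcond /= (big_pred1 (Ordinal cn)).
  rewrite big1 // => l _; case: eqP => // lc.
  by have := ltn_ord l; lia.
apply: (@le_trans _ _ (\sum_(l < n) ((if (l : nat) == (k + u)%N then g u else 0) +
    (if (l : nat) == (k - u)%N then g u else 0)))).
  apply: ler_sum => l _; case: eqP => h.
    have /orP[/eqP e|/eqP e] : ((l : nat) == (k + u)%N) || ((l : nat) == (k - u)%N).
      by lia.
    - have -> : ((l : nat) == (k + u)%N) = true by apply/eqP.
      by rewrite lerDl; case: ifP.
    - have -> : ((l : nat) == (k - u)%N) = true by apply/eqP.
      by rewrite lerDr; case: ifP.
  by rewrite addr_ge0 //; case: ifP.
by rewrite big_split /= mulr2n mulrDl mul1r lerD.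
Qed.

End StepApproximation.

Section BoundedVariables.
Context {d : measure_display} {T : measurableType d} {R : realType}.
Variable P : probability T R.
Implicit Types (A B : set T) (g : T -> R).

Definition prob A : R := fine (P A).

Lemma probE A : measurable A -> P A = (prob A)%:E.
Proof. by move=> mA; rewrite /prob fineK // fin_num_measure. Qed.

Lemma bounded_integrable g (c : R) : measurable_fun setT g ->
  (forall w, `|g w| <= c) -> P.-integrable setT (EFin \o g).
Proof.
move=> mg gc; apply: measurable_bounded_integrable => //.
  by apply: (le_lt_trans (probability_le1 P measurableT)); rewrite ltry.
by exists c; split; [exact: num_real|move=> x xc w _ /=; rewrite (le_trans (gc w)) // ltW].
Qed.

Lemma covariance_indic A B : measurable A -> measurable B ->
  \int[P]_w ((\1_A w - prob A) * (\1_B w - prob B)) =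
  prob (A `&` B) - prob A * prob B.
Proof.
move=> mA mB.
have iI C : measurable C -> P.-integrable setT (EFin \o (\1_C : T -> R)).
  move=> mC; apply: (@bounded_integrable _ 1); first exact: measurable_indic.
  by move=> w; rewrite indicE; case: (_ \in _); rewrite ?normr1 ?normr0.
have EI C : measurable C -> \int[P]_w (\1_C w : R) = prob C.
  by move=> mC; rewrite /Rintegral integral_indic // setIT.
have ic (c : R) : P.-integrable setT (EFin \o (fun=> c)).
  exact: (@bounded_integrable _ `|c|).
have iZ C (c : R) : measurable C ->
    P.-integrable setT (EFin \o (fun w => c * \1_C w)).
  by move=> mC; have := integrableZl measurableT c (iI C mC); apply: eq_integrable.
have iB : P.-integrable setT (EFin \o (fun w => prob B * \1_A w + prob A * \1_B w)).
  by have := integrableD measurableT (iZ A (prob B) mA) (iZ B (prob A) mB);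
    apply: eq_integrable.
have mAB : measurable (A `&` B) by exact: measurableI.
have iC : P.-integrable setT (EFin \o (fun w => \1_(A `&` B) w + prob A * prob B)).
  by have := integrableD measurableT (iI _ mAB) (ic (prob A * prob B));
    apply: eq_integrable.
have -> : \int[P]_w ((\1_A w - prob A) * (\1_B w - prob B)) =
    \int[P]_w ((\1_(A `&` B) w + prob A * prob B) -
               (prob B * \1_A w + prob A * \1_B w)).
  apply: eq_Rintegral => w _; rewrite indicI /=; ring.
have iA1 := iZ A (prob B) mA; have iB1 := iZ B (prob A) mB.
have iAB := iI _ mAB; have iAA := iI _ mA; have iBB := iI _ mB.
have icc := ic (prob A * prob B).
rewrite RintegralB // (RintegralD measurableT iAB icc).
rewrite (RintegralD measurableT iA1 iB1) !RintegralZl // !EI // Rintegral_cst //.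
rewrite [X in fine X](_ : _ = 1%E); last exact: probability_setT.
by rewrite /= mulr1; ring.
Qed.

End BoundedVariables.

Section Dependence.
Context {d : measure_display} {T : measurableType d} {R : realType}.
Variables (P : probability T R) (Y : int -> {RV P >-> R}).
Implicit Types (A B : set R) (k l u : nat) (h : R).

Lemma measurable_preimage (i : int) A : measurable A -> measurable (Y i @^-1` A).
Proof.
by move=> mA; rewrite -[_ @^-1` _]setTI; exact: (measurable_funP (Y i)).
Qed.

Hypothesis hY : strictly_stationary Y.

Lemma stationary_pair k l A B : measurable A -> measurable B ->
  P (Y k%:Z @^-1` A `&` Y (k + l)%N%:Z @^-1` B) =
  P (Y 0 @^-1` A `&` Y l%:Z @^-1` B).
Proof.
move=> mA mB.
pose C : set (2.-tuple R) := [set x | A (tnth x ord0) /\ B (tnth x ord_max)].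
have mC : measurable C.
  have -> : C = ((fun x : 2.-tuple R => tnth x ord0) @^-1` A) `&`
                ((fun x : 2.-tuple R => tnth x ord_max) @^-1` B) by [].
  apply: measurableI; rewrite -[X in measurable X]setTI.
  - exact: measurable_tnth.
  - exact: measurable_tnth.
have := hY 2%N [tuple of [:: 0; l%:Z]] k%:Z C mC.
set X1 := (X in P X = _ -> _); set X2 := (X in _ = P X -> _).
have -> : X1 = Y k%:Z @^-1` A `&` Y (k + l)%N%:Z @^-1` B.
  rewrite /X1 /C; apply/seteqP; split => w /=.
    by rewrite !tnth_mktuple /= !(tnth_nth 0) /= add0r addrC -PoszD.
  by rewrite !tnth_mktuple /= !(tnth_nth 0) /= add0r addrC -PoszD.
have -> : X2 = Y 0 @^-1` A `&` Y l%:Z @^-1` B.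
  rewrite /X2 /C; apply/seteqP; split => w /=.
    by rewrite !tnth_mktuple /= !(tnth_nth 0) /=.
  by rewrite !tnth_mktuple /= !(tnth_nth 0) /=.
by [].
Qed.

Lemma stationary_single k A : measurable A ->
  P (Y k%:Z @^-1` A) = P (Y 0 @^-1` A).
Proof.
move=> mA; have := stationary_pair k 0%N A setT mA measurableT.
by rewrite !preimage_setT !setIT.
Qed.

Variable kappa : nat -> R.-pker (g_sigma_algebraType (past Y 0)) ~> R.
Hypothesis hkappa : forall k : nat, cond_distribution (Y k%:Z) (kappa k).

Definition half_line h (b : nat) : set R := `]-oo, (b%:R * h)%R]%classic.

(** The deviation of the conditional distribution function of [Y_u] from the marginal
one, at the points [b * h] with [b <= M] only, which makes it a measurable
minorant of [dep_b]. *)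
Definition grid_dep (M : nat) h u (w : T) : R :=
  \big[Num.max/0]_(b < M.+1)
    `|fine (kappa u w (half_line h b)) - prob P (Y 0 @^-1` half_line h b)|.

Lemma measurable_past_fun (g : T -> R) :
  @measurable_fun _ _ (g_sigma_algebraType (past Y 0)) R setT g ->
  measurable_fun [set: T] g.
Proof.
move=> mg _ B mB; have := mg measurableT B mB; rewrite !setTI.
have : <<s past Y 0 >> `<=` @measurable _ T.
  apply: smallest_sub; first exact: sigma_algebra_measurable.
  by move=> _ [i _ [C mC ->]]; exact: measurable_preimage.
exact.
Qed.

Lemma measurable_kappa u B : measurable B ->
  measurable_fun [set: T] (fun w => fine (kappa u w B)).
Proof.
move=> mB; apply: measurable_past_fun.
exact: (measurableT_comp (fine_measurable measurableT) (measurable_kernel (kappa u) B mB)).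
Qed.

Lemma kappa_le1 u w B : measurable B -> (kappa u w B <= 1)%E.
Proof.
by move=> mB; rewrite -(prob_kernel (s := kappa u) w) le_measure ?inE.
Qed.

Lemma kappa_bound u w B : measurable B -> 0 <= fine (kappa u w B) <= 1.
Proof.
move=> mB; have k1 := kappa_le1 u w B mB.
rewrite fine_ge0 //= -lee_fin fineK // ge0_fin_numE //.
exact: le_lt_trans k1 (ltry 1).
Qed.

Lemma prob_bound (X : set T) : measurable X -> 0 <= prob P X <= 1.
Proof.
move=> mX; rewrite /prob fine_ge0 //= -lee_fin -probE //.
exact: probability_le1.
Qed.

Lemma measurable_half_line h b : measurable (half_line h b).
Proof. exact: measurable_itv. Qed.

Lemma measurable_grid_dep M h u : measurable_fun [set: T] (grid_dep M h u).
Proof.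
rewrite /grid_dep; elim: (index_enum _) => [|b s IH].
  under eq_fun do rewrite big_nil.
  exact: measurable_cst.
under eq_fun do rewrite big_cons.
apply: measurable_maxr; last exact: IH.
apply: (measurableT_comp (@normr_measurable R setT)).
apply: measurable_funB => //; exact: measurable_kappa (measurable_half_line _ _).
Qed.

Lemma grid_dep_ge0 M h u w : 0 <= grid_dep M h u w.
Proof. by rewrite /grid_dep; elim/big_ind: _ => // x y x0 y0; rewrite le_max x0. Qed.

Lemma grid_dep_le1 M h u w : grid_dep M h u w <= 1.
Proof.
apply: bigmax_le => // b _.
have /andP[k0 k1] := kappa_bound u w _ (measurable_half_line h b).
have /andP[q0 q1] := prob_bound _ (measurable_preimage 0 _ (measurable_half_line h b)).
by rewrite ler_norml; apply/andP; split; lra.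
Qed.

Lemma grid_dep_ge M h u w b : (b <= M)%N ->
  `|fine (kappa u w (half_line h b)) - prob P (Y 0 @^-1` half_line h b)| <=
  grid_dep M h u w.
Proof.
by move=> bM; rewrite /grid_dep (bigD1 (Ordinal (bM : (b < M.+1)%N))) //= le_max lexx.
Qed.

Lemma grid_dep_le M h u w : ((grid_dep M h u w)%:E <= dep_b (kappa u) w)%E.
Proof.
have D0 (b : nat) : ((`|fine (kappa u w (half_line h b)) -
    prob P (Y 0 @^-1` half_line h b)|)%:E <= dep_b (kappa u) w)%E.
  apply: ereal_sup_ubound; exists (b%:R * h) => //.
  have mh := measurable_half_line h b.
  rewrite -/(half_line h b) /distribution /pushforward.
  rewrite (probE P _ (measurable_preimage 0 _ mh)).
  rewrite -[X in `|X - _|%E]fineK //.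
  have /andP[k0 k1] := kappa_bound u w _ mh.
  by rewrite ge0_fin_numE //; apply: le_lt_trans (ltry 1); exact: kappa_le1.
rewrite /grid_dep; elim/big_ind: _ => //.
- by apply: le_trans (D0 0%N); rewrite lee_fin.
- by move=> x y x0 y0; rewrite /Num.max; case: ifP.
Qed.

Lemma integral_grid_dep_le M h u :
  (\int[P]_w (grid_dep M h u w)%:E <= beta1 kappa u)%E.
Proof.
apply: ge0_le_integral_nonmeasurable => w _; last exact: grid_dep_le.
by rewrite lee_fin grid_dep_ge0.
Qed.

(** Conditioning on the past, which contains the event that [Y_0] lies in [A],
brings in the conditional distribution function of [Y_u]. *)
Lemma covariance_half_line M h u b A : measurable A -> (b <= M)%N ->
  `|prob P (Y 0 @^-1` A `&` Y u%:Z @^-1` half_line h b) -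
    prob P (Y 0 @^-1` A) * prob P (Y 0 @^-1` half_line h b)| <=
  \int[P]_(w in Y 0 @^-1` A) grid_dep M h u w.
Proof.
move=> mA bM; have mh := measurable_half_line h b.
have mYA := measurable_preimage 0 A mA.
set c := prob P (Y 0 @^-1` half_line h b).
pose g (w : T) := fine (kappa u w (half_line h b)).
have mg : measurable_fun setT g by exact: (measurable_kappa u _ mh).
have gi : P.-integrable setT (EFin \o g).
  apply: (bounded_integrable P _ 1) => // w.
  by have /andP[g0 g1] := kappa_bound u w _ mh; rewrite ger0_norm.
have ci : P.-integrable setT (EFin \o (fun=> c)).
  exact: (bounded_integrable P _ `|c|).
have di : P.-integrable setT (EFin \o grid_dep M h u).
  apply: (bounded_integrable P _ 1); first exact: measurable_grid_dep.
  by move=> w; rewrite ger0_norm ?grid_dep_ge0 // grid_dep_le1.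
have gAi := integrableS measurableT mYA (@subsetT _ _) gi.
have cAi := integrableS measurableT mYA (@subsetT _ _) ci.
have dAi := integrableS measurableT mYA (@subsetT _ _) di.
have -> : prob P (Y 0 @^-1` A `&` Y u%:Z @^-1` half_line h b) =
    \int[P]_(w in Y 0 @^-1` A) g w.
  rewrite /prob (hkappa u (Y 0 @^-1` A)) //; last first.
    by apply: sub_sigma_algebra; exists 0 => //; exists A.
  rewrite /Rintegral; congr fine; apply: eq_integral => w _.
  rewrite /g fineK // ge0_fin_numE //; apply: le_lt_trans (ltry 1).
  exact: kappa_le1.
have -> : prob P (Y 0 @^-1` A) * c = \int[P]_(w in Y 0 @^-1` A) c.
  by rewrite Rintegral_cst // mulrC.
rewrite -RintegralB //.
have gci : P.-integrable (Y 0 @^-1` A) (EFin \o (fun w => g w - c)).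
  by have := integrableB mYA gAi cAi; apply: eq_integrable.
apply: le_trans (le_normr_Rintegral _ gci) _ => //.
apply: le_Rintegral => //; first exact: integrable_norm gci.
by move=> w _; exact: grid_dep_ge.
Qed.

End Dependence.

Section Variance.
Context {d : measure_display} {T : measurableType d} {R : realType}.
Variables (P : probability T R) (Y : int -> {RV P >-> R}).
Hypothesis hY : strictly_stationary Y.
Variable f : R -> R.
Hypothesis hf : has_density (Y 0) f.
Variable kappa : nat -> R.-pker (g_sigma_algebraType (past Y 0)) ~> R.
Hypothesis hkappa : forall k : nat, cond_distribution (Y k%:Z) (kappa k).
Variable q : {poly R}.
Implicit Types (A : set R) (m N j a b c k l u n : nat).

Local Notation leb := (@lebesgue_measure R).

Lemma density_integrable : leb.-integrable setT (EFin \o f).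
Proof.
have [mf f0 fE] := hf; apply/integrableP; split; first exact/measurable_EFinP.
apply: (@le_lt_trans _ _ (P setT)); last first.
  by apply: (le_lt_trans (probability_le1 P measurableT)); rewrite ltry.
have := fE setT measurableT.
rewrite /distribution /pushforward preimage_setT => ->.
by apply: ge0_le_integral_nonmeasurable => x _; rewrite ?abse_ge0 //= ger0_norm.
Qed.

Lemma density_prob A : measurable A ->
  prob P (Y 0 @^-1` A) = \int[leb]_(x in A) f x.
Proof. by move=> mA; have [_ _ fE] := hf; rewrite /prob /Rintegral -fE. Qed.

Local Notation grid m N := ((m * N)%:R^-1 : R).
Local Notation event m N k c := (Y (Posz k) @^-1` cell (grid m N) c).

Definition cell_prob m N c : R := prob P (event m N 0%N c).

(** The covariance of the step approximations of a basis function at two times at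
lag [u]. *)
Definition block_cov m N j u : R := \sum_(a < N) \sum_(b < N)
  step_value m N q a * step_value m N q b *
  (prob P (event m N 0%N (j * N + a) `&` event m N u (j * N + b)) -
   cell_prob m N (j * N + a) * cell_prob m N (j * N + b)).

Definition step_mean m N j : R :=
  \sum_(a < N) step_value m N q a * cell_prob m N (j * N + a).

Lemma measurable_event m N k c : measurable (event m N k c).
Proof. exact: measurable_preimage (measurable_cell _ _). Qed.

Lemma half_lineS (h : R) c : 0 < h ->
  half_line h c.+1 = half_line h c `|` cell h c.
Proof.
move=> h0; rewrite /half_line /cell; apply: itv_bndbnd_setU; rewrite bnd_simp //.
by rewrite ler_pM2r // ler_nat.
Qed.

Lemma prob_half_line (X : set T) k (h : R) c : measurable X -> 0 < h ->
  prob P (X `&` Y k%:Z @^-1` half_line h c.+1) -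
  prob P (X `&` Y k%:Z @^-1` half_line h c) =
  prob P (X `&` Y k%:Z @^-1` cell h c).
Proof.
move=> mX h0; apply/eqP; rewrite subr_eq; apply/eqP.
have mh := measurable_preimage P Y k _ (measurable_half_line h c).
have mc := measurable_preimage P Y k _ (measurable_cell h c).
rewrite half_lineS // preimage_setU setIUr /prob.
rewrite measureU; [|exact: measurableI|exact: measurableI|].
  by rewrite fineD ?fin_num_measure //; [rewrite addrC|exact: measurableI|exact: measurableI].
apply/seteqP; split => // w [[_]] /=.
rewrite /half_line /cell /= !in_itv /= => h1 [_ /andP[h2 _]].
by move: h1; rewrite leNgt h2.
Qed.

Lemma sum_blocks (F : nat -> R) m N :
  \sum_(j < m) \sum_(a < N) F (j * N + a)%N = \sum_(c < m * N) F c.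
Proof.
elim: m => [|m IH]; first by rewrite !big_ord0.
rewrite big_ord_recr /= IH mulSnr big_split_ord /=; congr (_ + _).
Qed.

(** The events are disjoint. *)
Lemma sum_event_le (g : T -> R) (h : R) M : 0 < h ->
  measurable_fun setT g -> (forall w, 0 <= g w <= 1) ->
  \sum_(c < M) \int[P]_(w in Y 0 @^-1` cell h c) g w <= \int[P]_w g w.
Proof.
move=> h0 mg g01.
have mA c : measurable (Y 0 @^-1` cell h c).
  exact: measurable_preimage (measurable_cell _ _).
have g0 w : 0 <= g w by have /andP[] := g01 w.
have gi : P.-integrable setT (EFin \o g).
  apply: (bounded_integrable P _ 1) => // w.
  by have /andP[? ?] := g01 w; rewrite ger0_norm.
have gAi (c : 'I_M) : P.-integrable setT
    (EFin \o (fun w => g w * \1_(Y 0 @^-1` cell h c) w)).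
  apply: (bounded_integrable P _ 1).
    by apply: measurable_funM => //; exact: measurable_indic.
  move=> w; have /andP[? ?] := g01 w; rewrite indicE normrM ger0_norm //.
  by case: (_ \in _); rewrite ?normr1 ?mulr1 // normr0 mulr0.
have [si sE] := Rintegral_sum P _ (index_enum 'I_M) _ gAi.
rewrite (eq_bigr (fun c : 'I_M => \int[P]_w (g w * \1_(Y 0 @^-1` cell h c) w)));
    last first.
  move=> c _; rewrite Rintegral_mkcond; apply: eq_Rintegral => w _.
  by rewrite patchE indicE; case: ifPn => _; rewrite ?mulr1 ?mulr0.
rewrite -sE; apply: le_Rintegral => // w _.
have [[c cM cw]|nc] := pselect (exists2 c, (c < M)%N & cell h c (Y 0 w)).
  rewrite (bigD1 (Ordinal cM)) //= indicE mem_set // mulr1 big1 ?addr0 // => b bc.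
  rewrite indicE memNset ?mulr0 // => bw.
  have := cell_unique _ _ _ _ h0 bw cw => /eqP.
  by rewrite -[_ == _]/(b == Ordinal cM) (negbTE bc).
rewrite big1 // => c _; rewrite indicE memNset ?mulr0 // => cw.
by apply: nc; exists c.
Qed.

Variables (B L : R).
Hypothesis B0 : 0 <= B.
Hypothesis qB : forall y, 0 <= y <= 1 -> `|q.[y]| <= B.
Hypothesis L0 : 0 <= L.
Hypothesis qL : forall x y, 0 <= x <= 1 -> 0 <= y <= 1 ->
  `|q.[x] - q.[y]| <= L * `|x - y|.

Lemma step_value_le m N a : (a < N)%N ->
  `|step_value m N q a| <= Num.sqrt m%:R * B.
Proof.
move=> aN; rewrite /step_value normrM ger0_norm ?sqrtr_ge0 // ler_wpM2l ?sqrtr_ge0 //.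
have N0 : 0 < N%:R :> R by rewrite ltr0n; lia.
by rewrite qB // divr_ge0 //= ler_pdivrMr // mul1r ler_nat.
Qed.

Lemma step_value_variation m N :
  `|step_value m N.+1 q 0| + `|step_value m N.+1 q N| +
  \sum_(b < N) `|step_value m N.+1 q b.+1 - step_value m N.+1 q b| <=
  Num.sqrt m%:R * (2 * B + L).
Proof.
have s0 : 0 <= Num.sqrt m%:R :> R by exact: sqrtr_ge0.
have N0 : 0 < N.+1%:R :> R by rewrite ltr0n.
rewrite mulrDr (mulrDl 1 1 B) mul1r mulrDr lerD ?lerD ?step_value_le //.
apply: (@le_trans _ _ (\sum_(b < N) Num.sqrt m%:R * (L / N.+1%:R))).
  apply: ler_sum => b _; rewrite /step_value -mulrBr normrM ger0_norm //.
  have bN : (b.+2 <= N.+1)%N by rewrite ltnS ltn_ord.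
  have y01 c : (c <= N.+1)%N -> 0 <= (c%:R / N.+1%:R : R) <= 1.
    by move=> cN; rewrite divr_ge0 //= ler_pdivrMr // mul1r ler_nat.
  rewrite ler_wpM2l // (le_trans (qL _ _ (y01 _ bN) (y01 _ (ltnW bN)))) //.
  rewrite ler_wpM2l // -mulrBl -natrB // subSnn mul1r ger0_norm //.
rewrite sumr_const card_ord -[leLHS]mulr_natl mulrCA ler_wpM2l //.
rewrite mulrCA ler_piMr // ler_pdivrMr // mul1r ler_nat //.
Qed.

(** Abel summation over the cells that contain [Y_u] brings in events [Y_u <= t], to
which the dependence coefficient applies. The events that [Y_0] is in a given cell
are disjoint, even when [j] varies, so the bounds add up to one coefficient; the
factor [m] is the square of the size of the basis functions. *)
Lemma block_cov_bound m N u : (0 < m)%N ->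
  ((\sum_(j < m) `|block_cov m N.+1 j u|)%:E <=
   (m%:R * (B * (2 * B + L)))%:E * beta1 kappa u)%E.
Proof.
move=> m0; pose M := (m * N.+1)%N; pose h := grid m N.+1.
have h0 : 0 < h by rewrite /h invr_gt0 ltr0n muln_gt0 m0.
have s0 : 0 <= Num.sqrt m%:R :> R by exact: sqrtr_ge0.
have sm : Num.sqrt m%:R * Num.sqrt m%:R = m%:R :> R by rewrite -expr2 sqr_sqrtr.
have BL0 : 0 <= 2 * B + L by rewrite addr_ge0 ?mulr_ge0.
pose g := grid_dep P Y kappa M h u.
have mg : measurable_fun setT g by exact: measurable_grid_dep.
have g01 w : 0 <= g w <= 1 by rewrite /g grid_dep_ge0 grid_dep_le1.
pose S c := \int[P]_(w in event m N.+1 0%N c) g w.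
have S0 c : 0 <= S c by apply: Rintegral_ge0 => w _; have /andP[] := g01 w.
have step j : (j < m)%N -> `|block_cov m N.+1 j u| <=
    m%:R * (B * (2 * B + L)) * \sum_(a < N.+1) S (j * N.+1 + a)%N.
  move=> jm; rewrite /block_cov mulr_sumr.
  apply: (le_trans (ler_norm_sum _ _ _)); apply: ler_sum => a _.
  pose X := event m N.+1 0%N (j * N.+1 + a).
  have mX : measurable X by exact: measurable_event.
  pose D c := prob P (X `&` Y u%:Z @^-1` half_line h c) -
    prob P X * prob P (Y 0 @^-1` half_line h c).
  have DS c : D c.+1 - D c = prob P (X `&` event m N.+1 u c) -
      prob P X * cell_prob m N.+1 c.
    have := prob_half_line setT 0%N h c measurableT h0; rewrite !setTI => E2.
    have E1 := prob_half_line X u h c mX h0.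
    rewrite /D /cell_prob -E1 -E2; ring.
  rewrite (eq_bigr (fun b : 'I_N.+1 => step_value m N.+1 q a *
    (step_value m N.+1 q b * (D (j * N.+1 + b).+1 - D (j * N.+1 + b)%N)))); last first.
    by move=> b _; rewrite DS -mulrA.
  rewrite -mulr_sumr normrM.
  have ab := abel_bound N (step_value m N.+1 q) (fun b => D (j * N.+1 + b)%N)
    (S (j * N.+1 + a)%N) (S0 _) _.
  have {}ab : `|\sum_(b < N.+1) step_value m N.+1 q b *
      (D (j * N.+1 + b).+1 - D (j * N.+1 + b)%N)| <=
      Num.sqrt m%:R * (2 * B + L) * S (j * N.+1 + a)%N.
    rewrite (eq_bigr (fun b : 'I_N.+1 => step_value m N.+1 q b *
      (D (j * N.+1 + b.+1)%N - D (j * N.+1 + b)%N))); last first.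
      by move=> b _; rewrite addnS.
    apply: (le_trans (ab _)) => [b bN|].
      apply: covariance_half_line => //; first exact: measurable_cell.
      by rewrite /M; nia.
    by rewrite ler_wpM2r // step_value_variation.
  apply: (le_trans (ler_pM (normr_ge0 _) (normr_ge0 _)
    (step_value_le m N.+1 a (ltn_ord a)) ab)).
  have E (x b c t : R) : x * b * (x * c * t) = (x * x) * (b * c) * t by ring.
  by rewrite E sm.
apply: (@le_trans _ _ ((m%:R * (B * (2 * B + L)))%:E *
    (\int[P]_w (g w)%:E))%E); last first.
  by rewrite lee_wpmul2l ?lee_fin ?mulr_ge0 // integral_grid_dep_le.
have gi : P.-integrable setT (EFin \o g).
  apply: (bounded_integrable P _ 1) => // w.
  by have /andP[? ?] := g01 w; rewrite ger0_norm.
have -> : (\int[P]_w (g w)%:E)%E = (\int[P]_w g w)%:E.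
  by rewrite /Rintegral fineK //; exact: integrable_fin_num.
rewrite -EFinM lee_fin.
apply: (@le_trans _ _ (\sum_(j < m) m%:R * (B * (2 * B + L)) *
    \sum_(a < N.+1) S (j * N.+1 + a)%N)).
  by apply: ler_sum => j _; exact: step.
rewrite -mulr_sumr ler_wpM2l ?mulr_ge0 // sum_blocks.
exact: sum_event_le.
Qed.

Lemma step_phi_covariance m N j k l : (0 < m)%N -> (0 < N)%N ->
  P.-integrable setT (EFin \o (fun w =>
    (step_phi m N q j (Y k%:Z w) - step_mean m N j) *
    (step_phi m N q j (Y l%:Z w) - step_mean m N j))) /\
  \int[P]_w ((step_phi m N q j (Y k%:Z w) - step_mean m N j) *
             (step_phi m N q j (Y l%:Z w) - step_mean m N j)) =
  block_cov m N j (maxn k l - minn k l).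
Proof.
move=> m0 N0; wlog kl : k l / (k <= l)%N.
  move=> H; have /orP[kl|lk] := leq_total k l; first exact: H.
  have [Hi HE] := H l k lk; rewrite maxnC minnC -HE; split.
    by apply: eq_integrable Hi => // w _ /=; rewrite mulrC.
  by apply: eq_Rintegral => w _; rewrite mulrC.
rewrite (maxn_idPr kl) (minn_idPl kl).
pose E i a := event m N i (j * N + a)%N.
have mE i a : measurable (E i a) by exact: measurable_event.
have EP i a : prob P (E i a) = cell_prob m N (j * N + a).
  by rewrite /prob stationary_single //; exact: measurable_cell.
have ZE i w : step_phi m N q j (Y (Posz i) w) - step_mean m N j =
    \sum_(a < N) step_value m N q a * (\1_(E i a) w - prob P (E i a)).
  rewrite /step_phi /step_mean -sumrB; apply: eq_bigr => a _.
  by rewrite EP -mulrBr !indicE.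
pose F (a b : 'I_N) w := step_value m N q a * step_value m N q b *
  ((\1_(E k a) w - prob P (E k a)) * (\1_(E l b) w - prob P (E l b))).
have ib a i : measurable_fun setT (fun w => \1_(E i a) w - prob P (E i a) : R).
  by apply: measurable_funB => //; exact: measurable_indic.
have ib1 a i w : `|\1_(E i a) w - prob P (E i a)| <= (1 : R).
  have /andP[p0 p1] := prob_bound P _ (mE i a).
  rewrite indicE; set x := prob P _ in p0 p1 *.
  by case: (_ \in _); rewrite /= ?mulr1n ?mulr0n ler_norml; apply/andP; split; lra.
have Gi a b : P.-integrable setT (EFin \o (fun w =>
    (\1_(E k a) w - prob P (E k a)) * (\1_(E l b) w - prob P (E l b)) : R)).
  apply: (bounded_integrable P _ 1).
    by apply: measurable_funM; exact: ib.
  by move=> w; rewrite normrM -[leRHS]mulr1 ler_pM.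
have Fi (a b : 'I_N) : P.-integrable setT (EFin \o F a b).
  have := integrableZl measurableT (step_value m N q a * step_value m N q b) (Gi a b).
  by apply: eq_integrable.
have Fs (a : 'I_N) := Rintegral_sum P _ (index_enum 'I_N) _ (Fi a).
have [Fsi FsE] := Rintegral_sum P _ (index_enum 'I_N) _ (fun a : 'I_N => (Fs a).1).
have ZZ : (fun w => (step_phi m N q j (Y k%:Z w) - step_mean m N j) *
    (step_phi m N q j (Y l%:Z w) - step_mean m N j)) =
    (fun w => \sum_(a < N) \sum_(b < N) F a b w).
  apply/funext => w; rewrite !ZE big_distrlr /=; apply: eq_bigr => a _.
  by apply: eq_bigr => b _; rewrite /F; ring.
rewrite ZZ; split=> //; rewrite FsE; apply: eq_bigr => a _.
rewrite (Fs a).2; apply: eq_bigr => b _.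
rewrite /F RintegralZl // covariance_indic //; congr (_ * (_ - _)).
  rewrite /prob -[in LHS](subnKC kl) stationary_pair //; exact: measurable_cell.
by rewrite !EP.
Qed.

(** The mean of the step function is its integral against the density [f], which has
integral [1]. *)
Lemma step_mean_approx m N j : (0 < m)%N -> (0 < N)%N ->
  `|step_mean m N j - basis_coef f m q j| <= Num.sqrt m%:R * (L / N%:R).
Proof.
move=> m0 N0; have [mf f0 fE] := hf.
set e := _ * (L / _).
have e0 : 0 <= e by rewrite /e mulr_ge0 ?sqrtr_ge0 // divr_ge0.
have fi := density_integrable.
have If : \int[leb]_x f x = 1.
  rewrite -density_prob // preimage_setT /prob probability_setT //.
have bi (g : R -> R) (c : R) : measurable_fun setT g -> (forall x, `|g x| <= c) ->
    leb.-integrable setT (EFin \o (fun x => g x * f x)).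
  move=> mg gc; have c0 : 0 <= c by apply: le_trans (gc 0); exact: normr_ge0.
  have := integrableZl measurableT c fi; apply: le_integrable => //.
    by apply/measurable_EFinP; exact: measurable_funM.
  move=> x _ /=; rewrite lee_fin !normrM (ger0_norm c0) ler_wpM2r //.
have sb x : `|step_phi m N q j x| <= Num.sqrt m%:R * B * N%:R.
  have -> : Num.sqrt m%:R * B * N%:R = \sum_(a < N) Num.sqrt m%:R * B.
    by rewrite sumr_const card_ord mulr_natr.
  rewrite (le_trans (ler_norm_sum _ _ _)) //; apply: ler_sum => a _.
  rewrite normrM indicE.
  case: (_ \in _); rewrite /= ?normr0 ?normr1 ?mulr0 ?mulr1 ?step_value_le //.
  by rewrite mulr_ge0 ?sqrtr_ge0.
have ms : measurable_fun setT (step_phi m N q j).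
  apply: measurable_sum => a; apply: measurable_funM => //.
  by apply: measurable_indic; exact: measurable_cell.
have mp : measurable_fun setT (phi m q j) by exact: measurable_phi.
have ps x : `|phi m q j x - step_phi m N q j x| <= e.
  exact: step_phi_approx.
have pb x : `|phi m q j x| <= e + Num.sqrt m%:R * B * N%:R.
  rewrite -[phi _ _ _ _](subrK (step_phi m N q j x)).
  by rewrite (le_trans (ler_normD _ _)) // lerD.
have si := bi _ _ ms sb; have pi := bi _ _ mp pb.
have -> : step_mean m N j = \int[leb]_x (step_phi m N q j x * f x).
  have Fi (a : 'I_N) : leb.-integrable setT (EFin \o (fun x =>
      step_value m N q a * (\1_(cell (m * N)%:R^-1 (j * N + a)) x * f x))).
    have := bi (fun x => step_value m N q a * \1_(cell (m * N)%:R^-1 (j * N + a)) x)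
      (Num.sqrt m%:R * B) _ _.
    move=> H; have {}H := H _ _; apply: eq_integrable (H _ _) => //.
    - by move=> x _ /=; rewrite mulrA.
    - by apply: measurable_funM => //; apply: measurable_indic; exact: measurable_cell.
    - move=> x; rewrite normrM indicE.
      case: (_ \in _); rewrite /= ?normr0 ?normr1 ?mulr0 ?mulr1 ?step_value_le //.
      by rewrite mulr_ge0 ?sqrtr_ge0.
  have [_ sE] := Rintegral_sum leb _ (index_enum 'I_N) _ Fi.
  transitivity (\int[leb]_x (\sum_(a < N) step_value m N q a *
      (\1_(cell (m * N)%:R^-1 (j * N + a)) x * f x))); last first.
    apply: eq_Rintegral => x _; rewrite /step_phi mulr_suml.
    by apply: eq_bigr => a _; rewrite mulrA.
  rewrite sE; apply: eq_bigr => a _.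
  have ci : leb.-integrable setT (EFin \o (fun x =>
      \1_(cell (m * N)%:R^-1 (j * N + a)) x * f x)).
    apply: (bi _ 1); first by apply: measurable_indic; exact: measurable_cell.
    by move=> x; rewrite indicE; case: (_ \in _); rewrite ?normr1 ?normr0.
  rewrite RintegralZl // /cell_prob density_prob; last exact: measurable_cell.
  rewrite Rintegral_mkcond; congr (_ * _); apply: eq_Rintegral => x _.
  by rewrite patchE indicE; case: ifPn => _; rewrite ?mul1r ?mul0r.
rewrite /basis_coef -RintegralB //.
apply: (le_trans (le_normr_Rintegral _ _)) => //.
  by have := integrableB measurableT si pi; apply: eq_integrable.
have <- : \int[leb]_x (e * f x) = e by rewrite RintegralZl // If mulr1.
apply: le_Rintegral => //.
- have := integrable_norm (integrableB measurableT si pi).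
  by apply: eq_integrable.
- by have := integrableZl measurableT e fi; apply: eq_integrable.
- move=> x _; rewrite -mulrBl normrM (ger0_norm (f0 x)) ler_wpM2r //.
  by rewrite distrC ps.
Qed.

(** The coefficient differs from the empirical mean of its step approximation
by [e] at most, and so do the expectations; the variance of that mean is an
average of covariances, each lag occurring at most [2 n] times. *)
Lemma coef_variance_le n m N j : (0 < n)%N -> (0 < m)%N -> (0 < N)%N ->
  (\int[P]_w ((Defs.coefX (fun i w => Y i w) n m q j w - basis_coef f m q j) ^+ 2)%:E <=
   (4 / n%:R * \sum_(u < n) `|block_cov m N j u| +
    8 * (Num.sqrt m%:R * (L / N%:R)) ^+ 2)%:E)%E.
Proof.
move=> n0 m0 N0; set e := _ * (L / _).
have nr : 0 < n%:R :> R by rewrite ltr0n.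
have e0 : 0 <= e by rewrite /e mulr_ge0 ?sqrtr_ge0 // divr_ge0.
pose Z k w := step_phi m N q j (Y (Posz k) w) - step_mean m N j.
pose A w := n%:R^-1 * \sum_(k < n) Z k.+1 w.
have XA w : `|Defs.coefX (fun i w => Y i w) n m q j w - basis_coef f m q j - A w| <=
    2 * e.
  have -> : Defs.coefX (fun i w => Y i w) n m q j w - basis_coef f m q j - A w =
      n%:R^-1 * \sum_(k < n) (phi m q j (Y (Posz k.+1) w) -
        step_phi m N q j (Y (Posz k.+1) w)) + (step_mean m N j - basis_coef f m q j).
    rewrite /Defs.coefX /A /Z big_add1 /= big_mkord !sumrB.
    have -> : \sum_(k < n) step_mean m N j = n%:R * step_mean m N j.
      by rewrite sumr_const card_ord mulr_natl.
    by field; rewrite gt_eqF.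
  rewrite (le_trans (ler_normD _ _)) // (mulrDl 1 1 e) mul1r lerD //; last first.
    exact: step_mean_approx.
  rewrite normrM gtr0_norm ?invr_gt0 // mulrC ler_pdivrMr // mulr_natr.
  have -> : e *+ n = \sum_(k < n) e by rewrite sumr_const card_ord.
  rewrite (le_trans (ler_norm_sum _ _ _)) //; apply: ler_sum => k _.
  exact: step_phi_approx.
have Zi k l := (step_phi_covariance m N j k l m0 N0).1.
have ZE k l := (step_phi_covariance m N j k l m0 N0).2.
have Zs (k : 'I_n) := Rintegral_sum P _ (index_enum 'I_n) _
  (fun l : 'I_n => Zi k.+1 l.+1).
have [ZZi ZZE] := Rintegral_sum P _ (index_enum 'I_n) _ (fun k : 'I_n => (Zs k).1).
have AE : (fun w => A w ^+ 2) = (fun w => n%:R^-1 ^+ 2 *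
    \sum_(k < n) \sum_(l < n) (Z k.+1 w * Z l.+1 w)).
  by apply/funext => w; rewrite /A exprMn; congr (_ * _); rewrite expr2 big_distrlr.
have Ai : P.-integrable setT (EFin \o (fun w => A w ^+ 2)).
  rewrite AE; have := integrableZl measurableT (n%:R^-1 ^+ 2) ZZi.
  by apply: eq_integrable.
have AI : \int[P]_w (A w ^+ 2) <= 2 / n%:R * \sum_(u < n) `|block_cov m N j u|.
  rewrite AE RintegralZl // ZZE.
  have -> : 2 / n%:R * \sum_(u < n) `|block_cov m N j u| = n%:R^-1 ^+ 2 *
      \sum_(k < n) (2 * \sum_(u < n) `|block_cov m N j u|).
    rewrite sumr_const card_ord -[_ *+ n]mulr_natl expr2.
    by field; rewrite gt_eqF.
  rewrite ler_wpM2l ?sqr_ge0 //; apply: ler_sum => k _.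
  rewrite (Zs k).2; apply: (@le_trans _ _ (\sum_(l < n)
      `|block_cov m N j (maxn k l - minn k l)|)).
    apply: ler_sum => l _; apply: (le_trans (ler_norm _)).
    by rewrite ZE maxnSS minnSS subSS.
  by have := sum_dist_le (fun u => `|block_cov m N j u|) n k
    (fun=> normr_ge0 _) (ltn_ord k).
have Bi : P.-integrable setT (EFin \o (fun w => 2 * A w ^+ 2)).
  by have := integrableZl measurableT 2 Ai; apply: eq_integrable.
have ci : P.-integrable setT (EFin \o (fun=> 8 * e ^+ 2)).
  exact: (bounded_integrable P _ `|8 * e ^+ 2|).
have Di : P.-integrable setT (EFin \o (fun w => 2 * A w ^+ 2 + 8 * e ^+ 2)).
  by have := integrableD measurableT Bi ci; apply: eq_integrable.
apply: (@le_trans _ _ (\int[P]_w (2 * A w ^+ 2 + 8 * e ^+ 2)%:E)%E).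
  apply: ge0_le_integral_nonmeasurable => w _; rewrite lee_fin ?sqr_ge0 //.
  have := XA w; set X := _ - basis_coef _ _ _ _; rewrite ler_norml => /andP[h1 h2].
  have H1 : 0 <= (2 * e - (X - A w)) * (2 * e + (X - A w)).
    by rewrite mulr_ge0 //; lra.
  have := sqr_ge0 (A w - (X - A w)); nra.
rewrite -[X in (X <= _)%E]fineK; last exact: integrable_fin_num.
rewrite lee_fin -[fine _]/(\int[P]_w (2 * A w ^+ 2 + 8 * e ^+ 2)).
have -> : \int[P]_w (2 * A w ^+ 2 + 8 * e ^+ 2) =
    2 * \int[P]_w (A w ^+ 2) + 8 * e ^+ 2.
  rewrite RintegralD // [X in X + _]RintegralZl // [X in _ + X]Rintegral_cst //.
  have PT : fine (P setT) = 1 by rewrite probability_setT.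
  congr (_ + _); rewrite -[RHS]mulr1; congr (_ * _); exact: PT.
have -> : 4 / n%:R = 2 * (2 / n%:R) :> R by field; rewrite gt_eqF.
by rewrite lerD2r -[leRHS]mulrA ler_pM2l.
Qed.

(** With [n * m] steps in each cell, the discretization error is of the order of the
term [m / n] at most. *)
Lemma variance_bound n m : (0 < n)%N -> (0 < m)%N ->
  (\sum_(j < m) \int[P]_w
     ((Defs.coefX (fun i w => Y i w) n m q j w - basis_coef f m q j) ^+ 2)%:E <=
   ((4 * (B * (2 * B + L)) + 8 * L ^+ 2) * (m%:R / n%:R))%:E *
     (\sum_(0 <= u < n.+1) beta1 kappa u + 1))%E.
Proof.
move=> n0 m0; pose N := (n * m).-1.
have NE : N.+1 = (n * m)%N by rewrite /N prednK // muln_gt0 n0.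
have nr : 0 < n%:R :> R by rewrite ltr0n.
have mr : 1 <= m%:R :> R by rewrite ler1n.
have mr0 : 0 < m%:R :> R by rewrite ltr0n.
have nr1 : 1 <= n%:R :> R by rewrite ler1n.
set K1 := B * _.
have K10 : 0 <= K1 by rewrite /K1 mulr_ge0 ?addr_ge0 ?mulr_ge0.
have b0 u : (0 <= beta1 kappa u)%E.
  by apply: integral_ge0 => w _; apply: le_trans (grid_dep_le P Y kappa 0%N 0 u w);
    rewrite lee_fin grid_dep_ge0.
set e := 8 * (Num.sqrt m%:R * (L / N.+1%:R)) ^+ 2.
have eE : m%:R * e <= 8 * L ^+ 2 * (m%:R / n%:R).
  rewrite /e exprMn sqr_sqrtr // NE natrM.
  have -> : m%:R * (8 * (m%:R * (L / (n%:R * m%:R)) ^+ 2)) =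
      8 * L ^+ 2 * (n%:R^-1 * n%:R^-1).
    by field; rewrite !gt_eqF.
  rewrite ler_wpM2l ?mulr_ge0 ?sqr_ge0 // ler_wpM2r ?invr_ge0 //.
  by rewrite (le_trans _ mr) // invf_le1.
apply: (@le_trans _ _ (\sum_(j < m) (4 / n%:R * \sum_(u < n) `|block_cov m N.+1 j u| + e)%:E)%E).
  by apply: lee_sum => j _; exact: coef_variance_le.
have s0 : (0 <= \sum_(0 <= u < n.+1) beta1 kappa u)%E by apply: sume_ge0.
have k0 : 0 <= 4 * K1 * (m%:R / n%:R) by apply: mulr_ge0; [exact: mulr_ge0|exact: divr_ge0].
have k1 : 0 <= 8 * L ^+ 2 * (m%:R / n%:R) 
  by apply: mulr_ge0; [rewrite mulr_ge0 // sqr_ge0|exact: divr_ge0].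
apply: (@le_trans _ _ ((4 * K1 * (m%:R / n%:R))%:E *
    \sum_(0 <= u < n.+1) beta1 kappa u + (8 * L ^+ 2 * (m%:R / n%:R))%:E)%E); last first.
  have -> : (4 * K1 + 8 * L ^+ 2) * (m%:R / n%:R) =
      4 * K1 * (m%:R / n%:R) + 8 * L ^+ 2 * (m%:R / n%:R) by ring.
  rewrite ge0_muleDr // mule1 leeD //; last by rewrite lee_fin lerDr.
  by rewrite lee_wpmul2r // lee_fin lerDl.
rewrite sumEFin big_split /= sumr_const card_ord -[e *+ m]mulr_natl EFinD leeD //.
rewrite -mulr_sumr exchange_big /= EFinM.
apply: (@le_trans _ _ ((4 / n%:R)%:E * ((m%:R * K1)%:E *
    \sum_(0 <= u < n.+1) beta1 kappa u))%E); last first.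
  by rewrite muleA -EFinM (_ : 4 / _ * _ = 4 * K1 * (m%:R / n%:R)) //; ring.
rewrite lee_wpmul2l ?lee_fin ?divr_ge0 //.
rewrite big_nat_recr //= big_mkord.
apply: (@le_trans _ _ ((m%:R * K1)%:E * \sum_(u < n) beta1 kappa u)%E).
  rewrite ge0_sume_distrr // -sumEFin; apply: lee_sum => u _.
  exact: block_cov_bound.
apply: lee_wpmul2l; last exact: (leeDl _ (b0 n)).
by rewrite lee_fin mulr_ge0 // ltW.
Qed.

End Variance.

(** * Risk of the estimator *)

Section Risk.
Context {d : measure_display} {T : measurableType d} {R : realType}.
Variables (P : probability T R) (Y : int -> {RV P >-> R}).
Variables (r : nat) (Q : 'I_r.+1 -> {poly R}).
Hypothesis hQ : orthonormal_basis01 Q.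
Implicit Types (f : R -> R) (p x e b : R) (m n j : nat).

Local Notation mu := (@lebesgue_measure R).

(** The first term bounds the values at most [e]; for the others,
[`|x| `^ (p - 2) <= e `^ (p - 2)] since [p <= 2]. *)
Lemma powR_le_square p e x : 1 <= p -> p <= 2 -> 0 < e ->
  `|x| `^ p <= e `^ p + e `^ (p - 2) * x ^+ 2.
Proof.
move=> p1 p2 e0; have p0 : 0 < p by rewrite (lt_le_trans _ p1).
have [xe|ex] := leP `|x| e.
  apply: (@le_trans _ _ (e `^ p)).
    by rewrite ge0_ler_powR ?nnegrE ?(ltW p0) // ltW.
  by rewrite lerDl mulr_ge0 ?powR_ge0 ?sqr_ge0.
have x0 : 0 < `|x| by exact: lt_trans e0 ex.
have -> : `|x| `^ p = `|x| `^ (p - 2) * x ^+ 2.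
  rewrite -(real_normK (num_real x)) -powR_mulrn // -powRD ?subrK //.
  by rewrite gt_eqF ?implybT.
apply: (@le_trans _ _ (e `^ (p - 2) * x ^+ 2)); last by rewrite lerDr powR_ge0.
rewrite ler_wpM2r ?sqr_ge0 // -opprB !powRN lef_pV2 ?posrE ?powR_gt0 //.
by rewrite ge0_ler_powR ?nnegrE ?subr_ge0 ?(ltW e0) // ltW.
Qed.

Lemma sqr_sum_le k (u : 'I_k -> R) :
  (\sum_(i < k) u i) ^+ 2 <= k%:R ^+ 2 * \sum_(i < k) u i ^+ 2.
Proof.
have -> : \sum_(i < k) u i ^+ 2 = \sum_(i < k) `|u i| `^ 2%:R.
  by apply: eq_bigr => i _; rewrite powR_mulrn // real_normK ?num_real.
rewrite -[k%:R ^+ 2]powR_mulrn // -(real_normK (num_real (\sum_(i < k) u i))).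
apply: (@le_trans _ _ ((\sum_(i < k) `|u i|) ^+ 2)).
  by rewrite lerXn2r ?nnegrE ?sumr_ge0 //; exact: ler_norm_sum.
rewrite -powR_mulrn ?sumr_ge0 //; apply: powR_sum_le => //.
by rewrite ler1n.
Qed.

(** The functions of a given degree have disjoint supports of length [1 / m], on
which they are [O (sqrt m)]; hence their combinations have a quadratic norm
comparable to that of the coefficients. *)
Lemma combination_norm_le : exists2 K : R, 0 <= K & forall m (a : 'I_r.+1 -> nat -> R),
  (0 < m)%N ->
  (\int[mu]_(x in `]0%R, 1%R])
     ((\sum_(i < r.+1) \sum_(j < m) a i j * phi m (Q i) j x) ^+ 2)%:E <=
   (K * \sum_(i < r.+1) \sum_(j < m) a i j ^+ 2)%:E)%E.
Proof.
have [B B0 QB] := orthonormal_bounded r Q.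
exists (r.+1%:R ^+ 2 * B ^+ 2) => [|m a m0]; first by rewrite mulr_ge0 ?sqr_ge0.
have mr0 : 0 < m%:R :> R by rewrite ltr0n.
have s0 : 0 <= Num.sqrt m%:R :> R by exact: sqrtr_ge0.
have m1 : m%:R * m%:R^-1 = 1 :> R by rewrite mulfV // gt_eqF.
rewrite -[X in Interval _ (BRight X)]m1.
apply: (le_trans (integral_cells_le _ (fun j => \sum_(i < r.+1)
    (r.+1%:R ^+ 2 * (m%:R * B ^+ 2) * a i j ^+ 2)) _ _ _ _ _ _)).
- by rewrite invr_gt0.
- by move=> x _; rewrite lee_fin sqr_ge0.
- apply/measurable_EFinP; apply: measurable_funTS; apply: measurable_funX.
  apply: measurable_sum => i; apply: measurable_sum => j.
  by apply: measurable_funM => //; exact: measurable_phi.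
- move=> j x jm jx; rewrite lee_fin.
  have -> : \sum_(i < r.+1) \sum_(l < m) a i l * phi m (Q i) l x =
      \sum_(i < r.+1) a i j * phi m (Q i) j x.
    apply: eq_bigr => i _; rewrite (bigD1 (Ordinal jm)) //= big1 ?addr0 // => l.
    rewrite -val_eqE /= => lj.
    by rewrite /phi (poly_cell_eq0 _ _ _ _ _ m0 jx lj) !mulr0.
  apply: (le_trans (sqr_sum_le _ _)); rewrite mulr_sumr; apply: ler_sum => i _.
  rewrite -mulrA ler_wpM2l // exprMn mulrC ler_wpM2r ?sqr_ge0 //.
  rewrite phi_cell // exprMn sqr_sqrtr ?(ltW mr0) // ler_wpM2l ?(ltW mr0) //.
  rewrite -(real_normK (num_real _)) lerXn2r ?nnegrE //.
  by move/(cellP _ _ _ m0): jx => /andP[y0 y1]; rewrite QB // (ltW y0).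
rewrite lee_fin exchange_big /= mulr_sumr mulr_sumr; apply: ler_sum => i _.
rewrite -mulr_sumr mulrA ler_wpM2r ?sumr_ge0 // => [j _|]; first exact: sqr_ge0.
by rewrite le_eqVlt; apply/orP; left; apply/eqP; field; rewrite gt_eqF.
Qed.

Lemma measurable_coefX n m (q : {poly R}) j :
  measurable_fun setT (Defs.coefX (fun i w => Y i w) n m q j).
Proof.
apply: measurable_funM => //; apply: measurable_sum => k.
exact: (measurableT_comp (measurable_phi m q j)).
Qed.

(** The risk is split into the bias [b] of the projection and a stochastic term,
measured in quadratic norm at the scale [e]. For each outcome the inner
integral is bounded by a function of the coefficients, which is then integrated. *)
Lemma risk_le p : 1 <= p -> p <= 2 -> exists2 K : R, 0 <= K & forall f n m e b,
  measurable_fun setT f -> (0 < m)%N -> 0 < e -> 0 <= b ->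
  (\int[mu]_(x in `]0%R, 1%R]) (`|projection r Q f m x - f x| `^ p)%:E <= b%:E)%E ->
  (\int[P]_w \int[mu]_(x in `[0%R, 1%R])
     (`|estimator (fun i w => Y i w) Q n m w x - f x| `^ p)%:E <=
   (4 * (e `^ p + b))%:E + (K * e `^ (p - 2))%:E *
     \sum_(i < r.+1) \sum_(j < m) \int[P]_w
       ((Defs.coefX (fun i w => Y i w) n m (Q i) j w - basis_coef f m (Q i) j) ^+ 2)%:E)%E.
Proof.
move=> p1 p2; have [K K0 KP] := combination_norm_le.
have p0 : 0 < p by rewrite (lt_le_trans _ p1).
exists (4 * K) => [|f n m e b mf m0 e0 b0 bP]; first by rewrite mulr_ge0.
pose a w (i : 'I_r.+1) j :=
  Defs.coefX (fun i w => Y i w) n m (Q i) j w - basis_coef f m (Q i) j.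
have ma i j : measurable_fun setT (fun w => (a w i j ^+ 2)%:E).
  apply/measurable_EFinP; apply: measurable_funX; apply: measurable_funB => //.
  exact: measurable_coefX.
pose h w x := \sum_(i < r.+1) \sum_(j < m) a w i j * phi m (Q i) j x.
have mh w : measurable_fun setT (h w).
  apply: measurable_sum => i; apply: measurable_sum => j.
  by apply: measurable_funM => //; exact: measurable_phi.
have mpr := measurable_projection r Q f m.
have estE w x : estimator (fun i w => Y i w) Q n m w x = h w x + projection r Q f m x.
  rewrite /estimator /h /projection -big_split; apply: eq_bigr => i _ /=.
  by rewrite -big_split; apply: eq_bigr => j _ /=; rewrite -mulrDl subrK.
have e2 : 0 <= e `^ (p - 2) by exact: powR_ge0.
have pw w : (\int[mu]_(x in `[0%R, 1%R])
    (`|estimator (fun i w => Y i w) Q n m w x - f x| `^ p)%:E <=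
    (4 * (e `^ p + b) + 4 * K * e `^ (p - 2) *
      \sum_(i < r.+1) \sum_(j < m) a w i j ^+ 2)%:E)%E.
  have mhp : measurable_fun setT (fun x => (`|h w x| `^ p)%:E).
    exact: measurable_powR_norm.
  have mbp : measurable_fun setT (fun x => (`|projection r Q f m x - f x| `^ p)%:E).
    by apply: measurable_powR_norm; exact: measurable_funB.
  have E : (fun x => (`|estimator (fun i w => Y i w) Q n m w x - f x| `^ p)%:E) =
      (fun x => (`|h w x + (projection r Q f m x - f x)| `^ p)%:E).
    by apply/funext => x; rewrite estE addrA.
  rewrite E -integral_itv_obnd_cbnd; last first.
    apply: measurable_funTS; apply: measurable_powR_norm.
    by apply: measurable_funD => //; exact: measurable_funB.
  have mD : measurable (`]0%R, 1%R]%classic : set (measurableTypeR R)) by [].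
  have mhD : measurable_fun (`]0%R, 1%R]%classic : set (measurableTypeR R))
    (fun x => ((h w x) ^+ 2)%:E).
    by apply/measurable_EFinP; apply: measurable_funTS; apply: measurable_funX; exact: mh.
  apply: (@le_trans _ _ (\int[mu]_(x in `]0%R, 1%R])
     ((4 * e `^ p)%:E + ((4 * e `^ (p - 2))%:E * ((h w x) ^+ 2)%:E +
       4%:E * (`|projection r Q f m x - f x| `^ p)%:E)))%E).
    apply: ge0_le_integral_nonmeasurable => x _; first by rewrite lee_fin powR_ge0.
    rewrite -!EFinM -!EFinD lee_fin.
    apply: (@le_trans _ _ ((`|h w x| + `|projection r Q f m x - f x|) `^ p)).
      rewrite ge0_ler_powR ?nnegrE ?addr_ge0 ?(ltW p0) //; exact: ler_normD.
    apply: (le_trans (powRD_le p _ _ p1 p2 (normr_ge0 _) (normr_ge0 _))).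
    have := powR_le_square p e (h w x) p1 p2 e0.
    by lra.
  rewrite ge0_integralD //; last 3 first.
  - by move=> x _; rewrite lee_fin mulr_ge0 ?powR_ge0.
  - by move=> x _; apply: adde_ge0; apply: mule_ge0; rewrite ?lee_fin ?sqr_ge0 ?powR_ge0 // mulr_ge0.
  - apply: emeasurable_funD; apply: measurable_funeM => //.
    exact: measurable_funTS.
  rewrite ge0_integralD //; last 3 first.
  - by move=> x _; apply: mule_ge0; rewrite lee_fin ?sqr_ge0 // mulr_ge0.
  - exact: measurable_funeM.
  - by apply: measurable_funeM; exact: measurable_funTS.
  rewrite ge0_integralZl //; last 2 first.
  - by move=> x _; rewrite lee_fin sqr_ge0.
  - by rewrite lee_fin mulr_ge0.
  rewrite ge0_integralZl //; last exact: measurable_funTS.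
  rewrite integral_cst //= lebesgue_measure_itv /= lte_fin ltr01 oppr0 adde0 mule1.
  have -> : (4 * (e `^ p + b) + 4 * K * e `^ (p - 2) *
      (\sum_(i < r.+1) \sum_(j < m) a w i j ^+ 2))%:E =
    ((4 * e `^ p)%:E + ((4 * e `^ (p - 2))%:E *
      (K * \sum_(i < r.+1) \sum_(j < m) a w i j ^+ 2)%:E + 4%:E * b%:E))%E.
    by rewrite -!EFinM -!EFinD; congr EFin; ring.
  apply: leeD => //; apply: leeD; apply: lee_wpmul2l => //.
    by rewrite lee_fin mulr_ge0.
  exact: KP.
have c0 : 0 <= 4 * K * e `^ (p - 2) by rewrite !mulr_ge0.
apply: (@le_trans _ _ (\int[P]_w ((4 * (e `^ p + b))%:E + (4 * K * e `^ (p - 2))%:E *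
    \sum_(i < r.+1) \sum_(j < m) (a w i j ^+ 2)%:E))%E).
  apply: ge0_le_integral_nonmeasurable => w _.
    by apply: integral_ge0 => x _; rewrite lee_fin powR_ge0.
  apply: (le_trans (pw w)); rewrite EFinD EFinM.
  by under [in leRHS]eq_bigr do rewrite sumEFin; rewrite sumEFin.
rewrite ge0_integralD //; last 3 first.
- by move=> w _; rewrite lee_fin mulr_ge0 ?addr_ge0 ?powR_ge0.
- move=> w _; rewrite mule_ge0 ?lee_fin // sume_ge0 // => i _.
  by rewrite sume_ge0 // => j _; rewrite lee_fin sqr_ge0.
- apply: measurable_funeM; apply: emeasurable_sum => i.
  by apply: emeasurable_sum.
rewrite leeD //.
  rewrite integral_cst // -[leRHS]mule1; apply: lee_wpmul2l.
    by rewrite lee_fin mulr_ge0 // addr_ge0 // powR_ge0.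
  exact: probability_le1.
rewrite ge0_integralZl //; last 2 first.
- by apply: emeasurable_sum => i; apply: emeasurable_sum.
- move=> w _; rewrite sume_ge0 // => i _.
  by rewrite sume_ge0 // => j _; rewrite lee_fin sqr_ge0.
apply: lee_wpmul2l => //; rewrite ge0_integral_sum //; last 2 first.
- by move=> i; apply: emeasurable_sum.
- by move=> i w _; rewrite sume_ge0 // => j _; rewrite lee_fin sqr_ge0.
apply: lee_sum => i _; rewrite ge0_integral_sum // => j w _.
by rewrite lee_fin sqr_ge0.
Qed.

End Risk.

Section Rates.
Context {R : realType}.
Local Notation mu := (@lebesgue_measure R).

(** The two smoothness classes give the same rate for the differences of a primitive,
of order [Num.truncn s + 2 <= r + 2] in the first case and [r + 2] in the second. *)
Lemma projection_bias (r : nat) (Q : 'I_r.+1 -> {poly R}) (p s : R) (f : R -> R) :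
  orthonormal_basis01 Q -> 1 <= p -> p <= 2 -> mu.-integrable setT (EFin \o f) ->
  (0 < s < r.+1%:R /\ lip_star01 s p (f \_ `[0, 1])) \/
  (s = r.+1%:R /\ sobolev01 r.+1 p (f \_ `[0, 1])) ->
  exists2 c : R, 0 <= c & forall m, (0 < m)%N ->
    (\int[mu]_(x in `]0%R, 1%R]) (`|projection r Q f m x - f x| `^ p)%:E <=
     (c * (m%:R `^ (- s)) `^ p)%:E)%E.
Proof.
move=> hQ p1 p2 fi hs.
have [k [kr s0 rate]] : exists k, [/\ (k <= r)%N, 0 < s &
    diff_rate k s p (primitive f)].
  case: hs => [[/andP[s0 sr] fs]|[-> fs]]; last first.
    by exists r; split => //; exact: sobolev_diff_rate.
  exists (Num.truncn s); split => //; last exact: lip_star_diff_rate.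
  by rewrite truncn_le_nat.
have [c c0 cP] := quasi_interp_error k p s f p1 s0 fi rate.
have [c' c'0 c'P] := projection_error r Q hQ p p1 p2.
exists (c' * c `^ p) => [|m m0]; first by rewrite mulr_ge0 ?powR_ge0.
apply: (le_trans (c'P f (quasi_interp k (primitive f) m) m m0 fi _)) => [j|].
  by rewrite (leq_trans (size_quasi_interp _ _ _ _)).
rewrite -mulrA -powRM ?powR_ge0 // EFinM lee_wpmul2l ?lee_fin //.
exact: cP.
Qed.

Lemma truncn_scale (c y : R) : 0 < c -> 2 <= c * y ->
  [/\ (0 < Num.truncn (c * y))%N, (Num.truncn (c * y))%:R <= c * y &
      c / 2 * y <= (Num.truncn (c * y))%:R].
Proof.
move=> c0 cy.
have h : c * y < (Num.truncn (c * y))%:R + 1 by rewrite natr1 truncnS_gt.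
rewrite truncn_gt0; split; [lra|by rewrite truncn_le; lra|lra].
Qed.

Lemma near_powR_ge (a c : R) : 0 < a -> \forall n \near \oo, c <= n%:R `^ a.
Proof.
move=> a0; exists (Num.truncn (`|c| `^ a^-1)).+1 => // n /= hn.
have E : `|c| = (`|c| `^ a^-1) `^ a by rewrite -powRrM mulVf ?powRr1 // gt_eqF.
rewrite (le_trans (ler_norm c)) // E ge0_ler_powR ?nnegrE ?powR_ge0 ?(ltW a0) //.
by apply: (le_trans (ltW (truncnS_gt _))); rewrite ler_nat.
Qed.

Lemma total_variance_bound (d : measure_display) (T : measurableType d)
    (P : probability T R) (Y : int -> {RV P >-> R}) (f : R -> R)
    (kappa : nat -> R.-pker (g_sigma_algebraType (past Y 0)) ~> R)
    (r : nat) (Q : 'I_r.+1 -> {poly R}) :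
  strictly_stationary Y -> has_density (Y 0) f ->
  (forall k : nat, cond_distribution (Y k%:Z) (kappa k)) ->
  exists2 K : R, 0 <= K & forall n m, (0 < n)%N -> (0 < m)%N ->
    (\sum_(i < r.+1) \sum_(j < m) \int[P]_w
       ((Defs.coefX (fun i w => Y i w) n m (Q i) j w - basis_coef f m (Q i) j) ^+ 2)%:E <=
     (K * (m%:R / n%:R))%:E * (\sum_(0 <= u < n.+1) beta1 kappa u + 1))%E.
Proof.
move=> hY hf hk; pose B i := s2val (cid2 (poly_bounded01 (Q i))).
pose L i := s2val (cid2 (poly_lipschitz01 (Q i))).
have B0 i : 0 <= B i := s2valP (cid2 (poly_bounded01 (Q i))).
have L0 i : 0 <= L i := s2valP (cid2 (poly_lipschitz01 (Q i))).
pose K i := 4 * (B i * (2 * B i + L i)) + 8 * L i ^+ 2.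
have K0 i : 0 <= K i by rewrite /K addr_ge0 ?mulr_ge0 ?addr_ge0 ?mulr_ge0 ?sqr_ge0.
exists (\sum_i K i) => [|n m n0 m0]; first exact: sumr_ge0.
rewrite mulr_suml -sumEFin ge0_sume_distrl => [|i _]; last first.
  by rewrite lee_fin mulr_ge0 // divr_ge0.
apply: lee_sum => i _.
exact: (variance_bound P Y hY f hf kappa hk (Q i) (B i) (L i) (B0 i)
  (s2valP' (cid2 (poly_bounded01 (Q i)))) (L0 i)
  (s2valP' (cid2 (poly_lipschitz01 (Q i)))) n m n0 m0).
Qed.

End Rates.

Theorem mainTheorem9 (R : realType) (d : measure_display)
    (T : measurableType d) (P : probability T R)
    (p : R) (hp1 : 1 <= p) (hp2 : p <= 2)
    (Y : int -> {RV P >-> R}) (hY : strictly_stationary Y)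
    (f : R -> R) (hf : has_density (Y 0) f)
    (kappa : nat -> R.-pker (g_sigma_algebraType (past Y 0)) ~> R)
    (hkappa : forall k : nat, cond_distribution (Y k%:Z) (kappa k))
    (delta : R) (hdelta0 : 0 <= delta) (hdelta1 : delta < 1)
    (hbeta : ebigO (fun n => (\sum_(0 <= k < n.+1) beta1 kappa k)%E)
                   (fun n => n%:R `^ delta))
    (r : nat) (Q : 'I_r.+1 -> {poly R}) (hQ : orthonormal_basis01 Q)
    (s : R)
    (hs : (0 < s < r.+1%:R /\ lip_star01 s p (f \_ `[0, 1])) \/
          (s = r.+1%:R /\ sobolev01 r.+1 p (f \_ `[0, 1])))
    (C : R) (hC : 0 < C) (m : nat -> nat)
    (hm : forall n, m n = Num.truncn (C * n%:R `^ ((1 - delta) / (2 * s + 1)))) :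
  ebigO (fun n => (\int[P]_w \int[lebesgue_measure]_(x in `[0%R, 1%R])
           (`|estimator (fun i w => Y i w) Q n (m n) w x - f x| `^ p)%:E)%E)
        (fun n => n%:R `^ (- p * s * (1 - delta) / (2 * s + 1))).
Proof.
have s0 : 0 < s by case: hs => [[/andP[]]|[->]].
have p0 : 0 < p by rewrite (lt_le_trans _ hp1).
have fi := density_integrable P Y f hf.
have [mf _ _] := hf.
have [Kb Kb0 bias] := projection_bias r Q p s f hQ hp1 hp2 fi hs.
have [Kr Kr0 risk] := risk_le P Y r Q p hp1 hp2.
have [Kv Kv0 var] := total_variance_bound d T P Y f kappa r Q hY hf hkappa.
have [M hM] := hbeta.
set a := (1 - delta) / (2 * s + 1) in hm.
have a0 : 0 < a by rewrite /a divr_gt0; lra.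
exists (4 * (1 + Kb * ((C / 2) `^ (- s)) `^ p) + Kr * (Kv * (C * (`|M| + 1)))).
near=> n.
have n0 : (0 < n)%N by near: n; exact: nbhs_infty_gt.
have nr0 : 0 < n%:R :> R by rewrite ltr0n.
have Cn : 2 <= C * n%:R `^ a.
  by rewrite mulrC -ler_pdivrMr //; near: n; exact: near_powR_ge.
have [m0 mC Cm] := truncn_scale C _ hC Cn; rewrite -hm in m0 mC Cm.
(* The scale of the stochastic term is the order of the bias. *)
pose e : R := n%:R `^ (- (s * a)).
have e0 : 0 < e by exact: powR_gt0.
have C20 : 0 < C / 2 by rewrite divr_gt0.
have -> : n%:R `^ (- p * s * (1 - delta) / (2 * s + 1)) = e `^ p.
  by rewrite /e -powRrM; congr (_ `^ _); rewrite /a; ring.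
have mr0 : 0 < (m n)%:R :> R by rewrite ltr0n.
have ms : (m n)%:R `^ (- s) <= (C / 2) `^ (- s) * e.
  have -> : e = (n%:R `^ a) `^ (- s).
    by rewrite /e -powRrM; congr (_ `^ _); ring.
  rewrite -powRM ?powR_ge0 ?(ltW C20) // !powRN lef_pV2 ?posrE ?powR_gt0 //.
    by rewrite ge0_ler_powR ?nnegrE ?mulr_ge0 ?powR_ge0 ?(ltW C20) // ltW.
  by rewrite mulr_gt0 // powR_gt0.
set b := Kb * ((C / 2) `^ (- s) * e) `^ p.
have b0 : 0 <= b by rewrite mulr_ge0 ?powR_ge0.
apply: (le_trans (risk f n (m n) e b mf m0 e0 b0 _)).
  apply: (le_trans (bias _ m0)); rewrite lee_fin ler_wpM2l //.
  by rewrite ge0_ler_powR ?nnegrE ?mulr_ge0 ?powR_ge0 ?(ltW p0) // ltW.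
(* The exponents match: a + delta - 1 = - 2 s a. *)
have e2 : (m n)%:R / n%:R * ((`|M| + 1) * n%:R `^ delta) <=
    C * (`|M| + 1) * e ^+ 2.
  have M0 : 0 <= `|M| + 1 by rewrite addr_ge0.
  have -> : e ^+ 2 = n%:R `^ a / n%:R * n%:R `^ delta.
    have nn : (n%:R : R) != 0 by rewrite gt_eqF.
    rewrite -powR_mulrn ?powR_ge0 // -[X in _ / X]powRr1 ?(ltW nr0) //.
    rewrite -powRN -!powRD ?nn ?implybT // -powRrM; congr (_ `^ _).
    by rewrite /a; field; rewrite gt_eqF //; lra.
  have -> : C * (`|M| + 1) * (n%:R `^ a / n%:R * n%:R `^ delta) =
      C * n%:R `^ a / n%:R * ((`|M| + 1) * n%:R `^ delta) by ring.
  rewrite ler_wpM2r ?mulr_ge0 ?powR_ge0 // ler_wpM2r ?invr_ge0 //.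
have S1 : (\sum_(0 <= k < n.+1) beta1 kappa k + 1 <=
    ((`|M| + 1) * n%:R `^ delta)%:E)%E.
  rewrite mulrDl mul1r EFinD; apply: leeD.
    apply: (@le_trans _ _ (M * n%:R `^ delta)%:E); first by near: n.
    by rewrite lee_fin ler_wpM2r ?powR_ge0 // ler_norm.
  have -> : 1%E = (1 `^ delta)%:E :> \bar R by rewrite powR1.
  by rewrite lee_fin ge0_ler_powR ?nnegrE // ler1n.
have -> : (4 * (1 + Kb * ((C / 2) `^ (- s)) `^ p) + Kr * (Kv * (C * (`|M| + 1)))) * e `^ p =
    4 * (e `^ p + b) + Kr * e `^ (p - 2) * (Kv * (C * (`|M| + 1) * e ^+ 2)).
  have ep : e `^ p = e `^ (p - 2) * e ^+ 2.
    rewrite -powR_mulrn ?(ltW e0) // -powRD ?subrK //.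
    by rewrite (gt_eqF e0) implybT.
  have E (k u v w x y z : R) : (4 * (1 + k * u) + v * (w * x)) * (y * z) =
    4 * (y * z + k * (u * (y * z))) + v * y * (w * (x * z)) by ring.
  by rewrite /b (powRM _ (powR_ge0 (C / 2) (- s)) (ltW e0)) ep; exact: E.
rewrite EFinD; apply: leeD => //; rewrite [leRHS]EFinM; apply: lee_wpmul2l.
  by rewrite lee_fin mulr_ge0 ?powR_ge0.
apply: (le_trans (var n (m n) n0 m0)).
apply: (@le_trans _ _ ((Kv * ((m n)%:R / n%:R))%:E *
    ((`|M| + 1) * n%:R `^ delta)%:E)%E).
  by apply: lee_wpmul2l => //; rewrite lee_fin mulr_ge0 // divr_ge0.
by rewrite -EFinM lee_fin -[leLHS]mulrA ler_wpM2l.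
Unshelve. all: by end_near. Qed.
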